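(* Let $\mathbb{F}$ be an algebraically closed field with $\operatorname{char}\mathbb{F}\neq 2$, let $n\geq 2$, and let $Q=Q(n)=Q^{\bar 0}\oplus Q^{\bar 1}$ be either the simple Lie superalgebra $Q(n)$ over $\mathbb{F}$ (in which case assume in addition that $\operatorname{char}\mathbb{F}$ does not divide $n+1$) or the simple Jordan superalgebra $Q(n)$ over $\mathbb{F}$. If $\Gamma$ is a fine grading on the algebra $Q^{\bar 0}$ with universal group $G$ and distinguished element $h\in G$, put $\tilde{\Gamma}=\Gamma\oplus\underline{\Gamma}^{[h^{1/2}]}$. Then: 1. For every fine grading $\Gamma$ on $Q^{\bar 0}$ with universal group $G$, $\tilde{\Gamma}$ is a fine grading on the superalgebra $Q$ with universal group $G[h^{1/2}]$. 2. Every fine grading on $Q$, regarded as a grading by its universal group, has the form $\tilde{\Gamma}$ for some fine grading $\Gamma$ on $Q^{\bar 0}$. 3. For fine gradings $\Gamma$ and $\Delta$ on $Q^{\bar 0}$, $\tilde{\Gamma}$ and $\tilde{\Delta}$ are equivalent if and only if $\Gamma$ and $\Delta$ are equivalent.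
   Context: Groups are written multiplicatively with identity $e$. All grading groups are abelian. All spaces are finite-dimensional over $\mathbb{F}$. **The superalgebras.** $M_k$ is the algebra of $k\times k$ matrices over $\mathbb{F}$. For $A_k=M_k\oplus uM_k$, the associative superalgebra with even part $M_k$ and odd part $uM_k$, where $u$ is odd, commutes with $M_k$ and $u^2=1$: - Lie case: $Q(n)$ is the quotient by its center $\mathbb{F}1$ of the derived superalgebra of $A_{n+1}$ under the supercommutator $[x,y]=xy-(-1)^{ij}yx$ ($x$ of parity $i$, $y$ of parity $j$). When $\operatorname{char}\mathbb{F}\nmid n+1$, put $a^\sharp=a-\frac{1}{n+1}\operatorname{tr}(a)1$; then $Q(n)$ is identified (via $a+ub+\mathbb{F}1\mapsto(a^\sharp,b)$) with $\mathfrak{sl}(n+1)\oplus\mathfrak{sl}(n+1)$ (even part $\oplus$ odd part). Writing $x$ for $(x,0)$ and $\underline{x}$ for $(0,x)$, the bracket is $[a,b]=ab-ba$, $[a,\underline{b}]=\underline{ab-ba}$, $[\underline{a},\underline{b}]=(ab+ba)^\sharp$ (and $[\underline b,a]=-[a,\underline b]$). So $Q^{\bar 0}=\mathfrak{sl}(n+1)$. - Jordan case: $Q(n)$ is $A_n$ with the product $x\circ y=xy+(-1)^{ij}yx$. It is identified with $M_n\oplus M_n$ via $a+ub\mapsto(a,b)$; writing $x$ for $(x,0)$ and $\underline{x}$ for $(0,x)$, the product is $a\circ b=ab+ba$, $a\circ\underline{b}=\underline{b}\circ a=\underline{ab+ba}$, $\underline{a}\circ\underline{b}=ab-ba$. So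 $Q^{\bar 0}=M_n^{(+)}$, the Jordan algebra $M_n$ with product $ab+ba$. In both cases $x\mapsto\underline{x}$ is an isomorphism of $Q^{\bar 0}$-modules $Q^{\bar 0}\to Q^{\bar 1}$. **Gradings.** A $G$-grading on a superalgebra $A$ is a vector space decomposition $A=\bigoplus_{g\in G}A_g$ with $A_gA_k\subseteq A_{gk}$ and $A_g=(A_g\cap A^{\bar 0})\oplus(A_g\cap A^{\bar 1})$ for all $g,k\in G$ (for ordinary algebras, with zero odd part, the second condition is vacuous). Its support is $\{g\in G\mid A_g\neq0\}$. Homomorphisms of superalgebras preserve parity. - Universal group: for a grading with support $S$ (by some abelian group), its universal group is the abelian group generated by $S$ with defining relations $s_1s_2=s_3$ for all $s_1,s_2,s_3\in S$ with $0\neq A_{s_1}A_{s_2}\subseteq A_{s_3}$; the grading may be regarded as a grading by its universal group. - Equivalence: gradings $A=\bigoplus_{g\in G}A_g$ and $B=\bigoplus_{k\in H}B_k$ with supports $S$ and $T$ are equivalent if there are an isomorphism of (super)algebras $\varphi:A\to B$ and a bijection $\alpha:S\to T$ with $\varphi(A_s)=B_{\alpha(s)}$ for all $s\in S$. - Fine: a grading $\Gamma'$ on $A$ is a refinement of a grading $\Gamma$ on $A$ if every nonzero component of $\Gamma'$ is contained in a component of $\Gamma$; it is proper if at least one of these inclusions is strict. A grading is fine if it has no proper refinement (among gradings by abelian groups). **Type and distinguished element.** Let $S=\mathfrak{sl}(n+1)$ and $R=M_{n+1}$ (Lie case) or $S=M_n^{(+)}$ and $R=M_n$ (Jordan case).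 A $G$-grading $\Gamma$ on $S=Q^{\bar 0}$ is of Type I if it is the restriction to $S$ of a $G$-grading of the associative algebra $R$ (in the Jordan case: if it is a grading of the associative algebra $M_n$), and of Type II otherwise. If $\Gamma$ is of Type II, there is a unique element $h\in G$ of order $2$ such that the coarsening of $\Gamma$ induced by $G\to G/\langle h\rangle$ (the component of degree $g\langle h\rangle$ being $S_g\oplus S_{gh}$) is of Type I; this $h$ is the distinguished element of $\Gamma$. If $\Gamma$ is of Type I, its distinguished element is $h=e$. **Notation.** For an abelian group $G$ and $h\in G$, $G[h^{1/2}]$ is the abelian group generated by $G$ and a new element $d$ subject only to the relation $d^2=h$; this $d$ is denoted $h^{1/2}$. $G$ is regarded as a subgroup of $G[h^{1/2}]$, so a $G$-grading is also a $G[h^{1/2}]$-grading. For a grading $\Gamma:V=\bigoplus_g V_g$ on a vector space and a group element $d$, the shift $\Gamma^{[d]}$ is obtained by relabeling the component $V_g$ as $V_{gd}$ for all $g$. For a $G$-grading $\Gamma$ on $Q^{\bar 0}$, $\underline{\Gamma}$ is the $G$-grading on $Q^{\bar 1}$ with components $\{\underline{x}\mid x\in Q^{\bar 0}_g\}$. For gradings $\Gamma$ on $V=Q^{\bar 0}$ and $\Delta$ on $W=Q^{\bar 1}$ by the same group, $\Gamma\oplus\Delta$ is the decomposition of $V\oplus W$ with components $V_g\oplus W_g$. *)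

(* Defs.v *)
From HB Require Import structures.
From mathcomp Require Import all_boot all_order all_algebra.
From mathcomp Require Import generic_quotient ring_quotient.
From mathcomp Require Import boolp classical_sets.
From mathcomp.multinomials Require Import freeg.

Set Implicit Arguments.
Unset Strict Implicit.
Unset Printing Implicit Defensive.

Import GRing.Theory.
Local Open Scope ring_scope.
Local Open Scope quotient_scope.

(* Grading groups are arbitrary abelian groups, so they are taken to be of     *)
(* type zmodType and are written additively: gh, g^-1, e and d^2 = h become    *)
(* g + h, - g, 0 and d *+ 2 = h.                                               *)

Section Subgroups.
Variables (V : zmodType) (R : V -> Prop).

Inductive gen_subgroup : V -> Prop :=
| gen_mem x : R x -> gen_subgroup x
| gen_zero : gen_subgroup 0
| gen_sub x y : gen_subgroup x -> gen_subgroup y -> gen_subgroup (x - y).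

Definition gen_subgroup_pred : {pred V} := fun x => `[< gen_subgroup x >].

Fact gen_subgroup_closed : zmod_closed gen_subgroup_pred.
Proof.
split; first exact/asboolP/gen_zero.
by move=> x y /asboolP gx /asboolP gy; apply/asboolP/gen_sub.
Qed.

HB.instance Definition _ :=
  GRing.isZmodClosed.Build V gen_subgroup_pred gen_subgroup_closed.

(* The quotient of V by the subgroup generated by R. *)
Definition quot_by : zmodType := Quotient.quot gen_subgroup_pred.

Definition quot_pi (x : V) : quot_by := \pi_quot_by x.

End Subgroups.

(* The carrier of a superalgebra is the subspace part false + part true of the *)
(* ambient vector space; the values of sprod outside of it are irrelevant.     *)
(* This avoids coercions between sl_k and 'M_k. An ordinary algebra has        *)
(* part true = 0.                                                              *)
Record superalgebra (F : fieldType) := Superalgebra {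
  ambient : vectType F;
  sprod : ambient -> ambient -> ambient;
  part : bool -> {vspace ambient}  (* false: even part, true: odd part *)
}.

Section Gradings.
Variable F : fieldType.
Implicit Types A B : superalgebra F.

Definition carrier A : {vspace ambient A} := (part A false + part A true)%VS.

Definition superalgebra_axioms A : Prop :=
  [/\ forall a x y z, sprod (a *: x + y) z = a *: sprod x z + sprod y z :> ambient A,
      forall a x y z, sprod z (a *: x + y) = a *: sprod z x + sprod z y :> ambient A,
      directv (part A false + part A true)
    & forall (i j : bool) x y, x \in part A i -> y \in part A j ->
        sprod x y \in part A (i (+) j)].

Definition is_grading A (G : zmodType) (Gam : G -> {vspace ambient A}) : Prop :=
  [/\ forall g, (Gam g <= carrier A)%VS,
      forall x, x \in carrier A -> exists s : seq G, x \in (\sum_(g <- s) Gam g)%VS,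
      forall s : seq G, uniq s -> directv (\sum_(g <- s) Gam g),
      forall g k x y, x \in Gam g -> y \in Gam k -> sprod x y \in Gam (g + k)
    & forall g, Gam g = ((Gam g :&: part A false) + (Gam g :&: part A true))%VS].

Definition supp (V : vectType F) (G : zmodType) (Gam : G -> {vspace V}) : choiceType :=
  {g : G | Gam g != 0%VS}.

(* The defining relations s1 + s2 - s3 of the universal group, as elements of  *)
(* the free abelian group on the support.                                      *)
Definition univ_relator A (G : zmodType) (Gam : G -> {vspace ambient A})
    (u : {freeg (supp Gam) / int}) : Prop :=
  exists s1 s2 s3 : supp Gam,
    [/\ exists x y, [/\ x \in Gam (val s1), y \in Gam (val s2) & sprod x y != 0],
        forall x y, x \in Gam (val s1) -> y \in Gam (val s2) ->
          sprod x y \in Gam (val s3)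
      & u = << s1 >> + << s2 >> - << s3 >>].

Definition univ_group A (G : zmodType) (Gam : G -> {vspace ambient A}) : zmodType :=
  quot_by (@univ_relator A G Gam).

Definition univ_class A (G : zmodType) (Gam : G -> {vspace ambient A})
    (s : supp Gam) : univ_group Gam :=
  quot_pi (@univ_relator A G Gam) << s >>.

(* G is the universal group of Gam: the homomorphism univ_group Gam -> G that  *)
(* is the identity on the support is an isomorphism.                           *)
Definition has_univ_group A (G : zmodType) (Gam : G -> {vspace ambient A}) : Prop :=
  exists f : {additive univ_group Gam -> G},
    bijective f /\ forall s : supp Gam, f (univ_class s) = val s.

(* The family W relabeled along j (meant for j injective on its labels); the   *)
(* components at labels outside of the image of j are zero.                    *)
Definition relabel (V : vectType F) (X K : Type) (j : X -> K) (W : X -> {vspace V})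
    (k : K) : {vspace V} :=
  if pselect (exists x, j x = k) is left e then W (projT1 (cid e)) else 0%VS.

Definition univ_grading A (G : zmodType) (Gam : G -> {vspace ambient A}) :
    univ_group Gam -> {vspace ambient A} :=
  relabel (@univ_class A G Gam) (fun s => Gam (val s)).

Definition refines (V : vectType F) (K G : zmodType)
    (Gam' : K -> {vspace V}) (Gam : G -> {vspace V}) : Prop :=
  forall k, Gam' k != 0%VS -> exists g, (Gam' k <= Gam g)%VS.

Definition properly_refines (V : vectType F) (K G : zmodType)
    (Gam' : K -> {vspace V}) (Gam : G -> {vspace V}) : Prop :=
  refines Gam' Gam /\
  exists k g, [/\ Gam' k != 0%VS, (Gam' k <= Gam g)%VS & Gam' k != Gam g].

Definition is_fine A (G : zmodType) (Gam : G -> {vspace ambient A}) : Prop :=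
  is_grading Gam /\
  ~ exists (K : zmodType) (Gam' : K -> {vspace ambient A}),
      is_grading Gam' /\ properly_refines Gam' Gam.

Definition is_isomorphism A B (phi : 'Hom(ambient A, ambient B)) : Prop :=
  [/\ (phi @: carrier A)%VS = carrier B,
      (lker phi :&: carrier A)%VS = 0%VS,
      forall x y, x \in carrier A -> y \in carrier A ->
        phi (sprod x y) = sprod (phi x) (phi y)
    & forall i, (phi @: part A i <= part B i)%VS].

Definition equivalent A B (G H : zmodType)
    (Gam : G -> {vspace ambient A}) (Del : H -> {vspace ambient B}) : Prop :=
  exists (phi : 'Hom(ambient A, ambient B)) (alpha : supp Gam -> supp Del),
    [/\ is_isomorphism phi, bijective alpha
      & forall s, (phi @: Gam (val s))%VS = Del (val (alpha s))].

End Gradings.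

Arguments univ_grading {F A G} Gam _.

Section SquareRoot.
Variables (G : zmodType) (h : G).

(* G[h^{1/2}] = (G x Z) / <(-h, 2)>, with d the class of (0, 1). *)
Definition sqrt_relator (x : (G * int)%type) : Prop := x = (- h, 2).
Definition sqrt_ext : zmodType := quot_by sqrt_relator.
Definition sqrt_in (g : G) : sqrt_ext := quot_pi sqrt_relator (g, 0).
Definition sqrt_elt : sqrt_ext := quot_pi sqrt_relator (0, 1).

End SquareRoot.

Section Algebras.
Variable F : fieldType.

Definition pairv (U V : vectType F) (X : {vspace U}) (Y : {vspace V}) :
    {vspace (U * V)%type} :=
  (linfun fst @^-1: X :&: linfun snd @^-1: Y)%VS.

Lemma mem_pairv (U V : vectType F) (X : {vspace U}) (Y : {vspace V}) x :
  (x \in pairv X Y) = (x.1 \in X) && (x.2 \in Y).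
Proof. by rewrite memv_cap -!memv_preim !lfunE. Qed.

Section Matrices.
Variable k : nat.
Implicit Types a b : 'M[F]_k.

Definition comm a b := a *m b - b *m a.
Definition acomm a b := a *m b + b *m a.
Definition sharp a := a - (k%:R^-1 * \tr a)%:M.

Definition sl : {vspace 'M[F]_k} := lker (linfun (mxtrace : 'M[F]_k -> F^o)).

Lemma mem_sl a : (a \in sl) = (\tr a == 0).
Proof. by rewrite memv_ker lfunE. Qed.

Definition assoc_alg : superalgebra F :=
  @Superalgebra F 'M[F]_k mulmx (fun i => if i then 0%VS else fullv).

End Matrices.

Variant qcase := Lie | Jordan.

(* The size of the matrices from which Q(n) is built. *)
Definition qdim (c : qcase) (n : nat) : nat :=
  match c with Lie => n.+1 | Jordan => n end.

Section Queer.
Variables (c : qcase) (n : nat).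
Local Notation M := 'M[F]_(qdim c n).

Definition q0space : {vspace M} := if c is Lie then sl (qdim c n) else fullv.

Definition q0prod (a b : M) : M := if c is Lie then comm a b else acomm a b.

(* The product of two odd elements. *)
Definition qodd (a b : M) : M := if c is Lie then sharp (acomm a b) else comm a b.

Definition Q0 : superalgebra F :=
  @Superalgebra F M q0prod (fun i => if i then 0%VS else q0space).

(* (a, b) stands for a + \underline{b}. In both cases                          *)
(* \underline{a} b = \underline{ab}, the product on the right being the one of *)
(* the even part.                                                              *)
Definition Q : superalgebra F :=
  @Superalgebra F (M * M)%type
    (fun x y => (q0prod x.1 y.1 + qodd x.2 y.2, q0prod x.1 y.2 + q0prod x.2 y.1))
    (fun i => if i then pairv 0%VS q0space else pairv q0space 0%VS).

Definition typeI (G : zmodType) (Gam : G -> {vspace M}) : Prop :=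
  exists Del : G -> {vspace M},
    is_grading (A := assoc_alg (qdim c n)) Del /\
    forall g, Gam g = (Del g :&: q0space)%VS.

(* Coarsening induced by G -> G / <h>, for h of order 2: the coset g + <h> is  *)
(* then {g, g + h}.                                                            *)
Definition coarsening2 (G : zmodType) (h : G) (Gam : G -> {vspace M}) :
    quot_by (fun x : G => x = h) -> {vspace M} :=
  fun q => (Gam (repr q) + Gam (repr q + h)%R)%VS.

(* For a grading of Type II this is the unique element with the given          *)
(* property, selected by classical choice.                                     *)
Definition distinguished (G : zmodType) (Gam : G -> {vspace M}) : G :=
  if pselect (typeI Gam) then 0
  else xget 0 [set h | [/\ h != 0, h *+ 2 = 0 & typeI (coarsening2 (h := h) Gam)]]%classic.

Definition tilde (G : zmodType) (Gam : G -> {vspace M}) :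
    sqrt_ext (distinguished Gam) -> {vspace (M * M)%type} :=
  let h := distinguished Gam in
  fun q => pairv (relabel (sqrt_in h) Gam q)
                 (relabel (sqrt_in h) Gam (q - sqrt_elt h)).

End Queer.
End Algebras.

Arguments distinguished {F c n G} Gam.
Arguments tilde {F c n G} Gam _.

Lemma gen_subgroup1 (V : zmodType) (r x : V) :
  gen_subgroup (fun y => y = r) x -> exists m : int, x = r *~ m.
Proof.
elim=> [_ ->|| _ _ _ [p ->] _ [q ->]]; first by exists 1.
  by exists 0.
by exists (p - q); rewrite mulrzBr.
Qed.

Lemma quot_pi_eq (V : zmodType) (R : V -> Prop) (x y : V) :
  quot_pi R x = quot_pi R y <-> gen_subgroup R (x - y).
Proof.
split=> [/eqP|g]; last apply/eqP; rewrite /quot_pi -Quotient.idealrBE.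
  by move=> /asboolP.
exact/asboolP.
Qed.

Lemma sqrt_in_inj (G : zmodType) (h : G) : injective (sqrt_in h).
Proof.
have sndM (x : (G * int)%type) m : (x *~ m).2 = x.2 *~ m by exact: raddfMz.
move=> g g' /quot_pi_eq /gen_subgroup1 [m E].
have : (((g, 0) - (g', 0)) : (G * int)%type).2 = 0 by rewrite /= subrr.
rewrite E sndM /= -mulrzr => /eqP; rewrite mulf_eq0 /= intz => /eqP m0.
by move: E; rewrite m0 mulr0z => -[/eqP]; rewrite subr_eq0 => /eqP.
Qed.

Lemma sqrt_eltE (G : zmodType) (h : G) : sqrt_elt h *+ 2 = sqrt_in h h.
Proof.
rewrite /sqrt_elt /quot_pi -raddfMn; apply/quot_pi_eq/gen_mem.
by rewrite /sqrt_relator mulr2n; congr (_, _); rewrite /= addr0 sub0r.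
Qed.

Section Laws.
Variable F : fieldType.

Lemma assoc_alg_axioms k : superalgebra_axioms (assoc_alg F k).
Proof.
split=> /= [a x y z|a x y z||[] [] x y] /=.
- by rewrite mulmxDl scalemxAl.
- by rewrite mulmxDr scalemxAr.
- by apply/directv_addP; rewrite capv0.
- by rewrite memvf.
- by rewrite !memv0 => /eqP-> _; rewrite mul0mx.
- by rewrite !memv0 => _ /eqP->; rewrite mulmx0.
- by rewrite !memvf.
Qed.

Variables (c : qcase) (n : nat).
Local Notation M := 'M[F]_(qdim c n).

Lemma commDl k a (x y z : 'M[F]_k) : comm (a *: x + y) z = a *: comm x z + comm y z.
Proof.
by rewrite /comm mulmxDl mulmxDr -scalemxAl -scalemxAr scalerBr opprD addrACA.
Qed.

Lemma commDr k a (x y z : 'M[F]_k) : comm z (a *: x + y) = a *: comm z x + comm z y.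
Proof.
by rewrite /comm mulmxDl mulmxDr -scalemxAl -scalemxAr scalerBr opprD addrACA.
Qed.

Lemma acommDl k a (x y z : 'M[F]_k) : acomm (a *: x + y) z = a *: acomm x z + acomm y z.
Proof.
by rewrite /acomm mulmxDl mulmxDr -scalemxAl -scalemxAr scalerDr addrACA.
Qed.

Lemma acommC k (x y : 'M[F]_k) : acomm x y = acomm y x.
Proof. by rewrite /acomm addrC. Qed.

Lemma sharpD k a (x y : 'M[F]_k) : sharp (a *: x + y) = a *: sharp x + sharp y.
Proof.
rewrite /sharp mxtraceD mxtraceZ mulrDr raddfD /= mulrCA scalerBr scale_scalar_mx.
by rewrite opprD addrACA.
Qed.

Lemma q0prodDl a (x y z : M) : q0prod (a *: x + y) z = a *: q0prod x z + q0prod y z.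
Proof. by rewrite /q0prod; case: c x y z => x y z; rewrite (commDl, acommDl). Qed.

Lemma q0prodDr a (x y z : M) : q0prod z (a *: x + y) = a *: q0prod z x + q0prod z y.
Proof.
by rewrite /q0prod; case: c x y z => x y z; rewrite ?commDr // ![acomm z _]acommC acommDl.
Qed.

Lemma qoddDl a (x y z : M) : qodd (a *: x + y) z = a *: qodd x z + qodd y z.
Proof. by rewrite /qodd; case: c x y z => x y z; rewrite ?commDl ?acommDl ?sharpD. Qed.

Lemma qoddDr a (x y z : M) : qodd z (a *: x + y) = a *: qodd z x + qodd z y.
Proof.
by rewrite /qodd; case: c x y z => x y z; rewrite ?commDr // ![acomm z _]acommC acommDl sharpD.
Qed.

Lemma q0prod_closed (x y : M) : q0prod x y \in q0space F c n.
Proof.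
rewrite /q0prod /q0space; case: c x y => x y; rewrite ?memvf //.
by rewrite mem_sl raddfB /= mxtrace_mulC subrr.
Qed.

Lemma qodd_closed (x y : M) : (c = Lie -> (n.+1)%:R != 0 :> F) ->
  qodd x y \in q0space F c n.
Proof.
rewrite /qodd /q0space; case: c x y => x y; rewrite ?memvf // => /(_ erefl) n0.
by rewrite mem_sl raddfB /= mxtrace_scalar -[_ * _ *+ _]mulr_natl mulVKf // subrr.
Qed.

Lemma Q0_axioms : superalgebra_axioms (Q0 F c n).
Proof.
have q0 (x : M) : q0prod 0 x = 0.
  by move: (q0prodDl (-1) 0 0 x); rewrite scaler0 addr0 scaleN1r addNr.
have q1 (x : M) : q0prod x 0 = 0.
  by move: (q0prodDr (-1) 0 0 x); rewrite scaler0 addr0 scaleN1r addNr.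
split=> /= [a x y z|a x y z||[] [] x y] /=.
- exact: q0prodDl.
- exact: q0prodDr.
- by apply/directv_addP; rewrite capv0.
- by rewrite q0prod_closed.
- by rewrite !memv0 => /eqP-> _; rewrite q0.
- by rewrite !memv0 => _ /eqP->; rewrite q1.
- by rewrite q0prod_closed.
Qed.

Lemma Q_axioms : (c = Lie -> (n.+1)%:R != 0 :> F) -> superalgebra_axioms (Q F c n).
Proof.
move=> n0.
have q0 (x : M) : q0prod 0 x = 0.
  by move: (q0prodDl (-1) 0 0 x); rewrite scaler0 addr0 scaleN1r addNr.
have q1 (x : M) : q0prod x 0 = 0.
  by move: (q0prodDr (-1) 0 0 x); rewrite scaler0 addr0 scaleN1r addNr.
have p0 (x : M) : qodd 0 x = 0.
  by move: (qoddDl (-1) 0 0 x); rewrite scaler0 addr0 scaleN1r addNr.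
have p1 (x : M) : qodd x 0 = 0.
  by move: (qoddDr (-1) 0 0 x); rewrite scaler0 addr0 scaleN1r addNr.
split=> /= [a x y z|a x y z||[] [] [x x'] [y y']] /=.
- by congr (_, _) => /=; rewrite !(q0prodDl, qoddDl) scalerDr addrACA.
- by congr (_, _) => /=; rewrite !(q0prodDr, qoddDr) scalerDr addrACA.
- apply/directv_addP/eqP; rewrite -subv0; apply/subvP=> -[x y].
  rewrite memv_cap !mem_pairv /= !memv0 => /andP[/andP[_ /eqP->]].
  by move=> /andP[/eqP->].
- rewrite !mem_pairv /= !memv0 => /andP[/eqP-> _] /andP[/eqP-> _].
  by rewrite !q0 q1 !add0r eqxx andbT qodd_closed.
- rewrite !mem_pairv /= !memv0 => /andP[/eqP-> _] /andP[_ /eqP->].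
  by rewrite !q0 p1 !add0r eqxx q0prod_closed.
- rewrite !mem_pairv /= !memv0 => /andP[_ /eqP->] /andP[/eqP-> _].
  by rewrite !q1 p0 !addr0 eqxx q0prod_closed.
- rewrite !mem_pairv /= !memv0 => /andP[_ /eqP->] /andP[_ /eqP->].
  by rewrite p0 q0 q1 !addr0 eqxx q0prod_closed.
Qed.

End Laws.

(* Main.v *)
(* Write S for the even part and * for the product of odd elements, transported
   to S by x |-> \underline{x}. The only facts about S that matter are that its
   centroid is F and that * is determined up to a scalar by finitely many
   multilinear identities involving the product of S (being (anti)symmetric,
   equivariant under inner derivations and, in the Jordan case, being a
   derivation in the second argument). These identities are inherited by the
   homogeneous components of * with respect to a G-grading of S, and by the
   transport of * along an automorphism of S. Hence * is homogeneous of some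
   degree h, and every automorphism of S extends to Q. The associator of *
   gives h^2 = e, and the grading is of Type I if and only if h = e, because
   the associative product is a combination of *, of the product of S and (for
   Lie) of the trace form; applied to the coarsenings modulo subgroups of
   order 2, this shows that h is the distinguished element. As the centroid is
   F, a grading of Q amounts to a grading Gamma of S together with the degree d
   of x |-> \underline{x}, subject to d^2 = h. Refinements of gradings of Q are
   thus refinements of gradings of S together with a square root of h, and the
   universal choice of that root is h^{1/2} in G[h^{1/2}]. *)

Require Import Defs.
From HB Require Import structures.
From mathcomp Require Import all_boot all_algebra ring.
From mathcomp Require Import generic_quotient ring_quotient.
From mathcomp Require Import boolp classical_sets.
From mathcomp.multinomials Require Import freeg.

Set Implicit Arguments.
Unset Strict Implicit.
Unset Printing Implicit Defensive.

Import GRing.Theory.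
Local Open Scope ring_scope.
Local Open Scope quotient_scope.

(** * Decompositions of a subspace *)

(** The characteristic may be positive, so the uniqueness of the odd product cannot rest on complete
    reducibility; it is proved with matrix units. An equivariant bilinear map on sl is determined by
    its value at (E_ij, E_ji), a diagonal matrix with few free entries, and only 2 and, in the Lie
    case, n+1 are inverted. On M_n equivariance alone is too weak, since traces and scalar matrices
    give further equivariant maps; hence the derivation identity in the Jordan case. The operators x
    |-> a(bx) - b(ax) serve as inner derivations in both cases: they equal ad [a, b] and are written
    with the even product alone, so gradings and automorphisms of S respect them. In the Lie case
    the associator of * carries two terms from the trace form, which have to be separated by degree
    before h^2 = e or Type I follows. That the field is algebraically closed enters through a square
    root: an automorphism of S multiplies * by a scalar a, and the odd part is rescaled by a root of
    1/a. *)

Section Decompositions.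
Variables (F : fieldType) (V : vectType F) (G : zmodType).
Implicit Types (W : {vspace V}) (Gam : G -> {vspace V}).

Definition spanned Gam (x : V) : Prop :=
  exists s : seq G, x \in (\sum_(g <- s) Gam g)%VS.

Definition decomposes W Gam : Prop :=
  [/\ forall g, (Gam g <= W)%VS, forall x, x \in W -> spanned Gam x
    & forall s : seq G, uniq s -> directv (\sum_(g <- s) Gam g)].

Lemma spanned_mem Gam g x : x \in Gam g -> spanned Gam x.
Proof. by move=> xg; exists [:: g]; rewrite big_seq1. Qed.

Lemma spannedD Gam x y : spanned Gam x -> spanned Gam y -> spanned Gam (x + y).
Proof. by move=> [s xs] [t yt]; exists (s ++ t); rewrite big_cat memv_add. Qed.

Lemma decomposes_ind W Gam (P : V -> Prop) : decomposes W Gam ->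
    (forall g x, x \in Gam g -> P x) ->
    (forall x y, x \in W -> y \in W -> P x -> P y -> P (x + y)) ->
  forall x, x \in W -> P x.
Proof.
move=> [sW span _] Phom PD x /span[s].
suff H : x \in (\sum_(g <- s) Gam g)%VS -> x \in W /\ P x by move=> /H[].
elim: s x => [|g s IH] x.
  by rewrite big_nil memv0 => /eqP->; split; [rewrite mem0v | apply: (Phom 0); rewrite mem0v].
rewrite big_cons => /memv_addP[y yg [z /IH[zW Pz] ->]].
have yW := subvP (sW g) y yg.
by split; [rewrite memvD | apply: PD => //; apply: Phom yg].
Qed.

Lemma directv_seqE Gam (s : seq G) :
  directv (\sum_(g <- s) Gam g) = (\dim (\sum_(g <- s) Gam g) == \sum_(g <- s) \dim (Gam g))%N.
Proof. by rewrite directvE. Qed.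

(** An endomorphism that is the identity on [Gam g] and kills the other components separates [Gam g]
    from every sum of them. In the applications such projectors are built from those of
    [decomposes_proj]. *)
Lemma decomposesI W Gam :
    (forall g, (Gam g <= W)%VS) -> (forall x, x \in W -> spanned Gam x) ->
    (forall g, exists p : 'End(V),
       {in Gam g, p =1 id} /\ forall k, k != g -> {in Gam k, p =1 (fun=> 0)}) ->
  decomposes W Gam.
Proof.
move=> sW span proj; split=> // s; rewrite directv_seqE.
elim: s => [_|g s IH]; first by rewrite !big_nil dimv0.
rewrite !big_cons => /andP[gs /IH/eqP <-].
rewrite dimv_disjoint_sum //; apply/eqP; rewrite -subv0; apply/subvP=> x.
have [p [pg pk]] := proj g.
rewrite memv_cap memv0 => /andP[xg xs]; rewrite -(pg x xg) -memv_ker.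
apply: (subvP _ x xs); elim: {IH xs} s gs => [|k s IH] gs.
  by rewrite big_nil sub0v.
move: gs; rewrite inE negb_or => /andP[gk gs]; rewrite big_cons subv_add IH // andbT.
by apply/subvP=> y yk; rewrite memv_ker (pk k) // eq_sym.
Qed.

(** Each vector of a basis of [W] lies in a finite sum of components; the concatenated index lists
    serve all of [W]. *)
Lemma decomposes_support W Gam : decomposes W Gam ->
  exists2 s : seq G, uniq s & W = (\sum_(g <- s) Gam g)%VS.
Proof.
move=> [sW span _].
have mono (s t : seq G) : {subset s <= t} ->
    (\sum_(g <- s) Gam g <= \sum_(g <- t) Gam g)%VS.
  move=> st; elim: s st => [|g s IH] st; first by rewrite big_nil sub0v.
  rewrite big_cons subv_add IH; last by move=> x xs; apply: st; rewrite inE xs orbT.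
  by rewrite andbT (big_rem g) ?st ?mem_head //= addvSl.
suff [s Ws] : exists s : seq G, (<<vbasis W>> <= \sum_(g <- s) Gam g)%VS.
  exists (undup s); first exact: undup_uniq.
  apply/eqP; rewrite eqEsubv -{1}(span_basis (vbasisP W)).
  rewrite (subv_trans Ws) /=; last by apply: mono => x; rewrite mem_undup.
  by elim: (undup s) => [|g t IH]; rewrite ?big_nil ?sub0v // big_cons subv_add sW.
have : forall x, x \in (vbasis W : seq V) -> x \in W by move=> x; apply: vbasis_mem.
elim: (vbasis W : seq V) => [|x t IH] tW; first by exists [::]; rewrite span_nil sub0v.
have [|s ts] := IH; first by move=> y yt; apply: tW; rewrite inE yt orbT.
have [|r xr] := span x; first by apply: tW; rewrite mem_head.
exists (r ++ s); rewrite span_cons subv_add big_cat /=.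
rewrite (subv_trans ts (addvSr _ _)) andbT; apply: subv_trans (addvSl _ _).
by rewrite -memvE.
Qed.

(** [p g] projects along the sum of the other components. It is available for every label: outside
    of the finite support [s] the component is zero, and so is [p g]. *)
Lemma decomposes_proj W Gam : decomposes W Gam ->
  exists (s : seq G) (p : G -> 'End(V)),
    [/\ uniq s, forall g x, p g x \in Gam g, forall g, {in Gam g, p g =1 id},
        forall g k, k != g -> {in Gam k, p g =1 (fun=> 0)}
      & forall x, x \in W -> x = \sum_(g <- s) p g x].
Proof.
move=> dW; have [s us Ws] := decomposes_support dW.
have [sW span dir] := dW.
have disj g t : uniq (g :: t) -> (Gam g :&: \sum_(k <- t) Gam k = 0)%VS.
  move=> u; have := dir _ u; rewrite directv_seqE !big_cons => /eqP D.
  have := dimv_sum_cap (Gam g) (\sum_(k <- t) Gam k); rewrite D => C.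
  apply/eqP; rewrite -dimv_eq0 -leqn0 -(leq_add2l (\dim (Gam g) + \sum_(k <- t) \dim (Gam k))).
  by rewrite addn0 C leq_add2l dimv_leq_sum.
have out g : g \notin s -> Gam g = 0%VS.
  move=> gs; have := disj g s; rewrite /= gs us -Ws => /(_ isT) <-.
  by apply/esym/capv_idPl.
have disjr g : (Gam g :&: \sum_(k <- rem g s) Gam k = 0)%VS.
  by apply: disj; rewrite /= mem_rem_uniqF // rem_uniq.
pose p g := daddv_pi (Gam g) (\sum_(k <- rem g s) Gam k).
have p1 g : {in Gam g, p g =1 id} by move=> x xg; apply: daddv_pi_id.
have p0 g k : k != g -> {in Gam k, p g =1 (fun=> 0)}.
  move=> kg x xk; have [ks|/out E] := boolP (k \in s); last first.
    by move: xk; rewrite E memv0 => /eqP->; rewrite linear0.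
  have xr : x \in (\sum_(k <- rem g s) Gam k)%VS.
    rewrite (big_rem k) ?mem_rem_uniq ?inE ?kg //=.
    exact: (subvP (addvSl _ _)).
  have := daddv_pi_add (disjr g) (subvP (addvSr _ _) x xr).
  rewrite (daddv_pi_id (etrans (capvC _ _) (disjr g)) xr) => /eqP.
  by rewrite -[eqbRHS]add0r (inj_eq (addIr x)) => /eqP.
exists s, p; split=> // [g x|]; first exact: memv_pi.
apply: (decomposes_ind dW) => [k x xk|x y _ _ {1}-> {1}->]; last first.
  by rewrite -big_split; apply: eq_bigr => g _; rewrite linearD.
have [ks|/out E] := boolP (k \in s); last first.
  by move: xk; rewrite E memv0 => /eqP->; rewrite big1 // => g _; rewrite linear0.
rewrite (bigD1_seq k) //= p1 // big1 ?addr0 // => g gk.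
by apply: (p0 _ k) => //; rewrite eq_sym.
Qed.

Lemma decomposes_eq_label W Gam g k x : decomposes W Gam ->
  x \in Gam g -> x \in Gam k -> x != 0 -> g = k.
Proof.
move=> /decomposes_proj[_ [p [_ _ p1 p0 _]]] xg xk; apply: contra_neq_eq => gk.
by rewrite -(p1 g x xg) (p0 g k) // eq_sym.
Qed.

End Decompositions.

Lemma vspace0Pn (F : fieldType) (V : vectType F) (U : {vspace V}) :
  reflect (exists2 x, x \in U & x != 0) (U != 0%VS).
Proof.
apply: (iffP idP) => [U0|[x xU]]; first by exists (vpick U); rewrite ?memv_pick ?vpick0.
by apply: contraNneq => U0; rewrite U0 memv0 in xU.
Qed.

(** * Equivariant bilinear maps on matrices *)

(** After full expansion both sides are linear in the matrix monomials, which become atoms for an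
    entrywise [ring]. *)
Ltac mx_ring :=
  rewrite /acomm /comm ?(mulmxDl, mulmxDr, mulNmx, mulmxN) ?mulmxA;
  repeat (move: (_ *m _) => ?);
  apply/matrixP=> ? ?; rewrite !mxE; ring.

Section MatrixProducts.
Variables (F : fieldType) (m : nat).
Local Notation M := 'M[F]_m.
Implicit Types x y z : M.

Lemma comm_jacobi z x y : comm z (comm x y) = comm (comm z x) y + comm x (comm z y).
Proof. mx_ring. Qed.

Lemma comm_acomm z x y : comm z (acomm x y) = acomm (comm z x) y + acomm x (comm z y).
Proof. mx_ring. Qed.

(** Source of the associator identities below: [qodd_qodd_Jordan], [qodd_qodd_Lie] and the Jordan
    half of [q0_centroid]. *)
Lemma comm_comm_acomm x y z :
  comm y (comm x z) = acomm (acomm x y) z - acomm x (acomm y z).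
Proof. mx_ring. Qed.

Lemma commC x y : comm y x = - comm x y.
Proof. by rewrite /comm opprB. Qed.

Lemma commxx x : comm x x = 0. Proof. exact: subrr. Qed.

Lemma comm_scalar x (a : F) : comm x a%:M = 0.
Proof. by rewrite /comm scalar_mxC subrr. Qed.

Lemma comm_sharp z x : comm z (sharp x) = comm z x.
Proof.
have := commDr (-1) (m%:R^-1 * \tr x)%:M x z.
by rewrite comm_scalar scaler0 add0r scaleN1r addrC.
Qed.

Lemma mxtrace_comm x y : \tr (comm x y) = 0.
Proof. by rewrite raddfB /= mxtrace_mulC subrr. Qed.

Lemma sharp_id x : \tr x = 0 -> sharp x = x.
Proof. by rewrite /sharp => ->; rewrite mulr0 raddf0 subr0. Qed.

Lemma comm_delta (a b c d : 'I_m) :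
  comm (delta_mx a b) (delta_mx c d) =
    delta_mx a d *+ (b == c) - delta_mx c b *+ (d == a) :> M.
Proof. by rewrite /comm !mul_delta_mx_cond. Qed.

Definition bilinear_map (f : M -> M -> M) : Prop :=
  (forall a x y z, f (a *: x + y) z = a *: f x z + f y z) /\
  (forall a x y z, f z (a *: x + y) = a *: f z x + f z y).

Section Bilinear.
Variable f : M -> M -> M.
Hypothesis f_bilin : bilinear_map f.

Lemma bilin0l z : f 0 z = 0.
Proof. by have := f_bilin.1 (-1) 0 0 z; rewrite scaler0 addr0 scaleN1r addNr. Qed.
Lemma bilin0r z : f z 0 = 0.
Proof. by have := f_bilin.2 (-1) 0 0 z; rewrite scaler0 addr0 scaleN1r addNr. Qed.
Lemma bilinZl a x z : f (a *: x) z = a *: f x z.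
Proof. by have := f_bilin.1 a x 0 z; rewrite addr0 bilin0l addr0. Qed.
Lemma bilinZr a x z : f z (a *: x) = a *: f z x.
Proof. by have := f_bilin.2 a x 0 z; rewrite addr0 bilin0r addr0. Qed.
Lemma bilinDl x y z : f (x + y) z = f x z + f y z.
Proof. by have := f_bilin.1 1 x y z; rewrite !scale1r. Qed.
Lemma bilinDr x y z : f z (x + y) = f z x + f z y.
Proof. by have := f_bilin.2 1 x y z; rewrite !scale1r. Qed.
Lemma bilinNl x z : f (- x) z = - f x z.
Proof. by rewrite -scaleN1r bilinZl scaleN1r. Qed.
Lemma bilinNr x z : f z (- x) = - f z x.
Proof. by rewrite -scaleN1r bilinZr scaleN1r. Qed.
Lemma bilinBl x y z : f (x - y) z = f x z - f y z.
Proof. by rewrite bilinDl bilinNl. Qed.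
Lemma bilinBr x y z : f z (x - y) = f z x - f z y.
Proof. by rewrite bilinDr bilinNr. Qed.

End Bilinear.

Lemma comm_bilin : bilinear_map (@comm F m).
Proof. by split=> *; rewrite (commDl, commDr). Qed.

Lemma acomm_bilin : bilinear_map (@acomm F m).
Proof. by split=> a x y z; rewrite ?acommDl // ![acomm z _]acommC acommDl. Qed.

Lemma sharp_acomm_bilin : bilinear_map (fun x y => sharp (acomm x y) : M).
Proof.
by split=> *; rewrite -sharpD (bilinDl acomm_bilin, bilinDr acomm_bilin)
  (bilinZl acomm_bilin, bilinZr acomm_bilin).
Qed.

Lemma bilin_comb (f g h : M -> M -> M) a b :
  bilinear_map f -> bilinear_map g -> bilinear_map h ->
  bilinear_map (fun x y => f x y - a *: g x y - b *: h x y).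
Proof.
move=> [fl fr] [gl gr] [hl hr].
by split=> c x y z; rewrite ?(fl, gl, hl) ?(fr, gr, hr); apply/matrixP=> ? ?; rewrite !mxE; ring.
Qed.

Definition equivariant (f : M -> M -> M) z :=
  forall x y, \tr x = 0 -> \tr y = 0 -> comm z (f x y) = f (comm z x) y + f x (comm z y).

Lemma sl_ind (P : M -> Prop) (j : 'I_m) :
    (forall a x y, P x -> P y -> P (a *: x + y)) ->
    (forall a b, a != b -> P (delta_mx a b)) ->
    (forall a, P (delta_mx a a - delta_mx j j)) ->
  forall x, \tr x = 0 -> P x.
Proof.
move=> PD Poff Pdiag x trx.
have P0 : P 0 by rewrite -(subrr (delta_mx j j)).
(* Replacing E_aa by E_aa - E_jj changes the sum by [\tr x] times E_jj, which is 0. *)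
have -> : x = \sum_a \sum_b x a b *: (delta_mx a b - delta_mx j j *+ (a == b)).
  have E : \sum_a x a a *: delta_mx j j = 0 by rewrite -scaler_suml -/(mxtrace x) trx scale0r.
  rewrite {1}[x]matrix_sum_delta -[LHS]subr0 -[X in _ - X]E -sumrB; apply: eq_bigr => a _.
  rewrite [in RHS](bigD1 a) //= (bigD1 a) //= eqxx scalerBr addrAC; congr (_ + _).
  by apply: eq_bigr => b ba; rewrite eq_sym (negbTE ba) subr0.
elim/big_ind: _ => // [y z Py Pz|a _]; first by rewrite -[y]scale1r; apply: PD.
elim/big_ind: _ => // [y z Py Pz|b _]; first by rewrite -[y]scale1r; apply: PD.
rewrite -[_ *: _]addr0; apply: PD => //.
by case: eqVneq => [<-|ab]; rewrite ?subr0; [apply: Pdiag | apply: Poff].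
Qed.

Lemma mxtrace_delta (a b : 'I_m) : \tr (delta_mx a b : M) = (a == b)%:R.
Proof.
rewrite /mxtrace (bigD1 a) //= mxE eqxx big1 ?addr0 // => c ca.
by rewrite mxE (negbTE ca).
Qed.

Hypothesis two_neq0 : 2%:R != 0 :> F.

(** The conditions [b != i] and [a != j] say that E_ab commutes with E_ij. From E_ji one reaches
    E_ii - E_jj, then -2 E_ij, where 2 is inverted, then the remaining units. *)
Lemma sl_generated (N : M -> Prop) (i j : 'I_m) : i != j ->
    (forall a x y, N x -> N y -> N (a *: x + y)) ->
    (forall a b y, a != b -> b != i -> a != j -> N y -> N (comm (delta_mx a b) y)) ->
    N (delta_mx j i) ->
  forall x, \tr x = 0 -> N x.
Proof.
move=> ij ND Ncomm Nji.
have N0 : N 0 by have := ND (-1) _ _ Nji Nji; rewrite scaleN1r addNr.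
have NZ c x : N x -> N (c *: x) by move=> Nx; rewrite -[_ *: _]addr0; apply: ND.
have NN x : N (- x) -> N x by move=> /(NZ (-1)); rewrite scaleN1r opprK.
have ji : j != i by rewrite eq_sym.
have Nd : N (delta_mx i i - delta_mx j j).
  by have := Ncomm i j _ ij ji ij Nji; rewrite comm_delta !eqxx.
have Nij : N (delta_mx i j).
  have := Ncomm i j _ ij ji ij Nd.
  rewrite (bilinBr comm_bilin) !comm_delta !eqxx (negbTE ji) sub0r subr0 -opprD.
  move/NN; rewrite -mulr2n -scaler_nat => /(NZ 2%:R^-1).
  by rewrite scalerA mulVf ?scale1r.
have Nai a : a != i -> a != j -> N (delta_mx a i).
  move=> ai aj; have := Ncomm a j _ aj ji aj Nji.
  by rewrite comm_delta eqxx [i == a]eq_sym (negbTE ai) subr0.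
have Njb b : b != i -> b != j -> N (delta_mx j b).
  move=> bi bj; have := Ncomm i b _ _ bi ij Nji; rewrite eq_sym bi => /(_ isT).
  by rewrite comm_delta eqxx (negbTE bj) sub0r => /NN.
have Nib b : b != i -> b != j -> N (delta_mx i b).
  move=> bi bj; have := Ncomm i j _ ij ji ij (Njb b bi bj).
  by rewrite comm_delta eqxx (negbTE bi) subr0.
have Naj a : a != i -> a != j -> N (delta_mx a j).
  move=> ai aj; have := Ncomm i j _ ij ji ij (Nai a ai aj).
  by rewrite comm_delta eqxx [j == a]eq_sym (negbTE aj) sub0r => /NN.
have Nab a b : a != i -> a != j -> b != i -> b != j ->
    N (delta_mx a b - delta_mx j j *+ (b == a)).
  move=> ai aj bi bj; have := Ncomm a j _ aj ji aj (Njb b bi bj).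
  by rewrite comm_delta eqxx.
apply: (sl_ind (j := j)) => // [a b ab|a].
  have [ai|ai] := eqVneq a i; first have [bj|bj] := eqVneq b j.
  - by rewrite ai bj.
  - by rewrite ai; apply: Nib => //; rewrite -ai eq_sym.
  have [aj|aj] := eqVneq a j; first have [bi|bi] := eqVneq b i.
  - by rewrite aj bi.
  - by rewrite aj; apply: Njb => //; rewrite -aj eq_sym.
  have [bi|bi] := eqVneq b i; first by rewrite bi; apply: Nai.
  have [bj|bj] := eqVneq b j; first by rewrite bj; apply: Naj.
  by have := Nab a b ai aj bi bj; rewrite eq_sym (negbTE ab) subr0.
have [->|ai] := eqVneq a i => //.
have [->|aj] := eqVneq a j; first by rewrite subrr.
by have := Nab a a ai aj ai aj; rewrite eqxx.
Qed.

Section Equivariant.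
Variable f : M -> M -> M.
Hypothesis f_bilin : bilinear_map f.
Hypothesis f_delta : forall a b : 'I_m, a != b -> equivariant f (delta_mx a b).

(** The traceless elements under which [f] is equivariant form a Lie algebra, and E_aa - E_jj is the
    commutator of E_aj and E_ja. *)
Lemma equivariant_sl z : \tr z = 0 -> equivariant f z.
Proof.
case: (posnP m) => [m0|m_gt0].
  move=> _ x y _ _; apply/matrixP=> i; suff : (i < 0)%N by []; by rewrite -[X in (_ < X)%N]m0.
apply: (sl_ind (j := Ordinal m_gt0)) => // [a x y Ex Ey|a] u v u0 v0.
  rewrite !(bilinDl comm_bilin, bilinZl comm_bilin) Ex // Ey //.
  by rewrite !(bilinDl f_bilin, bilinDr f_bilin, bilinZl f_bilin, bilinZr f_bilin) scalerDr addrACA.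
set j := Ordinal _; have [<-|aj] := eqVneq j a.
  rewrite subrr !(bilin0l comm_bilin) (bilin0l f_bilin) (bilin0r f_bilin).
  by rewrite addr0.
have -> : delta_mx a a - delta_mx j j = comm (delta_mx a j) (delta_mx j a) :> M.
  by rewrite comm_delta !eqxx.
have ja : a != j by rewrite eq_sym.
have J (w x y : M) : comm (comm w x) y = comm w (comm x y) - comm x (comm w y).
  by rewrite [in RHS]comm_jacobi addrK.
have T := mxtrace_comm.
set A : M := delta_mx a j; set B : M := delta_mx j a.
have [EA EB] : equivariant f A /\ equivariant f B by split; apply: f_delta.
rewrite !J (bilinBl f_bilin (comm A (comm B u))) (bilinBr f_bilin (comm A (comm B v))).
rewrite EB // EA // (bilinDr comm_bilin (f (comm B u) v)) (bilinDr comm_bilin (f (comm A u) v)).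
rewrite !EA ?T // !EB ?T //.
by apply/matrixP=> ? ?; rewrite !mxE; ring.
Qed.

(* The lowest weight vector E_ji generates sl under the centralizer of the
   highest weight vector E_ij, and E_ij generates sl. *)
Lemma equivariant_eq0 (i j : 'I_m) : i != j -> f (delta_mx i j) (delta_mx j i) = 0 ->
  forall x y, \tr x = 0 -> \tr y = 0 -> f x y = 0.
Proof.
move=> ij f0.
have trD (x y : M) a : \tr x = 0 -> \tr y = 0 -> \tr (a *: x + y) = 0.
  by move=> x0 y0; rewrite mxtraceD mxtraceZ x0 y0 mulr0 addr0.
have tr_ij (a b : 'I_m) : a != b -> \tr (delta_mx a b : M) = 0.
  by move=> ab; rewrite mxtrace_delta (negbTE ab).
have ji : j != i by rewrite eq_sym.
suff fij y : \tr y = 0 -> \tr y = 0 /\ f (delta_mx i j) y = 0.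
  move=> x y x0 y0; suff [] : \tr x = 0 /\ forall y, \tr y = 0 -> f x y = 0 by move=> _; apply.
  apply: (@sl_generated (fun x => \tr x = 0 /\ forall y, \tr y = 0 -> f x y = 0) j i) x0 => //.
  - move=> a u v [u0 fu] [v0 fv]; split=> [|w w0]; first exact: trD.
    by rewrite f_bilin.1 fu // fv // scaler0 addr0.
  - move=> a b u ab _ _ [u0 fu]; split=> [|w w0]; first exact: mxtrace_comm.
    have := f_delta ab u0 w0.
    by rewrite !fu ?mxtrace_comm // (bilin0r comm_bilin) addr0 => <-.
  - by split=> [|w w0]; [apply: tr_ij | apply: (fij w w0).2].
apply: (@sl_generated (fun y => \tr y = 0 /\ f (delta_mx i j) y = 0) i j) => //.
- move=> a u v [u0 fu] [v0 fv]; split; first exact: trD.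
  by rewrite f_bilin.2 fu fv scaler0 addr0.
- move=> a b u ab bi aj [u0 fu]; split; first exact: mxtrace_comm.
  have := f_delta ab (tr_ij _ _ ij) u0.
  rewrite fu comm_delta (negbTE bi) [j == a]eq_sym (negbTE aj) subrr.
  by rewrite (bilin0l f_bilin) (bilin0r comm_bilin) add0r => <-.
- by split=> //; apply: tr_ij.
Qed.

(** E_ij and E_ji have opposite weights, so E_aa - E_bb commutes with the value of [f]; the (a, b)
    entry of that commutator is twice the (a, b) entry of the value. *)
Lemma equivariant_diag (i j a b : 'I_m) : i != j -> a != b ->
  f (delta_mx i j) (delta_mx j i) a b = 0.
Proof.
move=> ij ab; set T := f _ _.
have ji : j != i by rewrite eq_sym.
have wt (k l : 'I_m) : comm (delta_mx a a - delta_mx b b) (delta_mx k l) =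
    ((a == k)%:R - (l == a)%:R - (b == k)%:R + (l == b)%:R) *: delta_mx k l :> M.
  rewrite (bilinBl comm_bilin) !comm_delta.
  have El (e : 'I_m) : delta_mx e l *+ (e == k) = (e == k)%:R *: delta_mx k l :> M.
    by case: eqVneq => [->|_]; rewrite ?scale1r ?scale0r.
  have Er (e : 'I_m) : delta_mx k e *+ (l == e) = (l == e)%:R *: delta_mx k l :> M.
    by case: eqVneq => [->|_]; rewrite ?scale1r ?scale0r.
  by rewrite !El !Er; apply/matrixP=> ? ?; rewrite !mxE; ring.
have := @equivariant_sl (delta_mx a a - delta_mx b b) _ (delta_mx i j) (delta_mx j i).
rewrite raddfB /= !mxtrace_delta !eqxx subrr (negbTE ij) (negbTE ji) !wt.
rewrite (bilinZl f_bilin) (bilinZr f_bilin) -scalerDl => /(_ erefl erefl erefl).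
rewrite [i == a]eq_sym [j == a]eq_sym [i == b]eq_sym [j == b]eq_sym.
have -> : forall r s t u : F, r - s - t + u + (s - r - u + t) = 0 by move=> *; ring.
rewrite scale0r => /matrixP/(_ a b); rewrite /comm mulmxBl mulmxBr !mxE.
have El (c : 'I_m) : (delta_mx c c *m T) a b = (c == a)%:R * T a b.
  rewrite mxE (bigD1 a) //= big1 => [|k ka]; rewrite mxE.
    by rewrite andbb [a == c]eq_sym addr0.
  by case: (eqVneq a c) => [<-|_]; rewrite ?mul0r // (negbTE ka) mul0r.
have Er (c : 'I_m) : (T *m delta_mx c c) a b = T a b * (c == b)%:R.
  rewrite mxE (bigD1 b) //= big1 => [|k kb]; rewrite mxE.
    by rewrite andbb [b == c]eq_sym addr0.
  by case: (eqVneq b c) => [<-|_]; rewrite ?(negbTE kb) ?andbF mulr0.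
move: (El a) (El b) (Er a) (Er b); rewrite !mxE => -> -> -> ->.
rewrite !eqxx [b == a]eq_sym (negbTE ab) => /eqP.
have -> : 1 * T a b - 0%:R * T a b - (T a b * 0%:R - T a b * 1) = 2%:R * T a b by ring.
by rewrite mulf_eq0 (negbTE two_neq0) => /eqP.
Qed.

(** E_ab commutes with both arguments, hence with the value of [f]; the (a, b) entry of this
    commutator is the difference of the two diagonal entries. *)
Lemma equivariant_eq_diag (i j a b : 'I_m) : i != j -> a != i -> a != j -> b != i -> b != j ->
  f (delta_mx i j) (delta_mx j i) a a = f (delta_mx i j) (delta_mx j i) b b.
Proof.
move=> ij ai aj bi bj; have [<-//|ab] := eqVneq a b; set T := f _ _.
have ji : j != i by rewrite eq_sym.
have := f_delta ab (x := delta_mx i j) (y := delta_mx j i).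
rewrite !mxtrace_delta (negbTE ij) (negbTE ji) => /(_ erefl erefl).
rewrite !comm_delta (negbTE bi) (negbTE bj) [i == a]eq_sym [j == a]eq_sym.
rewrite (negbTE ai) (negbTE aj) !mulr0n subr0 (bilin0l f_bilin) (bilin0r f_bilin) addr0.
move=> /matrixP/(_ a b); rewrite !mxE (bigD1 b) //= [X in _ - X](bigD1 a) //=.
rewrite !mxE !eqxx !big1 => [|k ka|k kb]; last first.
- by rewrite mxE (negbTE kb) andbF mul0r.
- by rewrite mxE (negbTE ka) mulr0.
by rewrite !addr0 mul1r mulr1 => /eqP; rewrite subr_eq0 => /eqP.
Qed.

End Equivariant.

Lemma acomm_delta (i j : 'I_m) :
  acomm (delta_mx i j) (delta_mx j i) = delta_mx i i + delta_mx j j :> M.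
Proof. by rewrite /acomm !mul_delta_mx. Qed.

Lemma equivariant_comb (f g h : M -> M -> M) a b z :
  equivariant f z -> equivariant g z -> equivariant h z ->
  equivariant (fun x y => f x y - a *: g x y - b *: h x y) z.
Proof.
move=> Ef Eg Eh x y x0 y0.
rewrite !(bilinBr comm_bilin) !(bilinZr comm_bilin) Ef // Eg // Eh //.
by apply/matrixP=> ? ?; rewrite !mxE; ring.
Qed.

Lemma comm_equivariant z : equivariant (@comm F m) z.
Proof. by move=> x y _ _; apply: comm_jacobi. Qed.

Lemma sharp_acomm_equivariant z : equivariant (fun x y => sharp (acomm x y) : M) z.
Proof.
move=> x y _ _; rewrite comm_sharp comm_acomm -[X in _ = X + _]scale1r -sharpD.
rewrite scale1r sharp_id // -comm_acomm; exact: mxtrace_comm.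
Qed.

(** The value at (E_ij, E_ji) is diagonal, traceless and constant outside of {i, j}. Such matrices
    form a plane, spanned by the values of the two standard maps; [2 < m] provides an index [k]
    outside of {i, j}. *)
Lemma equivariant_sl_classification (f : M -> M -> M) :
    (2 < m)%N -> m%:R != 0 :> F -> bilinear_map f ->
    (forall a b : 'I_m, a != b -> equivariant f (delta_mx a b)) ->
    (forall x y, \tr x = 0 -> \tr y = 0 -> \tr (f x y) = 0) ->
  exists a b, forall x y, \tr x = 0 -> \tr y = 0 ->
    f x y = a *: comm x y + b *: sharp (acomm x y).
Proof.
move=> m_gt2 m_neq0 fb fe ftr.
have m_gt1 := ltnW m_gt2; have m_gt0 := ltnW m_gt1.
pose i := Ordinal m_gt0; pose j := Ordinal m_gt1; pose k := Ordinal m_gt2.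
have ij : i != j by []. have ki : k != i by []. have kj : k != j by [].
set T := f (delta_mx i j) (delta_mx j i).
(* At (E_ij, E_ji) the standard maps give E_ii - E_jj and E_ii + E_jj - (2/m) 1: the difference of
   the entries at [i] and [j] yields [a], the entry at [k] yields [b]. *)
pose a := (T i i - T j j) / 2%:R; pose b := - (m%:R * T k k) / 2%:R.
exists a, b => x y x0 y0; apply/eqP; rewrite -subr_eq0 opprD addrA; apply/eqP.
apply: (equivariant_eq0 (bilin_comb a b fb comm_bilin sharp_acomm_bilin) _ ij) x0 y0 => // [c d cd|].
  by apply: equivariant_comb => //; [apply: fe | apply: comm_equivariant | apply: sharp_acomm_equivariant].
have trT : \tr T = 0 by apply: ftr; rewrite mxtrace_delta.
have Tk l : l != i -> l != j -> T l l = T k k.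
  by move=> li lj; apply: equivariant_eq_diag.
have sumT : T i i + T j j + (m%:R - 2%:R) * T k k = 0.
  rewrite -trT /mxtrace (bigD1 i) //= (bigD1 j) //= addrA; congr (_ + _).
  rewrite (eq_bigr (fun=> T k k)) => [|l /andP[li lj]]; last exact: Tk.
  rewrite sumr_const -[RHS]mulr_natl; congr (_ * _).
  have := cardC (mem [:: i; j]); rewrite card_ord (card_uniqP _) // => E.
  rewrite -[in m%:R]E natrD addrAC subrr add0r; congr (_%:R).
  by apply: eq_card => l; rewrite !inE negb_or.
rewrite -/T; apply/matrixP=> c d; rewrite /sharp acomm_delta.
rewrite comm_delta !eqxx !mulr1n.
have [<-|cd] := eqVneq c d; last first.
  have Tcd : T c d = 0 by apply: equivariant_diag.
  rewrite !mxE Tcd (negbTE cd) !mulr0n.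
  have Z (e : 'I_m) : (c == e) && (d == e) = false.
    by apply: contraNF cd => /andP[/eqP-> /eqP->].
  by rewrite !Z /=; ring.
rewrite !mxE raddfD /= !mxtrace_delta !eqxx !andbb mulr1n.
have Tij : T i i = - T j j - (m%:R - 2%:R) * T k k.
  by apply/eqP; rewrite -subr_eq0 opprD !opprK addrA sumT.
rewrite /a /b; have [->|ci] := eqVneq c i.
  by rewrite (negbTE ij) Tij /=; field; rewrite two_neq0 m_neq0.
have [->|cj] := eqVneq c j; first by rewrite Tij /=; field; rewrite two_neq0 m_neq0.
by rewrite Tk //=; field; rewrite two_neq0 m_neq0.
Qed.

(** The derivation identity forces the value at (E_ij, E_ji) to be a multiple of E_ii - E_jj, so [f]
    agrees on sl with a multiple of the commutator; the same identity extends this to all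
    matrices. *)
Lemma biderivation_classification (f : M -> M -> M) :
    (1 < m)%N -> bilinear_map f ->
    (forall a b : 'I_m, a != b -> equivariant f (delta_mx a b)) ->
    (forall x y, f y x = - f x y) ->
    (forall x y z, f x (acomm y z) = acomm (f x y) z + acomm y (f x z)) ->
  exists a, forall x y, f x y = a *: comm x y.
Proof.
move=> m_gt1 fb fe fC fD.
have m_gt0 := ltnW m_gt1.
pose i := Ordinal m_gt0; pose j := Ordinal m_gt1.
have ij : i != j by []. have ji : j != i by [].
set T := f (delta_mx i j) (delta_mx j i).
have twoI (x : M) : x + x = 0 -> x = 0.
  by rewrite -mulr2n -scaler_nat => /eqP; rewrite scaler_eq0 (negbTE two_neq0) => /eqP.
have fxx x : f x x = 0 by apply: twoI; rewrite {1}fC addNr.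
have T_k l : l != i -> l != j -> T l l = 0.
  move=> li lj.
  have := fD (delta_mx i j) (delta_mx i i) (delta_mx j i).
  rewrite {1}/acomm !mul_delta_mx_cond eqxx (negbTE ij) add0r mulr1n -/T.
  by move=> /matrixP/(_ l l) ->; rewrite !mxE !big1 ?addr0 // => k _;
    rewrite !mxE ?(negbTE li) ?(negbTE lj) ?andbF ?mul0r ?mulr0.
(* Write o for [acomm]. From e o e = 2e and e o v = 2v the derivation identity gives both e o y = y
   and e o y = 2y for y = f v e. *)
have fve : f (delta_mx i j) (delta_mx i i + delta_mx j j) = 0.
  set v := delta_mx i j; set e := _ + _.
  have ev : acomm e v = v + v.
    rewrite /acomm mulmxDl mulmxDr !mul_delta_mx_cond !eqxx (negbTE ji).
    by rewrite addr0 add0r.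
  have ee : acomm e e = e + e.
    rewrite /acomm mulmxDl !mulmxDr !mul_delta_mx_cond !eqxx (negbTE ij) (negbTE ji).
    by rewrite !mulr0n !addr0 add0r.
  have E1 := fD v e e; have E2 := fD e e v.
  rewrite ee (bilinDr fb) in E1; rewrite ev (bilinDr fb) fxx in E2.
  set y := f v e in E1 *.
  move: E2; rewrite [f e v]fC -/y (bilin0l acomm_bilin) add0r (bilinNr acomm_bilin).
  move=> E2; move: E1; rewrite [acomm y e]acommC.
  have -> : acomm e y = y + y by apply: oppr_inj; rewrite -E2 opprD.
  by move=> /eqP; rewrite -subr_eq0 opprD addrA subrr sub0r oppr_eq0 => /eqP/twoI.
have Tij : T j j = - T i i.
  have := fD (delta_mx i j) (delta_mx i j) (delta_mx j i).
  rewrite acomm_delta fve fxx (bilin0l acomm_bilin) add0r -/T.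
  move=> /matrixP/(_ i j); rewrite !mxE (bigD1 j) //= [X in _ + X](bigD1 i) //=.
  rewrite !mxE !eqxx !big1 => [|k' ki|k' kj]; last first.
  - by rewrite mxE (negbTE kj) andbF mul0r.
  - by rewrite mxE (negbTE ki) mulr0.
  by rewrite !addr0 mul1r mulr1 => /eqP; rewrite eq_sym addr_eq0 => /eqP.
(* The term with coefficient 0 gives [g] the shape of [bilin_comb] and [equivariant_comb]. *)
pose g x y := f x y - T i i *: comm x y - 0 *: comm x y.
have gb : bilinear_map g by apply: bilin_comb => //; apply: comm_bilin.
have ge (a b : 'I_m) : a != b -> equivariant g (delta_mx a b).
  move=> ab; apply: (@equivariant_comb f (@comm F m) (@comm F m)); first exact: fe.
    exact: comm_equivariant.
  exact: comm_equivariant.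
have gC x y : g y x = - g x y.
  by rewrite /g fC [comm y x]commC; apply/matrixP=> ? ?; rewrite !mxE; ring.
have gD x y z : g x (acomm y z) = acomm (g x y) z + acomm y (g x z).
  rewrite /g !scale0r !subr0 fD comm_acomm (bilinBl acomm_bilin (f x y)).
  rewrite (bilinBr acomm_bilin (f x z)) (bilinZl acomm_bilin) (bilinZr acomm_bilin).
  by rewrite scalerDr opprD addrACA.
have g0 : g (delta_mx i j) (delta_mx j i) = 0.
  rewrite /g scale0r subr0 -/T comm_delta !eqxx !mulr1n; apply/matrixP=> c d.
  have [<-|cd] := eqVneq c d.
    rewrite !mxE !andbb.
    have [->|ci] := eqVneq c i; first by rewrite (negbTE ij) /=; ring.
    have [->|cj] := eqVneq c j; first by rewrite Tij /=; ring.
    by rewrite (T_k c) //=; ring.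
  have Tcd : T c d = 0 by apply: equivariant_diag.
  have Z (e : 'I_m) : (c == e) && (d == e) = false.
    by apply: contraNF cd => /andP[/eqP-> /eqP->].
  by rewrite !mxE Tcd !Z /=; ring.
have gsl := equivariant_eq0 gb ge ij g0.
(* The characteristic may divide [m], so E_ii rather than the identity matrix complements sl; 2 E_ii
   is [acomm] of E_ij and E_ji plus a traceless matrix. *)
have ext x : (forall y, \tr y = 0 -> g x y = 0) -> forall y, g x y = 0.
  move=> gx y.
  have gii : g x (delta_mx i i) = 0.
    apply: twoI; rewrite -(bilinDr gb).
    have -> : delta_mx i i + delta_mx i i =
        acomm (delta_mx i j) (delta_mx j i) + (delta_mx i i - delta_mx j j) :> M.
      by rewrite acomm_delta addrACA addrN addr0.
    rewrite (bilinDr gb) gD !gx ?raddfB /= ?mxtrace_delta ?eqxx ?subrr //.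
    by rewrite (bilin0l acomm_bilin) (bilin0r acomm_bilin) !addr0.
  rewrite -[y](subrK (\tr y *: delta_mx i i)) (bilinDr gb) (bilinZr gb) gii.
  rewrite scaler0 addr0 gx // raddfB /= mxtraceZ mxtrace_delta eqxx mulr1.
  exact: subrr.
exists (T i i) => x y; apply/eqP; rewrite -subr_eq0; apply/eqP.
suff : g x y = 0 by rewrite /g scale0r subr0.
apply: (ext) => {}y y0; rewrite gC; apply/eqP; rewrite oppr_eq0; apply/eqP.
by apply: ext => {}x x0; apply: gsl.
Qed.

End MatrixProducts.

Lemma centralizer_sl (F : fieldType) (m : nat) (x : 'M[F]_m) : (1 < m)%N ->
  (forall a b : 'I_m, a != b -> comm (delta_mx a b) x = 0) -> exists a, x = a%:M.
Proof.
move=> m_gt1 xc.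
have E (a b d : 'I_m) : a != b -> x b d = x a a *+ (d == b).
  move=> /xc/matrixP/(_ a d); rewrite !mxE (bigD1 b) //= [X in _ - X](bigD1 a) //= !big1.
  - by rewrite !mxE !eqxx !addr0 mul1r mulr_natr => /eqP; rewrite subr_eq0 => /eqP.
  - by move=> k ka; rewrite mxE (negbTE ka) mulr0.
  - by move=> k kb; rewrite mxE (negbTE kb) andbF mul0r.
pose i := Ordinal (ltnW m_gt1); pose j := Ordinal m_gt1.
exists (x i i); apply/matrixP=> b d; rewrite mxE.
have [->|bi] := eqVneq b i; last by rewrite (E i) eq_sym.
by rewrite (E j) // (E i j j) // eqxx eq_sym.
Qed.

(** * The identities that single out the odd product, and the centroid of the even part *)

Section Queer.
Variables (F : fieldType) (c : qcase) (n : nat).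
Hypotheses (two_neq0 : 2%:R != 0 :> F) (n_ge2 : (2 <= n)%N).
Hypothesis lie_neq0 : c = Lie -> n.+1%:R != 0 :> F.

Local Notation M := 'M[F]_(qdim c n).
Local Notation S := (q0space F c n).
Local Notation p := (@q0prod F c n).
Local Notation q := (@qodd F c n).

Lemma qdim_gt1 : (1 < qdim c n)%N.
Proof. by rewrite /qdim; case: c => //; apply: leqW. Qed.

Lemma sl_q0space (x : M) : \tr x = 0 -> x \in S.
Proof. by rewrite /q0space; case: c x => x; rewrite ?memvf // mem_sl => ->. Qed.

Lemma q0prod_bilin : bilinear_map p.
Proof. by split=> *; rewrite (q0prodDl, q0prodDr). Qed.

Lemma qodd_bilin : bilinear_map q.
Proof. by split=> *; rewrite (qoddDl, qoddDr). Qed.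

Lemma qodd_mem x y : q x y \in S.
Proof. exact: qodd_closed. Qed.

Definition inner_der (a b x : M) : M := p a (p b x) - p b (p a x).

(** Jacobi in the Lie case; in the Jordan case, the commutator of two multiplication operators of a
    special Jordan algebra. *)
Lemma inner_derE a b x : inner_der a b x = comm (comm a b) x.
Proof.
rewrite /inner_der /q0prod; case: c a b x => a b x; last by mx_ring.
by rewrite [comm a (comm b x)]comm_jacobi addrK.
Qed.

(** The sign of the odd product under exchange of its arguments; the even product has the opposite
    one. *)
Definition swap_sign : F := if c is Lie then 1 else -1.

Lemma q0prod_swap x y : p x y = - swap_sign *: p y x.
Proof.
rewrite /q0prod /swap_sign; case: c x y => x y; first by rewrite scaleN1r commC.
by rewrite opprK scale1r acommC.
Qed.

(* The multilinear identities that single out the odd product up to a scalar. *)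
Definition natural_map (f : M -> M -> M) : Prop :=
  [/\ bilinear_map f, forall x y, x \in S -> y \in S -> f x y \in S,
      forall x y, x \in S -> y \in S -> f y x = swap_sign *: f x y,
      forall a b x y, a \in S -> b \in S -> x \in S -> y \in S ->
        inner_der a b (f x y) = f (inner_der a b x) y + f x (inner_der a b y)
    & c = Jordan -> forall x y z, x \in S -> y \in S -> z \in S ->
        f x (p y z) = p (f x y) z + p y (f x z)].

Lemma qodd_natural : natural_map q.
Proof.
split=> [|*|x y _ _|a b x y _ _ _ _|cJ x y z _ _ _]; [exact: qodd_bilin|exact: qodd_mem|..].
- rewrite /swap_sign /qodd; case: c x y => x y; first by rewrite acommC scale1r.
  by rewrite commC scaleN1r.
- rewrite !inner_derE /qodd; case: c a b x y => a b x y; last exact: comm_jacobi.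
  rewrite comm_sharp comm_acomm -[X in _ = X + _]scale1r -sharpD scale1r.
  by rewrite sharp_id // -comm_acomm mxtrace_comm.
- by move: x y z; rewrite /qodd /q0prod cJ => x y z; apply: comm_acomm.
Qed.

(** E_ab = [H, E_ab] with [H] half of E_aa - E_bb, so ad E_ab is one of the inner derivations. *)
Lemma natural_equivariant f (a b : 'I_(qdim c n)) :
  natural_map f -> a != b -> equivariant f (delta_mx a b).
Proof.
move=> [fb _ _ fD _] ab x y x0 y0.
pose H : M := 2%:R^-1 *: (delta_mx a a - delta_mx b b).
have ba : b != a by rewrite eq_sym.
have trH : \tr H = 0.
  by rewrite mxtraceZ raddfB /= !mxtrace_delta !eqxx subrr mulr0.
have trE : \tr (delta_mx a b : M) = 0 by rewrite mxtrace_delta (negbTE ab).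
have := fD H (delta_mx a b) x y (sl_q0space trH) (sl_q0space trE) (sl_q0space x0) (sl_q0space y0).
rewrite !inner_derE.
suff -> : comm H (delta_mx a b) = delta_mx a b by [].
rewrite (bilinZl (@comm_bilin _ _)) (bilinBl (@comm_bilin _ _)) !comm_delta !eqxx.
rewrite (negbTE ba) subr0 sub0r opprK -mulr2n -scaler_nat scalerA mulVf //.
by rewrite scale1r.
Qed.

(** In the Lie case symmetry removes the multiple of the commutator, as 2 is invertible. In the
    Jordan case antisymmetry makes [f] a derivation in both arguments. *)
Lemma natural_classification f : natural_map f ->
  exists a, forall x y, x \in S -> y \in S -> f x y = a *: q x y.
Proof.
move=> nf; have fe a b ab := @natural_equivariant f a b nf ab.
have [fb fS fC _ fD] := nf.
move: f {nf} fb fS fC fD fe qdim_gt1 lie_neq0; rewrite /swap_sign /qodd /q0prod /q0space.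
case: c => f fb fS fC fD fe m_gt1 neq0.
  have mS x : (x \in sl F n.+1) = (\tr x == 0) by apply: mem_sl.
  have m_gt2 : (2 < n.+1)%N by [].
  have [x y x0 y0|a [b E]] :=
      equivariant_sl_classification two_neq0 m_gt2 (neq0 erefl) fb fe.
    by apply/eqP; rewrite -mS fS ?mS ?x0 ?y0.
  exists b => x y; rewrite !mS => /eqP x0 /eqP y0.
  have := fC x y; rewrite !mS x0 y0 scale1r => /(_ (eqxx _) (eqxx _)).
  rewrite !E // acommC commC scalerN => /addIr/eqP.
  rewrite -subr_eq0 -opprD oppr_eq0 -mulr2n -scaler_nat scaler_eq0 (negbTE two_neq0) /=.
  by move/eqP->; rewrite add0r.
have [x y|x y z|a E] := biderivation_classification two_neq0 m_gt1 fb fe.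
- by rewrite fC ?memvf // scaleN1r.
- by apply: fD; rewrite ?memvf.
- by exists a => x y _ _.
Qed.

(* In the Lie case, (x, y) |-> [t x, y] is equivariant, hence a combination of
   the bracket and of the product * of odd elements; as [t x, x] = t [x, x] = 0,
   the latter does not occur. *)
Lemma q0_centroid (t : 'End(M)) : (forall x, x \in S -> t x \in S) ->
    (forall x z, x \in S -> z \in S -> t (p z x) = p z (t x)) ->
  exists a, forall x, x \in S -> t x = a *: x.
Proof.
move: t qdim_gt1 lie_neq0; rewrite /q0prod /q0space; case: c => t m_gt1 neq0 tS tp.
  have mS x : (x \in sl F n.+1) = (\tr x == 0) by apply: mem_sl.
  have {}tS x : \tr x = 0 -> \tr (t x) = 0.
    by move=> x0; apply/eqP; rewrite -mS tS // mS x0.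
  have {}tp x z : \tr x = 0 -> \tr z = 0 -> t (comm z x) = comm z (t x).
    by move=> x0 z0; apply: tp; rewrite mS (x0, z0).
  pose f x y := comm (t x) y.
  have fb : bilinear_map f.
    by split=> a x y z; rewrite /f ?linearP /= (bilinDl (@comm_bilin _ _), bilinDr (@comm_bilin _ _))
      (bilinZl (@comm_bilin _ _), bilinZr (@comm_bilin _ _)).
  have m_gt2 : (2 < n.+1)%N by [].
  have [a b ab x y x0 y0|x y _ _|a [b E]] :=
      equivariant_sl_classification two_neq0 m_gt2 (neq0 erefl) fb.
  - by rewrite /f comm_jacobi tp // mxtrace_delta (negbTE ab).
  - exact: mxtrace_comm.
  exists a.
  have b0 : b = 0.
    pose i := Ordinal (ltnW m_gt1); pose j := Ordinal m_gt1; pose k := Ordinal m_gt2.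
    (* [acomm x x] is 2 (E_ii + E_jj), whose sharp part has different entries at [i] and [k]; its
       multiple by [b] can vanish only for [b] = 0. *)
    pose x : 'M[F]_n.+1 := delta_mx i j + delta_mx j i.
    have x0 : \tr x = 0 by rewrite mxtraceD !mxtrace_delta addr0.
    have := E x x x0 x0; rewrite /f commC -tp // commxx linear0 oppr0 scaler0 add0r.
    have -> : acomm x x = 2%:R *: (delta_mx i i + delta_mx j j).
      rewrite /acomm mulmxDl !mulmxDr !mul_delta_mx_cond /= !mulr0n !mulr1n add0r addr0.
      by rewrite scaler_nat mulr2n.
    move=> /matrixP B; have := B i i; have := B k k; rewrite !mxE /= !mulr1n.
    set u := _^-1 * _ => Bk Bi.
    have : b * 2%:R = 0.
      have -> : b * 2%:R = b * (2%:R * (1 + 0) - u) - b * (2%:R * (0 + 0) - u) by ring.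
      by rewrite -Bk -Bi subrr.
    by move=> /eqP; rewrite mulf_eq0 (negbTE two_neq0) orbF => /eqP.
  move=> x; rewrite mS => /eqP x0; apply/eqP; rewrite -subr_eq0; apply/eqP.
  (* The difference centralizes sl and is therefore scalar; being traceless it is 0, as n + 1 is
     invertible. *)
  have [//|d ab|l El] := @centralizer_sl F n.+1 (t x - a *: x).
    move=> dab; rewrite commC (bilinBl (@comm_bilin _ _)) (bilinZl (@comm_bilin _ _)).
    have := E x (delta_mx d ab) x0; rewrite /f => ->; last by rewrite mxtrace_delta (negbTE dab).
    by rewrite b0 scale0r addr0 subrr oppr0.
  have : \tr (t x - a *: x) = 0 by rewrite raddfB /= mxtraceZ tS // x0 mulr0 subrr.
  rewrite El mxtrace_scalar -mulr_natl => /eqP.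
  by rewrite mulf_eq0 (negbTE (neq0 erefl)) => /eqP->; rewrite raddf0.
have {}tp x z : t (acomm z x) = acomm z (t x) by apply: tp; rewrite memvf.
(* Twice [t] is multiplication by [e], and [t] commutes with all multiplications, so the associator
   of x, y, e vanishes: every commutator with [e] is scalar. *)
pose e := t 1%:M.
have te x : 2%:R *: t x = acomm x e.
  rewrite /e -tp /acomm mulmx1 mul1mx linearD /=.
  by rewrite scaler_nat mulr2n.
have cc x y : comm y (comm x e) = 0.
  by rewrite comm_comm_acomm -!te (bilinZr (@acomm_bilin _ _)) tp subrr.
have scal x : exists l, comm x e = l%:M by apply: centralizer_sl => // a b _; apply: cc.
have comm_e x : comm x e = 0.
  have [l El] := scal x; have [l' El'] := scal (x *m e).
  (* If l = [x, e] is nonzero, then l e = [x e, e] is scalar as well, and so is [e]. *)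
  have [l0|l0] := eqVneq l 0; first by rewrite El l0 raddf0.
  have E : comm (x *m e) e = l *: e by rewrite -[l *: e]mul_scalar_mx -El /comm mulmxBl !mulmxA.
  have -> : e = (l^-1 * l')%:M by rewrite -scale_scalar_mx -El' E scalerA mulVf ?scale1r.
  exact: comm_scalar.
have [|a Ea] := @centralizer_sl F n e m_gt1; first by move=> a b _; apply: comm_e.
exists a => x _; apply: (scalerI two_neq0); rewrite te Ea /acomm scalar_mxC.
by rewrite mul_scalar_mx scaler_nat mulr2n.
Qed.

(** * Homogeneous components *)

Definition prod_graded (G : zmodType) (Gam : G -> {vspace M}) : Prop :=
  decomposes S Gam /\
  forall g k x y, x \in Gam g -> y \in Gam k -> p x y \in Gam (g + k).

Lemma is_grading_Q0 (G : zmodType) (Gam : G -> {vspace M}) :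
  is_grading (A := Q0 F c n) Gam <-> prod_graded Gam.
Proof.
rewrite /is_grading /carrier /= addv0.
split=> [[sS span dir prod _]|[[sS span dir] prod]]; first by split.
split=> // g; rewrite capv0 addv0; apply/esym/capv_idPl; exact: sS.
Qed.

Lemma delta_mx_neq0 (m : nat) (i j : 'I_m) : delta_mx i j != 0 :> 'M[F]_m.
Proof.
by apply/eqP=> /matrixP/(_ i j)/eqP; rewrite !mxE !eqxx oner_eq0.
Qed.

(** The further even product discards the scalar correction of [sharp] in the Lie case, which is
    what [typeI_odd_degree0] needs. *)
Lemma qodd_neq0 : exists x y z, [/\ x \in S, y \in S, z \in S & p (q x y) z != 0].
Proof.
move: qdim_gt1 n_ge2; rewrite /q0prod /qodd /q0space; case: c => m_gt1 n2.
  pose i := Ordinal (ltnW m_gt1); pose j := Ordinal m_gt1.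
  have m_gt2 : (2 < n.+1)%N by [].
  pose k := Ordinal m_gt2.
  exists (delta_mx i j), (delta_mx j i), (delta_mx i k).
  rewrite !mem_sl !mxtrace_delta !eqxx; split=> //.
  rewrite commC comm_sharp -commC acomm_delta (bilinDl (@comm_bilin _ _)) !comm_delta.
  by rewrite !eqxx /= subr0 subrr addr0 delta_mx_neq0.
pose i := Ordinal (ltnW m_gt1); pose j := Ordinal m_gt1.
exists (delta_mx i j), (delta_mx j i), (delta_mx i i); rewrite !memvf; split=> //.
rewrite comm_delta !eqxx !mulr1n (bilinBl (@acomm_bilin _ _)).
rewrite /acomm !mul_delta_mx_cond !eqxx /= !mulr1n !mulr0n addr0 subr0 -mulr2n -scaler_nat.
by rewrite scaler_eq0 (negbTE two_neq0) delta_mx_neq0.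
Qed.

Section GradedPieces.
Variables (G : zmodType) (Gam : G -> {vspace M}).
Hypothesis gradG : prod_graded Gam.

Let decG : decomposes S Gam := gradG.1.

Lemma graded_mem g x : x \in Gam g -> x \in S.
Proof. by case: decG => sS _ _; apply/subvP. Qed.

Lemma graded_proj_prod (pi : G -> 'End(M)) :
    (forall g, {in Gam g, pi g =1 id}) ->
    (forall g k, k != g -> {in Gam k, pi g =1 (fun=> 0)}) ->
  forall g k z x, z \in Gam g -> x \in S -> pi (g + k) (p z x) = p z (pi k x).
Proof.
move=> pi1 pi0 g k z x zg xS; have [_ prod] := gradG.
move: x xS; apply: (decomposes_ind decG) => [l x xl|x y _ _ Ex Ey].
  have [lk|lk] := eqVneq l k; first by rewrite -lk !pi1 // prod.
  rewrite (pi0 k l) // (bilin0r q0prod_bilin) (pi0 _ (g + l)) ?prod //.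
  by rewrite (inj_eq (addrI g)).
by rewrite (bilinDr q0prod_bilin) !linearD /= Ex Ey (bilinDr q0prod_bilin).
Qed.

Lemma graded_ind2 (P : M -> M -> Prop) :
    (forall g k x y, x \in Gam g -> y \in Gam k -> P x y) ->
    (forall x x' y, x \in S -> x' \in S -> y \in S -> P x y -> P x' y -> P (x + x') y) ->
    (forall x y y', x \in S -> y \in S -> y' \in S -> P x y -> P x y' -> P x (y + y')) ->
  forall x y, x \in S -> y \in S -> P x y.
Proof.
move=> Phom Pl Pr x y xS yS.
move: x xS; apply: (decomposes_ind decG) => [g x xg|x x' xS x'S Px Px']; last exact: Pl.
move: y yS; apply: (decomposes_ind decG) => [k y yk|y y' yS y'S Py Py']; first exact: Phom xg yk.
by apply: Pr => //; apply: graded_mem xg.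
Qed.

Section Component.
Variables (s : seq G) (pi : G -> 'End(M)) (f : M -> M -> M) (t : G).
Hypotheses (us : uniq s) (pi_in : forall g x, pi g x \in Gam g).
Hypotheses (pi1 : forall g, {in Gam g, pi g =1 id})
  (pi0 : forall g k, k != g -> {in Gam k, pi g =1 (fun=> 0)})
  (pi_sum : forall x, x \in S -> x = \sum_(g <- s) pi g x).
Hypothesis nf : natural_map f.

(** The homogeneous part of degree [t] of [f] in the graded space of bilinear maps. *)
Definition component x y := \sum_(g <- s) \sum_(k <- s) pi (g + k + t) (f (pi g x) (pi k y)).

Lemma sum_proj (L : G -> M -> M) g x : (forall k, L k 0 = 0) -> x \in Gam g ->
  \sum_(k <- s) L k (pi k x) = L g x.
Proof.
move=> L0 xg; have pik k : k != g -> pi k x = 0 by move=> kg; apply: pi0 xg; rewrite eq_sym.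
have [gs|gs] := boolP (g \in s).
  rewrite (bigD1_seq g) //= pi1 // big1 ?addr0 // => k kg.
  by rewrite pik ?L0.
have x0 : x = 0.
  rewrite (pi_sum (graded_mem xg)) big1_seq // => k /andP[_ ks].
  by apply: pik; apply: contraNneq gs => <-.
by rewrite x0 L0 big1 // => k _; rewrite linear0 L0.
Qed.

Lemma component_hom g k x y : x \in Gam g -> y \in Gam k ->
  component x y = pi (g + k + t) (f x y).
Proof.
have [fb _ _ _ _] := nf; move=> xg yk; rewrite /component.
rewrite (sum_proj (L := fun g x => \sum_(k <- s) pi (g + k + t) (f x (pi k y))) _ xg).
  by rewrite (sum_proj (L := fun k y => pi (g + k + t) (f x y)) _ yk) // => l;
    rewrite (bilin0r fb) linear0.
by move=> l; rewrite big1 // => l' _; rewrite (bilin0l fb) linear0.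
Qed.

(** The identities are multilinear, so homogeneous arguments suffice. There each of them is the
    projection to a single degree of the identity for [f], because projections commute with products
    by homogeneous elements up to a shift of labels. *)
Lemma component_natural : natural_map component.
Proof.
have [fb fS fC fD fJ] := nf.
have cb : bilinear_map component.
  split=> a x y z; rewrite /component scaler_sumr -big_split; apply: eq_bigr => g _ /=;
    rewrite scaler_sumr -big_split; apply: eq_bigr => k _ /=; rewrite !linearP /=.
    by rewrite fb.1 linearP.
  by rewrite fb.2 linearP.
have cE := component_hom.
have pb := q0prod_bilin.
have db a b : {morph inner_der a b : x y / x + y}.
  by move=> x y; rewrite /inner_der !(bilinDr pb) opprD addrACA.
have dl a a' b x : inner_der (a + a') b x = inner_der a b x + inner_der a' b x.
  by rewrite /inner_der !(bilinDl pb) !(bilinDr pb) opprD addrACA.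
have dr a b b' x : inner_der a (b + b') x = inner_der a b x + inner_der a b' x.
  by rewrite /inner_der !(bilinDl pb) !(bilinDr pb) opprD addrACA.
have [_ prod] := gradG.
split=> // [x y _ _|x y|a b x y aS bS xS yS|cJ x y z xS yS zS].
- by apply: rpred_sum => g _; apply: rpred_sum => k _; apply: graded_mem (pi_in _ _).
- move: x y; apply: graded_ind2 => [g k x y xg yk|x x' y _ _ _ Ex Ex'|x y y' _ _ _ Ey Ey'].
  + by rewrite (cE _ _ _ _ xg yk) (cE _ _ _ _ yk xg) (fC x y) ?(graded_mem xg) ?(graded_mem yk) //
      linearZ /= [k + g]addrC.
  + by rewrite (bilinDl cb) (bilinDr cb) scalerDr Ex Ex'.
  + by rewrite (bilinDl cb) (bilinDr cb) scalerDr Ey Ey'.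
- move: a b aS bS; apply: graded_ind2 => [g k a b ag bk|a a' b _ _ _ Ea Ea'|a b b' _ _ _ Eb Eb'];
    last 2 first.
  + by rewrite !dl Ea Ea' (bilinDl cb) (bilinDr cb) addrACA.
  + by rewrite !dr Eb Eb' (bilinDl cb) (bilinDr cb) addrACA.
  have DG l x' : x' \in Gam l -> inner_der a b x' \in Gam (g + k + l).
    move=> xl; rewrite /inner_der memvB //; first by rewrite -addrA; apply: (prod) => //; apply: prod.
    by rewrite [g + k]addrC -addrA; apply: (prod) => //; apply: prod.
  have Dpi l x' : x' \in S -> pi (g + k + l) (inner_der a b x') = inner_der a b (pi l x').
    move=> xS'; have [aS bS] := (graded_mem ag, graded_mem bk).
    have pS u v : p u v \in S by apply: q0prod_closed.
    have pp := graded_proj_prod pi1 pi0.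
    rewrite linearB /= -{1}addrA (pp _ _ _ _ ag) // (pp _ _ _ _ bk) //.
    by rewrite [g + k]addrC -addrA (pp _ _ _ _ bk) // (pp _ _ _ _ ag).
  move: x y xS yS; apply: graded_ind2 => [u v x y xu yv|x x' y _ _ _ Ex Ex'|x y y' _ _ _ Ey Ey'].
  + rewrite (cE _ _ _ _ xu yv) (cE _ _ _ _ (DG _ _ xu) yv) (cE _ _ _ _ xu (DG _ _ yv)).
    have [[xS yS] [aS bS]] := ((graded_mem xu, graded_mem yv), (graded_mem ag, graded_mem bk)).
    rewrite -Dpi ?fS // fD // linearD /=.
    by congr (pi _ _ + pi _ _); rewrite -?addrA //; rewrite [RHS]addrCA; congr (_ + _); rewrite addrCA.
  + by rewrite (bilinDl cb) !db Ex Ex' !(bilinDl cb) addrACA.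
  + by rewrite (bilinDr cb) !db Ey Ey' !(bilinDr cb) addrACA.
have pC u v : p u v = p v u by rewrite q0prod_swap (_ : - swap_sign = 1) ?scale1r // /swap_sign cJ opprK.
move: z zS; apply: (decomposes_ind decG) => [w z zw|z z' _ _ Ez Ez']; last first.
  by rewrite !(bilinDr pb) !(bilinDr cb) (bilinDr pb) Ez Ez' addrACA.
move: x y xS yS; apply: graded_ind2 => [u v x y xu yv|x x' y _ _ _ Ex Ex'|x y y' _ _ _ Ey Ey'].
- have [[xS yS] zS] := ((graded_mem xu, graded_mem yv), graded_mem zw).
  rewrite (cE _ _ _ _ xu (prod _ _ _ _ yv zw)) (cE _ _ _ _ xu yv) (cE _ _ _ _ xu zw).
  have pp := graded_proj_prod pi1 pi0.
  rewrite fJ // linearD /= [p (pi _ _) z]pC -(pp _ _ _ _ zw) ?fS // -(pp _ _ _ _ yv) ?fS //.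
  rewrite [p z _]pC; congr (pi _ _ + pi _ _); rewrite ?addrA.
    by rewrite addrC !addrA.
  by congr (_ + _ + _); rewrite addrC.
- by rewrite !(bilinDl cb) (bilinDl pb) (bilinDr pb) Ex Ex' addrACA.
- by rewrite !(bilinDl pb) !(bilinDr cb) (bilinDl pb) Ey Ey' addrACA.
Qed.

End Component.

Lemma qodd_hom_neq0 : exists g k x y, [/\ x \in Gam g, y \in Gam k & q x y != 0].
Proof.
apply: contrapT => none.
have q0 x y : x \in S -> y \in S -> q x y = 0.
  move: x y; apply: graded_ind2 => [g k x y xg yk|x x' y _ _ _ Ex Ex'|x y y' _ _ _ Ey Ey'].
  - by have [//|qxy] := eqVneq (q x y) 0; case: none; exists g, k, x, y.
  - by rewrite (bilinDl qodd_bilin) Ex Ex' addr0.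
  - by rewrite (bilinDr qodd_bilin) Ey Ey' addr0.
have [x [y [z [xS yS _]]]] := qodd_neq0.
by rewrite q0 // (bilin0l q0prod_bilin) eqxx.
Qed.

Lemma qodd_homogeneous : exists h, forall g k x y,
  x \in Gam g -> y \in Gam k -> q x y \in Gam (g + k + h).
Proof.
have [s [pi [us pi_in pi1 pi0 pi_sum]]] := decomposes_proj decG.
have [g0 [k0 [x0 [y0 [xg yk qxy]]]]] := qodd_hom_neq0.
have [l l_neq0] : exists l, pi l (q x0 y0) != 0.
  apply: contrapT => none; move: qxy; rewrite (pi_sum _ (qodd_mem x0 y0)) big1 ?eqxx //.
  by move=> l _; apply/eqP/negPn/negP=> E; apply: none; exists l.
(* A degree in which [q] has a nonzero homogeneous part; by the classification this part is a
   nonzero multiple of [q]. *)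
pose t := l - (g0 + k0).
have nf : natural_map (component s pi q t).
  by apply: component_natural => //; apply: qodd_natural.
have cE g k x y : x \in Gam g -> y \in Gam k ->
    component s pi q t x y = pi (g + k + t) (q x y).
  by apply: component_hom => //; apply: qodd_natural.
have [a Ea] := natural_classification nf.
have a_neq0 : a != 0.
  apply: contraNneq l_neq0 => a0; have := cE _ _ _ _ xg yk.
  by rewrite Ea ?(graded_mem xg) ?(graded_mem yk) // a0 scale0r addrC subrK => <-.
exists t => g k x y xg' yk'; have := cE _ _ _ _ xg' yk'.
rewrite Ea ?(graded_mem xg') ?(graded_mem yk') // => E.
by rewrite -[q x y](scalerK a_neq0) E memvZ // pi_in.
Qed.

End GradedPieces.

End Queer.

(** * The degree of the odd product and gradings of Type I *)

HB.instance Definition _ (F : fieldType) (k : nat) :=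
  GRing.isLinear.Build F 'M[F]_k 'M[F]_k *:%R (@sharp F k) (@sharpD F k).

Section Degree.
Variables (F : fieldType) (c : qcase) (n : nat).
Hypotheses (two_neq0 : 2%:R != 0 :> F) (n_ge2 : (2 <= n)%N).
Hypothesis lie_neq0 : c = Lie -> n.+1%:R != 0 :> F.

Local Notation M := 'M[F]_(qdim c n).
Local Notation S := (q0space F c n).
Local Notation p := (@q0prod F c n).
Local Notation q := (@qodd F c n).

Lemma q0space_Jordan : c = Jordan -> S = fullv.
Proof. by rewrite /q0space; case: c. Qed.

Lemma mem_q0space_Lie : c = Lie -> forall x, (x \in S) = (\tr x == 0).
Proof. by rewrite /q0space; case: c => // _ x; rewrite mem_sl. Qed.

Lemma q0prod_qoddE x y z :
  p (q x y) z = if c is Lie then comm (acomm x y) z else acomm (comm x y) z.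
Proof.
rewrite /q0prod /qodd; case: c x y z => // x y z.
by rewrite commC comm_sharp -commC.
Qed.

Lemma q0prod_add_qodd_Jordan : c = Jordan ->
  forall x y, p x y + q x y = 2%:R *: (x *m y).
Proof.
by rewrite /q0prod /qodd; case: c => // _ x y; rewrite addrACA subrr addr0 scaler_nat mulr2n.
Qed.

Lemma qodd_qodd_Jordan : c = Jordan ->
  forall x y z, q y (q x z) = p (p x y) z - p x (p y z).
Proof. by rewrite /qodd /q0prod; case: c => // _ x y z; apply: comm_comm_acomm. Qed.

(* The trace form, normalized so as to be the coefficient in [qodd_qodd_Lie]. *)
Definition trform (x y : M) : F := 2%:R * ((qdim c n)%:R^-1 * \tr (acomm x y)).

Lemma trformD x y z : trform x (y + z) = trform x y + trform x z.
Proof. by rewrite /trform (bilinDr (@acomm_bilin _ _)) raddfD /= !mulrDr. Qed.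

Lemma trformC x y : trform x y = trform y x.
Proof. by rewrite /trform acommC. Qed.

Lemma q0prod_add_qodd_Lie : c = Lie ->
  forall x y, p x y + q x y + (2%:R^-1 * trform x y)%:M = 2%:R *: (x *m y).
Proof.
rewrite /trform /q0prod /qodd; case: c => // _ x y.
by rewrite mulKf // -addrA subrK addrACA addNr addr0 scaler_nat mulr2n.
Qed.

(** This is [comm_comm_acomm] with each inner anticommutator split into its sharp part and a scalar;
    the scalars produce the trace terms. Applying [sharp] throughout keeps the left side, a
    commutator, unchanged. *)
Lemma qodd_qodd_Lie : c = Lie -> forall x y z, x \in S -> y \in S -> z \in S ->
  p y (p x z) = q (q x y) z - q x (q y z) + trform x y *: z - trform y z *: x.
Proof.
rewrite /trform /qodd /q0prod /q0space; case: c => // _ x y z; rewrite !mem_sl.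
move=> /eqP x0 /eqP y0 /eqP z0.
have E (u v w : 'M[F]_n.+1) : \tr w = 0 -> sharp (acomm (acomm u v) w) =
    sharp (acomm (sharp (acomm u v)) w) + (2%:R * ((n.+1)%:R^-1 * \tr (acomm u v))) *: w.
  move=> w0; set a := _^-1 * _; rewrite -[X in _ + X](sharp_id (x := _)); last first.
    by rewrite mxtraceZ w0 mulr0.
  rewrite -linearD /=; congr sharp.
  have aw : acomm a%:M w = (2%:R * a) *: w.
    by rewrite /acomm scalar_mxC mul_scalar_mx -mulr2n -scaler_nat scalerA.
  by rewrite [sharp (acomm u v)]/sharp -/a (bilinBl (@acomm_bilin _ _)) aw subrK.
rewrite -[LHS]sharp_id ?mxtrace_comm // comm_comm_acomm linearB /= E //.
rewrite [acomm x (acomm y z)]acommC E // [acomm (sharp (acomm y z)) x]acommC.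
by rewrite opprD addrACA addrA.
Qed.

Lemma qodd_qodd_neq0 : c = Jordan -> exists x y z : M, q y (q x z) != 0.
Proof.
move: n_ge2; rewrite /qodd; case: c => // m_gt1 _.
pose i := Ordinal (ltnW m_gt1); pose j := Ordinal m_gt1.
exists (delta_mx i j), (delta_mx i j), (delta_mx j i).
rewrite comm_delta (bilinBr (@comm_bilin _ _)) !eqxx !comm_delta !eqxx /= !mulr0n !mulr1n.
by rewrite sub0r subr0 -opprD oppr_eq0 -mulr2n -scaler_nat scaler_eq0 (negbTE two_neq0)
  delta_mx_neq0.
Qed.

(** A triple for which the two trace terms of [qodd_qodd_Lie] alone cannot account for the left
    side. *)
Lemma q0prod_q0prod_notin_span : c = Lie -> exists x y z, [/\ x \in S, y \in S, z \in S &
  forall a b, p y (p x z) != a *: z - b *: x].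
Proof.
move: n_ge2; rewrite /q0prod /q0space; case: c => // m_gt2 _.
have {}m_gt2 : (2 < n.+1)%N by []. have m_gt1 := ltnW m_gt2.
pose i := Ordinal (ltnW m_gt1); pose j := Ordinal m_gt1; pose k := Ordinal m_gt2.
exists (delta_mx i j), (delta_mx i k), (delta_mx j i).
rewrite !mem_sl !mxtrace_delta !eqxx; split=> // a b.
rewrite comm_delta !eqxx (bilinBr (@comm_bilin _ _)) !comm_delta /= !mulr0n !mulr1n.
rewrite !subr0 sub0r; apply/eqP=> /matrixP/(_ i k)/eqP; rewrite !mxE /= !mulr0 subrr.
by rewrite oppr_eq0 oner_eq0.
Qed.

Section Graded.
Variables (G : zmodType) (Gam : G -> {vspace M}) (h : G).
Hypothesis gradG : prod_graded Gam.
Hypothesis degG : forall g k x y, x \in Gam g -> y \in Gam k -> q x y \in Gam (g + k + h).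

Let decG := gradG.1.

(* Compare degrees in the associator identity: in the Lie case, if 2h were not 0
   then y (x z) would be a combination of x and z. *)
Lemma odd_degree_order2 : h *+ 2 = 0.
Proof.
apply/eqP/negPn/negP=> h2.
have [s [pi [us pi_in pi1 pi0 pi_sum]]] := decomposes_proj decG.
have [_ prod] := gradG.
have label g k l : g + k + l != k + (g + l + h) + h.
  rewrite [g + k]addrC -!addrA !(inj_eq (addrI _)) -[X in X == _]addr0 !addrA.
  rewrite -[X in _ == X]addrA -mulr2n (inj_eq (addrI _)) eq_sym.
  exact: h2.
have [cJ|cL] : c = Jordan \/ c = Lie by case: c; [right | left].
  have [x [y [z]]] := qodd_qodd_neq0 cJ; move=> /eqP; apply.
  have SE := q0space_Jordan cJ.
  have : [/\ x \in S, y \in S & z \in S] by rewrite SE !memvf.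
  have qb := @qodd_bilin F c n.
  case=> xS yS zS; move: y yS.
  apply: (decomposes_ind decG) => [k y yk|y y' _ _ E E']; last by rewrite (bilinDl qb) E E' addr0.
  move: x z xS zS; apply: (graded_ind2 gradG) => [g l x z xg zl|x x' z _ _ _ E E'|x z z' _ _ _ E E'].
  - apply/eqP; apply: contraTT (label g k l) => E; rewrite negbK.
    apply/eqP; apply: (decomposes_eq_label decG) E; last by exact: degG yk (degG xg zl).
    rewrite (qodd_qodd_Jordan cJ) memvB //; last by rewrite -addrA; exact: prod xg (prod _ _ _ _ yk zl).
    exact: prod (prod _ _ _ _ xg yk) zl.
  - by rewrite (bilinDl qb) (bilinDr qb) E E' addr0.
  - by rewrite !(bilinDr qb) E E' addr0.
have [x [y [z [xS yS zS]]]] := q0prod_q0prod_notin_span cL.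
suff [tau E] : exists tau : M -> F, forall x z, x \in S -> z \in S ->
    p y (p x z) = tau x *: z - tau z *: x.
  by move/(_ (tau x) (tau z)); rewrite E // eqxx.
have pb := @q0prod_bilin F c n.
move: y yS {x z xS zS}; apply: (decomposes_ind decG) => [k y yk|y y' _ _ [t E] [t' E']]; last first.
  exists (fun x => t x + t' x) => x z xS zS; rewrite (bilinDl pb) E // E' // !scalerDl opprD.
  exact: addrACA.
(* Projection to degree g + k + l removes the iterated odd products. The trace term in [z] survives
   only for g = -k and the one in [x] only for l = -k, hence the projector to degree -k. *)
exists (fun x => trform y (pi (- k) x)).
apply: (graded_ind2 gradG) => [g l x z xg zl|x x' z _ _ _ Ex Ex'|x z z' _ _ _ Ez Ez'].
- have [xS [yS zS]] := (graded_mem gradG xg, (graded_mem gradG yk, graded_mem gradG zl)).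
  have E := qodd_qodd_Lie cL xS yS zS.
  have := congr1 (pi (g + k + l)) E.
  rewrite pi1; last by rewrite [g + k]addrC -addrA; exact: prod yk (prod _ _ _ _ xg zl).
  move=> ->; rewrite !(linearB, linearD, linearZ) /=.
  have d1 : q (q x y) z \in Gam (k + (g + l + h) + h).
    by have := degG (degG xg yk) zl; rewrite [g + k]addrC -!addrA [h + (l + h)]addrCA.
  have d2 : q x (q y z) \in Gam (k + (g + l + h) + h).
    by have := degG xg (degG yk zl); rewrite !addrA [g + k]addrC.
  rewrite (pi0 _ _ _ _ d1) 1?eq_sym ?label // (pi0 _ _ _ _ d2) 1?eq_sym ?label //.
  rewrite subrr add0r; rewrite !scalerN; congr (_ - _).
    have [gk|gk] := eqVneq g (- k).
      have xk : x \in Gam (- k) by rewrite -gk.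
      by rewrite gk addNr add0r (pi1 l) // (pi1 (- k)) // trformC.
    rewrite (pi0 _ _ gk) // (pi0 _ l) ?scaler0 //.
      by rewrite -[trform y 0](addrK (trform y 0)) -trformD addr0 subrr scale0r.
    by rewrite -{1}[l]add0r (inj_eq (addIr l)) eq_sym addr_eq0.
  have [lk|lk] := eqVneq l (- k).
    have zk : z \in Gam (- k) by rewrite -lk.
    by rewrite lk addrK (pi1 g) // (pi1 (- k)).
  rewrite (pi0 _ _ lk) // (pi0 _ g) ?scaler0 //.
    by rewrite -[trform y 0](addrK (trform y 0)) -trformD addr0 subrr scale0r.
  by rewrite -{1}[g]addr0 -addrA (inj_eq (addrI g)) eq_sym addrC addr_eq0.
- rewrite (bilinDl pb) (bilinDr pb) Ex Ex' [pi _ (_ + _)]linearD trformD scalerDl scalerDr opprD.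
  exact: addrACA.
- rewrite !(bilinDr pb) Ez Ez' [pi _ (_ + _)]linearD trformD scalerDl scalerDr opprD.
  exact: addrACA.
Qed.

Lemma q0prod_neq0 : exists x y, [/\ x \in S, y \in S & p x y != 0].
Proof.
have [x [y [z [_ _ zS pq]]]] := @qodd_neq0 F c n two_neq0 n_ge2.
by exists (q x y), z; rewrite (qodd_mem lie_neq0).
Qed.

(** Commutators and anticommutators respect the degrees of [Del], so [p (q x y) z] has degree g + k
    + l; by [degG] its degree is also g + k + h + l. *)
Lemma typeI_odd_degree0 : typeI Gam -> h = 0.
Proof.
move=> [Del [gradD GD]].
have [_ prod] := gradG.
have mul g k x y : x \in Del g -> y \in Del k -> x *m y \in Del (g + k).
  by case: gradD => _ _ _ mul _; apply: mul.
have DG g x : x \in Gam g -> x \in Del g by rewrite GD memv_cap => /andP[].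
have pq g k l x y z : x \in Gam g -> y \in Gam k -> z \in Gam l ->
    p (q x y) z \in Gam (g + k + l).
  move=> /DG xg /DG yk /DG zl; rewrite GD memv_cap q0prod_closed andbT.
  have C : comm x y \in Del (g + k) by apply: memvB; [|rewrite addrC]; apply: (mul).
  have A : acomm x y \in Del (g + k) by apply: memvD; [|rewrite addrC]; apply: (mul).
  rewrite q0prod_qoddE; have CI := mul _ _ _ _ C zl; have IC := mul _ _ _ _ zl C.
  have AI := mul _ _ _ _ A zl; have IA := mul _ _ _ _ zl A.
  rewrite [l + _]addrC in IC IA.
  have mem b : (if b is Lie then comm (acomm x y) z else acomm (comm x y) z) \in Del (g + k + l).
    by case: b; [apply: memvB | apply: memvD].
  exact: mem.
apply/eqP/negPn/negP=> h0.
have [x [y [z [xS yS zS]]]] := @qodd_neq0 F c n two_neq0 n_ge2.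
move=> /eqP; apply.
have pb := @q0prod_bilin F c n; have qb := @qodd_bilin F c n.
move: z zS; apply: (decomposes_ind decG) => [l z zl|z z' _ _ E E']; last by rewrite (bilinDr pb) E E' addr0.
move: x y xS yS; apply: (graded_ind2 gradG) => [g k x y xg yk|x x' y _ _ _ E E'|x y y' _ _ _ E E'].
- apply/eqP; apply: contraNT h0 => E; apply/eqP.
  have := decomposes_eq_label decG (pq _ _ _ _ _ _ xg yk zl) (prod _ _ _ _ (degG xg yk) zl) E.
  by move=> /eqP; rewrite -!addrA !(inj_eq (addrI _)) -{1}[l]add0r (inj_eq (addIr l)) => /eqP.
- by rewrite (bilinDl qb) (bilinDl pb) E E' addr0.
- by rewrite (bilinDr qb) (bilinDl pb) E E' addr0.
Qed.

Lemma odd_degree0_typeI : h = 0 -> typeI Gam.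
Proof.
move=> h0; have [sS span dir] := decG; have [_ prod] := gradG.
have deg0 g k x y : x \in Gam g -> y \in Gam k -> q x y \in Gam (g + k).
  by move=> xg yk; have := degG xg yk; rewrite h0 addr0.
have [cJ|cL] : c = Jordan \/ c = Lie by case: c; [right | left].
  exists Gam; split=> [|g]; last by rewrite q0space_Jordan // capvf.
  split=> [g|x _|s us|g k x y xg yk|g] /=.
  - by rewrite /carrier /= addv0 subvf.
  - by apply: span; rewrite q0space_Jordan ?memvf.
  - exact: dir.
  - rewrite -[x *m y](scalerK two_neq0) memvZ //.
    by rewrite -q0prod_add_qodd_Jordan // memvD ?prod ?deg0.
  - by rewrite capvf capv0 addv0.
(* Associative products of traceless matrices acquire a scalar part, so the identity matrix is
   adjoined in degree 0. *)
pose Del g := if g == 0 then (Gam 0 + <[1%:M : M]>)%VS else Gam g.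
have m_neq0 : (qdim c n)%:R != 0 :> F by rewrite /qdim; case: c cL lie_neq0 => // _ ->.
have memS := mem_q0space_Lie cL.
have GD g : (Gam g <= Del g)%VS.
  by rewrite /Del; case: eqP => [->|_]; rewrite ?addvSl ?subvv.
have oneD : 1%:M \in Del 0 by rewrite /Del eqxx (subvP (addvSr _ _)) // memv_line.
have DelP g x : x \in Del g -> exists y a, [/\ y \in Gam g, a = 0 \/ g = 0 & x = y + a%:M].
  rewrite /Del; case: eqP => [->|_].
    move=> /memv_addP[y yg [_ /vlineP[a ->] ->]]; exists y, a; split=> //; first by right.
    by rewrite scalemx1.
  by move=> xg; exists x, 0; split=> //; [left | rewrite raddf0 addr0].
(* If g + k were not 0, projecting [qodd_qodd_Lie] to a degree l other than g would leave only a
   nonzero multiple of [z], so all of [S] would have degree g. A nonzero product then forces g = 0,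
   and k = g because [y] is nonzero. *)
have tr_hom g k x y : x \in Gam g -> y \in Gam k -> trform x y != 0 -> g + k = 0.
  move=> xg yk t0; apply/eqP/negPn/negP=> gk.
  have only l : l != g -> Gam l = 0%VS.
    move=> lg; apply/eqP; rewrite -subv0; apply/subvP=> z zl; rewrite memv0.
    have [xS [yS zS]] := (graded_mem gradG xg, (graded_mem gradG yk, graded_mem gradG zl)).
    have := qodd_qodd_Lie cL xS yS zS.
    have [s [pi [us pi_in pi1 pi0 pi_sum]]] := decomposes_proj decG.
    move=> /(congr1 (pi l)); rewrite !(linearB, linearD, linearZ) /=.
    have lgkl : g + k + l != l by rewrite -{2}[l]add0r (inj_eq (addIr l)).
    have gl : g != l by rewrite eq_sym.
    have P1 : p y (p x z) \in Gam (g + k + l).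
      by rewrite [g + k]addrC -addrA; exact: prod yk (prod _ _ _ _ xg zl).
    have P2 := deg0 _ _ _ _ (deg0 _ _ _ _ xg yk) zl.
    have P3 : q x (q y z) \in Gam (g + k + l).
      by rewrite -addrA; exact: deg0 xg (deg0 _ _ _ _ yk zl).
    rewrite (pi0 _ _ lgkl _ P1) (pi0 _ _ lgkl _ P2) (pi0 _ _ lgkl _ P3) (pi0 _ _ gl _ xg).
    rewrite (pi1 l z zl) subrr add0r oppr0 scaler0 addr0 => /esym/eqP.
    by rewrite scaler_eq0 (negbTE t0).
  have Sg : forall z, z \in S -> z \in Gam g.
    apply: (decomposes_ind decG) => [l w wl|w w' _ _]; last exact: memvD.
    by have [<-//|/only E] := eqVneq l g; move: wl; rewrite E memv0 => /eqP->; rewrite mem0v.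
  have [u [v [uS vS uv]]] := q0prod_neq0.
  have := decomposes_eq_label decG (prod _ _ _ _ (Sg u uS) (Sg v vS)) (Sg _ (q0prod_closed _ _)) uv.
  move=> /eqP; rewrite -[X in _ == X]addr0 (inj_eq (addrI g)) => /eqP g0.
  have y_neq0 : y != 0.
    apply: contraNneq t0 => ->.
    by rewrite -[trform x 0](addrK (trform x 0)) -trformD addr0 subrr.
  have kg := decomposes_eq_label decG yk (Sg y (graded_mem gradG yk)) y_neq0.
  by rewrite kg g0 addr0 eqxx in gk.
have sharpE x a : x \in S -> sharp (x + a%:M) = x.
  rewrite memS /sharp => /eqP x0; rewrite mxtraceD x0 add0r mxtrace_scalar.
  by rewrite -[a *+ _]mulr_natl mulKf // addrK.
exists Del; split=> [|g]; last first.
  apply/eqP; rewrite eqEsubv subv_cap GD sS /=; apply/subvP=> x.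
  rewrite memv_cap memS => /andP[/DelP[y [a [yg _ ->]]]].
  have := graded_mem gradG yg; rewrite memS => /eqP y0.
  rewrite mxtraceD y0 add0r mxtrace_scalar -mulr_natl mulf_eq0 (negbTE m_neq0) => /eqP->.
  by rewrite raddf0 addr0.
have spanD x : spanned Del x.
  have -> : x = sharp x + ((qdim c n)%:R^-1 * \tr x)%:M by rewrite subrK.
  apply: spannedD; last first.
    by apply: (@spanned_mem _ _ _ _ 0); rewrite -scalemx1 memvZ.
  have [|s xs] := span (sharp x).
    by rewrite memS /sharp raddfB /= mxtrace_scalar -[_ *+ _]mulr_natl mulVKf ?subrr.
  elim: s {x} (sharp x) xs => [|g s IH] x.
    by rewrite big_nil memv0 => /eqP->; exists [::]; rewrite mem0v.
  rewrite big_cons => /memv_addP[y yg [z /IH zs ->]]; apply: spannedD => //.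
  by apply: (@spanned_mem _ _ _ _ g); apply: subvP yg.
split=> [g|x _|s us|g k x y|g] /=.
- by rewrite /carrier /= addv0 subvf.
- exact: spanD.
- suff dD : decomposes fullv Del by have [_ _ dirD] := dD; apply: dirD.
  have [t [pi [_ pi_in pi1 pi0 pi_sum]]] := decomposes_proj decG.
  apply: decomposesI => [g|x _|g]; [exact: subvf | exact: spanD |].
  pose sh : 'End(M) := linfun (@sharp F (qdim c n)).
  have shE x : sh x = sharp x by rewrite lfunE.
  (* [sh] strips the scalar part, and in degree 0 the summand [\1 - sh] restores it. *)
  exists (if g == 0 then pi 0 \o sh + (\1 - sh) else pi g \o sh)%VF.
  split=> [x|k kg x] /DelP[y [a [yg ag ->]]].
    have yS := graded_mem gradG yg; case: eqVneq ag yg => [->|g0] [] // a0 yg.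
    - by rewrite !(add_lfunE, comp_lfunE, opp_lfunE, id_lfunE) !shE sharpE // pi1 // addrC subrK.
    - by rewrite !(add_lfunE, comp_lfunE, opp_lfunE, id_lfunE) !shE sharpE // pi1 // addrC subrK.
    - by rewrite !(add_lfunE, comp_lfunE, opp_lfunE, id_lfunE) !shE sharpE // pi1 // a0 raddf0 addr0.
    - by rewrite a0 eqxx in g0.
  have yS := graded_mem gradG yg; case: (eqVneq g 0) kg => [->|g0] kg.
    case: ag => [->|k0]; last by rewrite k0 eqxx in kg.
    by rewrite !(add_lfunE, comp_lfunE, opp_lfunE, id_lfunE) !shE sharpE // (pi0 _ k) // raddf0 addr0 subrr addr0.
  by rewrite !(add_lfunE, comp_lfunE, opp_lfunE, id_lfunE) !shE sharpE // (pi0 _ k).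
- move=> /DelP[x' [a [xg ag ->]]] /DelP[y' [b [yk bk ->]]].
  rewrite mulmxDl !mulmxDr scalar_mxC !mul_scalar_mx.
  apply: memvD; apply: memvD.
  - rewrite -[x' *m y'](scalerK two_neq0) memvZ // -q0prod_add_qodd_Lie //.
    apply: memvD; first by apply: (subvP (GD _)); rewrite memvD ?prod ?deg0.
    have [->|/(tr_hom _ _ _ _ xg yk)->] := eqVneq (trform x' y') 0.
      by rewrite mulr0 raddf0 mem0v.
    by rewrite -scalemx1 memvZ.
  - case: bk => [->|->]; first by rewrite scale0r mem0v.
    by rewrite addr0 memvZ // (subvP (GD _)).
  - case: ag => [->|->]; first by rewrite scale0r mem0v.
    by rewrite add0r memvZ // (subvP (GD _)).
  - case: ag => [->|->]; first by rewrite scale0r mem0v.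
    case: bk => [->|->]; first by rewrite raddf0 scaler0 mem0v.
    by rewrite addr0 memvZ // -scalemx1 memvZ.
- by rewrite capvf capv0 addv0.
Qed.

End Graded.
End Degree.

(** * The distinguished element *)

Section Coarsening.
Variables (F : fieldType) (c : qcase) (n : nat).
Hypotheses (two_neq0 : 2%:R != 0 :> F) (n_ge2 : (2 <= n)%N).
Hypothesis lie_neq0 : c = Lie -> n.+1%:R != 0 :> F.

Local Notation M := 'M[F]_(qdim c n).
Local Notation S := (q0space F c n).
Local Notation p := (@q0prod F c n).
Local Notation q := (@qodd F c n).

Definition odd_degree (G : zmodType) (Gam : G -> {vspace M}) (h : G) : Prop :=
  forall g k x y, x \in Gam g -> y \in Gam k -> q x y \in Gam (g + k + h).

Section Coarsening2.
Variables (G : zmodType) (Gam : G -> {vspace M}) (d : G).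
Hypothesis gradG : prod_graded Gam.
Hypotheses (d_neq0 : d != 0) (d_order2 : d *+ 2 = 0).

Let cls (g : G) : quot_by (fun x : G => x = d) := quot_pi _ g.
Let coarse := coarsening2 (h := d) Gam.

Lemma cls_eq g g' : cls g = cls g' <-> g = g' \/ g = g' + d.
Proof.
split=> [/quot_pi_eq/gen_subgroup1[m E]|[->|->]] //; last first.
  by apply/quot_pi_eq; rewrite addrAC subrr add0r; apply: gen_mem.
(* As 2d = 0, only the parity of the coefficient matters. *)
have E2 : d *~ m = d *+ odd `|m|%N.
  have dN : - d = d by apply/eqP; rewrite -subr_eq0 -opprD oppr_eq0 -mulr2n d_order2.
  have dMn k : d *+ k = d *+ odd k.
    by rewrite -{1}[k]odd_double_half mulrnDr -mul2n mulrnA d_order2 mul0rn addr0.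
  case: m {E} => k; first by rewrite -pmulrn absz_nat dMn.
  by rewrite NegzE mulrNz -mulNrz dN abszN -pmulrn dMn.
have -> : g = g' + (g - g') by rewrite addrC subrK.
by rewrite E E2; case: odd; [right | left; rewrite addr0].
Qed.

Lemma cls_repr k : cls (repr k) = k.
Proof. exact: reprK. Qed.

Lemma coarse_mem g x : x \in Gam g -> x \in coarse (cls g).
Proof.
move=> xg; have /cls_eq := cls_repr (cls g).
rewrite /coarse /coarsening2; set r := repr (cls g) => -[E|E].
  by rewrite E (subvP (addvSl _ _)).
rewrite (subvP (addvSr _ _)) // (_ : r + d = g) // E.
by rewrite -addrA -mulr2n d_order2 addr0.
Qed.

Lemma coarse_memP k x : x \in coarse k -> exists g g' y y',
  [/\ y \in Gam g, y' \in Gam g', cls g = k, cls g' = k & x = y + y'].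
Proof.
move=> /memv_addP[y yg [y' yg' ->]]; exists (repr k), (repr k + d), y, y'.
split=> //; first exact: cls_repr.
by rewrite -[RHS]cls_repr; apply/cls_eq; right.
Qed.

Lemma coarse_bilin (f : M -> M -> M) t : bilinear_map f ->
    (forall g k x y, x \in Gam g -> y \in Gam k -> f x y \in Gam (g + k + t)) ->
  forall g k x y, x \in coarse g -> y \in coarse k -> f x y \in coarse (g + k + cls t).
Proof.
move=> fb fG gc kc x y xg yk.
have [g [g' [x1 [x2 [x1g x2g Eg1 Eg ->]]]]] := coarse_memP xg.
have [k [k' [y1 [y2 [y1k y2k Ek1 Ek ->]]]]] := coarse_memP yk.
rewrite -Eg1 -Ek1; rewrite -Eg1 in Eg; rewrite -Ek1 in Ek.
have piD : {morph cls : a b / a + b} by move=> a b; apply: raddfD.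
rewrite !(bilinDl fb) !(bilinDr fb) -!piD.
apply: memvD; apply: memvD.
- by apply: coarse_mem; apply: fG.
- by rewrite piD piD -Ek -!piD; apply: coarse_mem; apply: fG.
- by rewrite piD piD -Eg -!piD; apply: coarse_mem; apply: fG.
- by rewrite piD piD -Eg -Ek -!piD; apply: coarse_mem; apply: fG.
Qed.

Lemma coarse_graded : prod_graded coarse.
Proof.
have [decG prod] := gradG; have [sS span _] := decG.
split; last first.
  move=> g k x y xg yk; have := @coarse_bilin p 0 (q0prod_bilin F c n) _ g k x y xg yk.
  rewrite /cls (_ : quot_pi _ 0 = 0) ?addr0; last exact: raddf0.
  by apply=> g' k' x' y' xg' yk'; rewrite addr0; apply: prod.
have [s [pi [us pi_in pi1 pi0 pi_sum]]] := decomposes_proj decG.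
have d_fix g : g != g + d by rewrite -{1}[g]addr0 (inj_eq (addrI g)) eq_sym.
apply: decomposesI => [k|x xS|k].
- by rewrite /coarse /coarsening2 subv_add !sS.
- move: x xS; apply: (decomposes_ind decG) => [g x xg|x y _ _]; last exact: spannedD.
  by apply: (@spanned_mem _ _ _ _ (cls g)); apply: coarse_mem.
(* The two labels in a coset differ because [d] is nonzero, so the sum of their projectors is the
   projector of the coset. *)
exists (pi (repr k) + pi (repr k + d)); split=> [x|l lk x].
  move=> /memv_addP[y yg [y' yg' ->]]; rewrite add_lfunE !linearD /=.
  rewrite (pi1 _ _ yg) (pi1 _ _ yg') (pi0 _ _ _ _ yg') 1?eq_sym // (pi0 _ _ _ _ yg) //.
  by rewrite addr0 add0r.
move=> /coarse_memP[g [g' [y [y' [yg yg' Eg Eg' ->]]]]].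
have neq a : cls a = l -> (a != repr k) && (a != repr k + d).
  move=> Ea; rewrite -negb_or; apply: contraNN lk => E; rewrite -Ea -[X in _ == X]cls_repr.
  by apply/eqP/cls_eq; case/orP: E => /eqP->; [left | right].
have /andP[g1 g2] := neq _ Eg; have /andP[g1' g2'] := neq _ Eg'.
rewrite add_lfunE !linearD /= (pi0 _ _ g1) // (pi0 _ _ g2) // (pi0 _ _ g1') // (pi0 _ _ g2') //.
by rewrite !addr0.
Qed.

End Coarsening2.

Section Distinguished.
Variables (G : zmodType) (Gam : G -> {vspace M}).
Hypothesis gradG : prod_graded Gam.

Lemma distinguished_odd_degree : odd_degree Gam (distinguished Gam).
Proof.
have [h degG] := qodd_homogeneous two_neq0 n_ge2 lie_neq0 gradG.
suff -> : distinguished Gam = h by [].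
have h2 := odd_degree_order2 two_neq0 n_ge2 gradG degG.
have degC d (d0 : d != 0) (d2 : d *+ 2 = 0) : odd_degree (coarsening2 (h := d) Gam) (quot_pi _ h).
  by move=> g k x y; apply: coarse_bilin => //; apply: qodd_bilin.
rewrite /distinguished; case: pselect => [tI|ntI].
  by rewrite (typeI_odd_degree0 two_neq0 n_ge2 gradG degG tI).
have h0 : h != 0.
  by apply/eqP=> h0; apply: ntI; exact: (odd_degree0_typeI two_neq0 n_ge2 lie_neq0 gradG degG h0).
case: xgetP => [d _ [d0 d2 dI]|none].
  (* Type I for the coarsening modulo [d] puts [h] in {0, d}, and Type II excludes 0. *)
  have := typeI_odd_degree0 two_neq0 n_ge2 (coarse_graded gradG d0 d2) (degC d d0 d2) dI.
  move=> E; have : quot_pi (fun x : G => x = d) h = quot_pi _ 0 by rewrite E; apply/esym/raddf0.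
  move=> /(cls_eq d2)[h_eq0|]; first by rewrite h_eq0 eqxx in h0.
  by rewrite add0r.
(* [h] itself has the three properties, so the default value of [xget] does not occur. *)
case: (none h); split=> //; apply: (odd_degree0_typeI two_neq0 n_ge2 lie_neq0 (coarse_graded gradG h0 h2) (degC h h0 h2)).
rewrite -[RHS](raddf0 (quot_pi _)); apply/(cls_eq h2); right.
by rewrite add0r.
Qed.

End Distinguished.
End Coarsening.

(** * Universal groups *)

Lemma additive_of_morph (U V : zmodType) (f : U -> V) :
  {morph f : x y / x - y} -> exists g : {additive U -> V}, g =1 f.
Proof.
move=> fB; pose fA : {additive U -> V} := HB.pack f (GRing.isZmodMorphism.Build _ _ f fB).
by exists fA.
Qed.

Lemma quot_by_lift (V H : zmodType) (R : V -> Prop) (f : {additive V -> H}) :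
  (forall r, R r -> f r = 0) ->
  exists g : {additive quot_by R -> H}, forall x, g (quot_pi R x) = f x.
Proof.
move=> fR; have f0 x : gen_subgroup R x -> f x = 0.
  by elim=> [r /fR//||y z _ fy _ fz]; [exact: raddf0 | rewrite raddfB fy fz subrr].
have fE x y : quot_pi R x = quot_pi R y -> f x = f y.
  by move/quot_pi_eq/f0; rewrite raddfB => /eqP; rewrite subr_eq0 => /eqP.
have piK (u : quot_by R) : quot_pi R (repr u) = u by exact: reprK.
have [|g gE] := @additive_of_morph (quot_by R) H (fun u => f (repr u)).
  move=> u v; rewrite -raddfB; apply: fE; rewrite piK -{1}[u]piK -{1}[v]piK.
  exact/esym/raddfB.
by exists g => x; rewrite gE; apply: fE; rewrite piK.
Qed.

Lemma freeg_lift (T : choiceType) (H : zmodType) (phi : T -> H) :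
  exists f : {additive {freeg T / int} -> H}, forall t, f << t >> = phi t.
Proof.
pose L := fglift (phi : T -> zmodule H).
have LB x y : L (x - y) = L x - L y by apply: lift_is_additive.
have [f fE] := @additive_of_morph {freeg T / int} H L LB.
by exists f => t; rewrite fE /L liftU scale1r.
Qed.

Lemma freeg_additive_ext (T : choiceType) (H : zmodType) (f1 f2 : {additive {freeg T / int} -> H}) :
  (forall t, f1 << t >> = f2 << t >>) -> f1 =1 f2.
Proof.
move=> E D; rewrite -[D]freeg_sumE !raddf_sum; apply: eq_bigr => t _.
have -> : << coeff t D *g t >> = << t >> *~ coeff t D by rewrite freegU_mulz intz.
by rewrite !raddfMz E.
Qed.

Section Universal.
Variables (F : fieldType) (A : superalgebra F).
Hypothesis axA : superalgebra_axioms A.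

Lemma sprod0l (x : ambient A) : sprod 0 x = 0 :> ambient A.
Proof.
have [axl _ _ _] := axA.
by have := axl (-1) 0 0 x; rewrite scaler0 addr0 scaleN1r addNr.
Qed.

Lemma sprod0r (x : ambient A) : sprod x 0 = 0 :> ambient A.
Proof.
have [_ axr _ _] := axA.
by have := axr (-1) 0 0 x; rewrite scaler0 addr0 scaleN1r addNr.
Qed.

Section OneGrading.
Variables (G : zmodType) (Gam : G -> {vspace ambient A}).

(** The condition for a map on the support to extend to a homomorphism from the universal group, see
    [univ_lift]. *)
Definition respects_relators (H : zmodType) (phi : supp Gam -> H) : Prop :=
  forall s1 s2 s3 : supp Gam,
    (exists x y, [/\ x \in Gam (val s1), y \in Gam (val s2) & sprod x y != 0]) ->
    (forall x y, x \in Gam (val s1) -> y \in Gam (val s2) -> sprod x y \in Gam (val s3)) ->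
  phi s1 + phi s2 = phi s3.

Lemma univ_lift (H : zmodType) (phi : supp Gam -> H) : respects_relators phi ->
  exists f : {additive univ_group Gam -> H}, forall s, f (univ_class s) = phi s.
Proof.
move=> phiR; have [f fE] := freeg_lift phi.
have [r|g gE] := @quot_by_lift _ H (@univ_relator F A G Gam) f.
  move=> [s1 [s2 [s3 [nz sub ->]]]].
  by rewrite raddfB raddfD !fE (phiR _ _ s3) // subrr.
by exists g => s; rewrite gE fE.
Qed.

Lemma univ_additive_ext (H : zmodType) (f1 f2 : {additive univ_group Gam -> H}) :
  (forall s, f1 (univ_class s) = f2 (univ_class s)) -> f1 =1 f2.
Proof.
move=> E u; pose piA : {additive {freeg (supp Gam) / int} -> univ_group Gam} :=
  \pi_(quot_by (@univ_relator F A G Gam)).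
have := @freeg_additive_ext _ H (f1 \o piA) (f2 \o piA) E (repr u).
by rewrite /= reprK.
Qed.

Lemma univ_class_respects : respects_relators (@univ_class F A G Gam).
Proof.
move=> s1 s2 s3 nz sub; apply/eqP; rewrite -subr_eq0; apply/eqP.
rewrite /univ_class /quot_pi -raddfD -raddfB -[RHS](raddf0 \pi_(quot_by (@univ_relator F A G Gam))).
by apply/quot_pi_eq; rewrite subr0; apply: gen_mem; exists s1, s2, s3.
Qed.

Hypothesis gradG : is_grading Gam.
Let decG : decomposes (carrier A) Gam. Proof. by case: gradG. Qed.

Lemma supp_label (g : G) x : x \in Gam g -> x != 0 -> exists s : supp Gam, val s = g.
Proof.
move=> xg x0; have g0 : Gam g != 0%VS by apply/vspace0Pn; exists x.
by exists (exist _ g g0).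
Qed.

Lemma val_respects : respects_relators (fun s => val s).
Proof.
move=> s1 s2 s3 [x [y [x1 y2 xy]]] sub; have [_ _ _ mul _] := gradG.
exact: decomposes_eq_label decG (mul _ _ _ _ x1 y2) (sub _ _ x1 y2) xy.
Qed.

Lemma respects_val (H : zmodType) (f : {additive G -> H}) :
  respects_relators (fun s => f (val s)).
Proof. by move=> s1 s2 s3 nz sub; rewrite -raddfD (val_respects nz sub). Qed.

Lemma univ_eval : exists f : {additive univ_group Gam -> G}, forall s, f (univ_class s) = val s.
Proof. exact: univ_lift val_respects. Qed.

Lemma univ_class_inj : injective (@univ_class F A G Gam).
Proof.
by have [f fE] := univ_eval; move=> s s' /(congr1 f); rewrite !fE => /val_inj.
Qed.

Lemma has_univ_group_lift (H : zmodType) (phi : supp Gam -> H) :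
  has_univ_group Gam -> respects_relators phi ->
  exists f : {additive G -> H}, forall s, f (val s) = phi s.
Proof.
move=> [e [[e' eK e'K] eE]] /univ_lift[f fE].
have [|g gE] := @additive_of_morph G H (f \o e').
  move=> x y /=; rewrite -raddfB; congr (f _); apply: (can_inj eK).
  by rewrite e'K raddfB !e'K.
by exists g => s; rewrite gE /= -eE eK fE.
Qed.

Lemma has_univ_group_ext (H : zmodType) (f1 f2 : {additive G -> H}) :
  has_univ_group Gam -> (forall s : supp Gam, f1 (val s) = f2 (val s)) -> f1 =1 f2.
Proof.
move=> [e [[e' eK e'K] eE]] E g; rewrite -[g]e'K.
by apply: (@univ_additive_ext H (f1 \o e) (f2 \o e)) => s /=; rewrite eE.
Qed.

(** The canonical map to [G] has inverse [f]: one composite fixes all classes, the other fixes the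
    support and is the identity by the second hypothesis. *)
Lemma has_univ_groupI :
    (exists f : {additive G -> univ_group Gam}, forall s, f (val s) = univ_class s) ->
    (forall f : {additive G -> G}, (forall s : supp Gam, f (val s) = val s) -> f =1 id) ->
  has_univ_group Gam.
Proof.
move=> [f fE] gen; have [e eE] := univ_eval; exists e; split=> //; exists f.
  pose i : {additive univ_group Gam -> univ_group Gam} := idfun.
  by apply: (@univ_additive_ext _ (f \o e) i) => s /=; rewrite eE fE.
by apply: (gen (e \o f)) => s /=; rewrite fE eE.
Qed.

(** Products have the right degree because each nonzero product of components yields a relator of
    [Gam]; directness reuses the projectors of [Gam], as [phi] is injective. *)
Lemma regrading (K : zmodType) (Del : K -> {vspace ambient A}) (phi : supp Gam -> K) :
    injective phi -> respects_relators phi -> (forall s, Del (phi s) = Gam (val s)) ->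
    (forall k, Del k != 0%VS -> exists s, phi s = k) ->
  is_grading Del.
Proof.
move=> phi_inj phiR DE Dsupp; have [sG _ _ mul parity] := gradG.
have Dcase k : Del k = 0%VS \/ exists s, phi s = k.
  by have [|/Dsupp] := eqVneq (Del k) 0%VS; [left | right].
have sD k : (Del k <= carrier A)%VS.
  by case: (Dcase k) => [->|[s <-]]; rewrite ?sub0v // DE.
have [s [pi [_ _ pi1 pi0 _]]] := decomposes_proj decG.
have [_ span dir] : decomposes (carrier A) Del.
  apply: decomposesI => // [x xA|k].
    move: x xA; apply: (decomposes_ind decG) => [g x xg|x y _ _]; last exact: spannedD.
    have [->|x0] := eqVneq x 0; first by exists [::]; rewrite mem0v.
    have [t tg] := supp_label xg x0.
    by apply: (@spanned_mem _ _ _ _ (phi t)); rewrite DE tg.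
  have [k0|[t tk]] := Dcase k.
    exists 0; split=> [x|l _ x _]; last by rewrite zero_lfunE.
    by rewrite k0 memv0 zero_lfunE => /eqP->.
  exists (pi (val t)); split=> [x|l lk x]; first by rewrite -tk DE => /pi1.
  have [->|[t' tl]] := Dcase l; first by rewrite memv0 => /eqP->; rewrite linear0.
  rewrite -tl DE => /pi0->//; apply: contraNneq lk => /val_inj E.
  by rewrite -tl -tk E.
split=> // [g k x y xg yk|k]; last first.
  by have [->|[t <-]] := Dcase k; rewrite ?cap0v ?addv0 // DE.
have [->|xy] := eqVneq (sprod x y) 0; first exact: mem0v.
have nz (z : ambient A) l : z \in Del l -> z != 0 -> exists2 t, phi t = l & z \in Gam (val t).
  move=> zl z0; have [l0|[t tl]] := Dcase l; first by rewrite l0 memv0 (negbTE z0) in zl.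
  by exists t => //; rewrite -DE tl.
have [|t1 E1 x1] := nz _ _ xg; first by apply: contraNneq xy => ->; rewrite sprod0l.
have [|t2 E2 y2] := nz _ _ yk; first by apply: contraNneq xy => ->; rewrite sprod0r.
have [t3 E3] := supp_label (mul _ _ _ _ x1 y2) xy.
have E : phi t1 + phi t2 = phi t3.
  by apply: phiR => [|u v u1 v2]; [exists x, y | rewrite E3; apply: mul].
by rewrite -E1 -E2 E DE E3; apply: mul.
Qed.

End OneGrading.

Lemma relabelE (V : vectType F) (X K : Type) (j : X -> K) (W : X -> {vspace V}) x :
  injective j -> relabel j W (j x) = W x.
Proof.
rewrite /relabel => j_inj; case: pselect => [e|[]]; last by exists x.
by congr W; apply: j_inj; apply: (projT2 (cid e)).
Qed.

Lemma relabel_supp (V : vectType F) (X K : Type) (j : X -> K) (W : X -> {vspace V}) k :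
  relabel j W k != 0%VS -> exists x, j x = k.
Proof. by rewrite /relabel; case: pselect => // _; rewrite eqxx. Qed.

Section UnivGrading.
Variables (G : zmodType) (Gam : G -> {vspace ambient A}).
Hypothesis gradG : is_grading Gam.

Lemma univ_gradingE s : univ_grading Gam (univ_class s) = Gam (val s).
Proof. exact: (relabelE (fun s : supp Gam => Gam (val s)) s (univ_class_inj gradG)). Qed.

Lemma univ_grading_supp u : univ_grading Gam u != 0%VS -> exists s, univ_class s = u.
Proof. exact: relabel_supp. Qed.

Lemma univ_grading_grading : is_grading (univ_grading Gam).
Proof.
apply: (regrading gradG (univ_class_inj gradG) (@univ_class_respects _ _) univ_gradingE).
exact: univ_grading_supp.
Qed.

(** [univ_class] matches the two supports with equal components, hence with the same relators. *)
Lemma univ_grading_has_univ_group : has_univ_group (univ_grading Gam).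
Proof.
have supp_class s : univ_grading Gam (univ_class s) != 0%VS by rewrite univ_gradingE (valP s).
pose up s : supp (univ_grading Gam) := exist _ (univ_class s) (supp_class s).
apply: (has_univ_groupI univ_grading_grading) => [|f fE].
  have [|f fE] := @univ_lift _ Gam _ (fun s => univ_class (up s)).
    move=> s1 s2 s3 [x [y [x1 y2 xy]]] sub; apply: univ_class_respects.
      by exists x, y; rewrite /= !univ_gradingE.
    by move=> u v; rewrite /= !univ_gradingE; apply: sub.
  exists f => s; have [t E] := univ_grading_supp (valP s).
  by rewrite -E fE; congr univ_class; apply: val_inj.
pose i : {additive univ_group Gam -> univ_group Gam} := idfun.
by apply: (@univ_additive_ext _ Gam _ f i) => s; apply: (fE (up s)).
Qed.

End UnivGrading.

Definition same_components (G K : zmodType) (Gam : G -> {vspace ambient A})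
    (Del : K -> {vspace ambient A}) : Prop :=
  forall g, Gam g != 0%VS -> exists k, Del k = Gam g.

Lemma univ_grading_same (G : zmodType) (Gam : G -> {vspace ambient A}) :
  is_grading Gam -> same_components (univ_grading Gam) Gam.
Proof.
by move=> gradG u /univ_grading_supp[s <-]; exists (val s); rewrite univ_gradingE.
Qed.

(** Fineness does not see labels: a proper refinement of [Del] is one of [Gam]. *)
Lemma is_fine_same (G K : zmodType) (Gam : G -> {vspace ambient A}) (Del : K -> {vspace ambient A}) :
  is_fine Gam -> is_grading Del -> same_components Del Gam -> is_fine Del.
Proof.
move=> [_ fineG] gradD same; split=> // -[L [Xi [gradX [ref [l [k [Xl0 Xlk Xneq]]]]]]].
have same' m d : Xi m != 0%VS -> (Xi m <= Del d)%VS -> exists g, Gam g = Del d.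
  move=> Xm XD; apply: same; apply: contraNneq Xm => D0.
  by rewrite -subv0 -D0.
apply: fineG; exists L, Xi; split=> //; split.
  move=> m Xm; have [d XD] := ref m Xm.
  by have [g E] := same' m d Xm XD; exists g; rewrite E.
by have [g E] := same' l k Xl0 Xlk; exists l, g; rewrite E.
Qed.

Lemma is_fine_refinement (G K : zmodType) (Gam : G -> {vspace ambient A})
    (Del : K -> {vspace ambient A}) :
  is_fine Gam -> is_grading Del -> refines Del Gam ->
  forall k g, Del k != 0%VS -> (Del k <= Gam g)%VS -> Del k = Gam g.
Proof.
move=> [_ fineG] gradD ref k g Dk sub; apply/eqP/negPn/negP=> neq.
by apply: fineG; exists K, Del; split=> //; split=> //; exists k, g.
Qed.

End Universal.

(** * Gradings of Q *)

Lemma lfun_of_linear (F : fieldType) (U V : vectType F) (f : U -> V) :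
  linear f -> exists g : 'Hom(U, V), g =1 f.
Proof.
move=> lf; pose fL : {linear U -> V} := HB.pack f (GRing.isLinear.Build _ _ _ _ f lf).
by exists (linfun fL) => x; rewrite lfunE.
Qed.

Section QueerGradings.
Variables (F : fieldType) (c : qcase) (n : nat).
Hypotheses (two_neq0 : 2%:R != 0 :> F) (n_ge2 : (2 <= n)%N).
Hypothesis lie_neq0 : c = Lie -> n.+1%:R != 0 :> F.

Local Notation M := 'M[F]_(qdim c n).
Local Notation S := (q0space F c n).
Local Notation p := (@q0prod F c n).
Local Notation q := (@qodd F c n).

Let pb := q0prod_bilin F c n.
Let qb := qodd_bilin F c n.

Lemma mem_carrier_Q x : (x \in carrier (Q F c n)) = (x.1 \in S) && (x.2 \in S).
Proof.
apply/memv_addP/andP => [[y + [z + ->]]|[x1 x2]].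
  by rewrite !mem_pairv !memv0 /= => /andP[y1 /eqP->] /andP[/eqP-> z2]; rewrite addr0 add0r.
exists (x.1, 0); first by rewrite mem_pairv /= x1 mem0v.
exists (0, x.2); first by rewrite mem_pairv /= x2 mem0v.
by case: x x1 x2 => a b _ _; congr (_, _); rewrite /= ?addr0 ?add0r.
Qed.

Lemma is_grading_decomposes (A : superalgebra F) (G : zmodType) (Gam : G -> {vspace ambient A}) :
  is_grading Gam -> decomposes (carrier A) Gam.
Proof. by case. Qed.

Section FromEven.
Variables (K : zmodType) (Gam : K -> {vspace M}) (d : K).

Definition qgraded (k : K) : {vspace (M * M)%type} := pairv (Gam k) (Gam (k - d)).

Hypotheses (gradG : prod_graded Gam) (degG : odd_degree Gam (d *+ 2)).

Lemma qgraded_grading : is_grading (A := Q F c n) qgraded.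
Proof.
have [decG prod] := gradG; have [sS _ _] := decG.
have [s [pi [_ _ pi1 pi0 _]]] := decomposes_proj decG.
have sub k : (qgraded k <= carrier (Q F c n))%VS.
  by apply/subvP=> x; rewrite mem_pairv mem_carrier_Q => /andP[/(subvP (sS _))-> /(subvP (sS _))->].
have [_ span dir] : decomposes (carrier (Q F c n)) qgraded.
  apply: decomposesI => // [x|k].
    rewrite mem_carrier_Q => /andP[x1 x2].
    have -> : x = (x.1, 0) + (0, x.2).
      by case: x x1 x2 => a b _ _; congr (_, _); rewrite /= ?addr0 ?add0r.
    apply: spannedD.
      move: x.1 x1; apply: (decomposes_ind decG) => [g y yg|y z _ _ Sy Sz].
        by apply: (@spanned_mem _ _ _ _ g); rewrite mem_pairv /= yg mem0v.
      by rewrite -[0]addr0; apply: (spannedD Sy Sz).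
    move: x.2 x2; apply: (decomposes_ind decG) => [g y yg|y z _ _ Sy Sz].
      by apply: (@spanned_mem _ _ _ _ (g + d)); rewrite mem_pairv /= addrK yg mem0v.
    by rewrite -[X in (X, _)]addr0; apply: (spannedD Sy Sz).
  have [|P PE] := @lfun_of_linear F (M * M)%type (M * M)%type (fun x => (pi k x.1, pi (k - d) x.2)).
    by move=> a x y; congr (_, _) => /=; rewrite linearP.
  exists P; split=> [x|l lk x]; rewrite mem_pairv PE => /andP[x1 x2].
    by case: x x1 x2 => a b /= x1 x2; rewrite !pi1.
  by rewrite (pi0 _ _ lk) // (pi0 _ (l - d)) // (inj_eq (addIr _)).
split=> // [g k x y|g].
  rewrite !mem_pairv /= => /andP[x1 x2] /andP[y1 y2]; apply/andP; split.
    apply: memvD; first exact: prod.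
    by have := (degG x2 y2); rewrite [g - d + _]addrACA -opprD -mulr2n subrK.
  apply: memvD; first by rewrite -addrA; apply: prod.
  by rewrite addrAC; apply: prod.
apply/vspaceP=> x; apply/idP/idP=> [|/memv_addP[y yg [z zg ->]]]; last first.
  by move: yg zg => /memv_capP[yg _] /memv_capP[zg _]; apply: memvD.
rewrite mem_pairv => /andP[x1 x2]; apply/memv_addP.
have [x1S x2S] := (subvP (sS _) _ x1, subvP (sS _) _ x2).
exists (x.1, 0); first by rewrite memv_cap !mem_pairv /= x1 x1S !mem0v.
exists (0, x.2); first by rewrite memv_cap !mem_pairv /= x2 x2S !mem0v.
by case: x {x1 x2 x1S x2S} => a b; congr (_, _); rewrite /= ?addr0 ?add0r.
Qed.

End FromEven.

Section ToEven.
Variables (K : zmodType) (Xi : K -> {vspace (M * M)%type}).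
Hypothesis gradX : is_grading (A := Q F c n) Xi.

Lemma grading_Q_even_odd : exists Gam Lam : K -> {vspace M},
  [/\ decomposes S Gam, decomposes S Lam & forall k, Xi k = pairv (Gam k) (Lam k)].
Proof.
have [sub _ _ _ parity] := gradX; have decX := is_grading_decomposes gradX.
pose Gam k := (linfun fst @: (Xi k :&: pairv S 0))%VS : {vspace M}.
pose Lam k := (linfun snd @: (Xi k :&: pairv 0 S))%VS : {vspace M}.
have memS x k : x \in Xi k -> (x.1 \in S) && (x.2 \in S).
  by rewrite -mem_carrier_Q; apply/subvP.
have mG a k : (a \in Gam k) = ((a, 0) \in Xi k).
  apply/memv_imgP/idP => [[x /memv_capP[xX +] ->]|aX].
    rewrite mem_pairv memv0 lfunE /= => /andP[_ /eqP x2].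
    by case: x xX x2 => u v xX /= v0; rewrite -v0.
  exists (a, 0); last by rewrite lfunE.
  apply/memv_capP; split=> //; rewrite mem_pairv mem0v andbT.
  by have /andP[] := memS _ _ aX.
have mL b k : (b \in Lam k) = ((0, b) \in Xi k).
  apply/memv_imgP/idP => [[x /memv_capP[xX +] ->]|bX].
    rewrite mem_pairv memv0 lfunE /= => /andP[/eqP x1 _].
    by case: x xX x1 => u v xX /= u0; rewrite -u0.
  exists (0, b); last by rewrite lfunE.
  apply/memv_capP; split=> //; rewrite mem_pairv mem0v /=.
  by have /andP[] := memS _ _ bX.
have XE k : Xi k = pairv (Gam k) (Lam k).
  apply/vspaceP=> x; rewrite mem_pairv mG mL; apply/idP/andP=> [|[x1 x2]].
    rewrite {1}parity => /memv_addP[y /memv_capP[yX +] [z /memv_capP[zX +] ->]].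
    rewrite !mem_pairv !memv0 => /andP[_ /eqP y2] /andP[/eqP z1 _].
    case: y yX y2 => y1 y2 yX /= y20; case: z zX z1 => z1 z2 zX /= z10.
    by rewrite y20 in yX *; rewrite z10 in zX *; rewrite addr0 add0r. 
  have -> : x = (x.1, 0) + (0, x.2).
    by case: x {x1 x2} => a b; congr (_, _); rewrite /= ?addr0 ?add0r.
  exact: memvD.
have [s [Pi [_ _ Pi1 Pi0 _]]] := decomposes_proj decX.
exists Gam, Lam; split=> //.
  apply: decomposesI => [k|x xS|k].
  - by apply/subvP=> a; rewrite mG => /memS/andP[].
  - have : (x, 0) \in carrier (Q F c n) by rewrite mem_carrier_Q xS mem0v.
    rewrite -[X in spanned _ X]/((x, 0 : M).1).
    apply: (decomposes_ind decX (P := fun x => spanned Gam x.1)) => [k y yk|y z _ _].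
      by apply: (@spanned_mem _ _ _ _ k); move: yk; rewrite XE mem_pairv => /andP[].
    exact: spannedD.
  have [|P PE] := @lfun_of_linear F M M (fun a => (Pi k (a, 0)).1).
    move=> a x y; have -> : (a *: x + y, 0) = a *: (x, 0) + (y, 0) :> (M * M)%type.
      by congr (_, _); rewrite /= scaler0 addr0.
    by rewrite linearP.
  exists P; split=> [x|l lk x]; rewrite mG PE => xX; first by rewrite Pi1.
  by rewrite (Pi0 _ _ lk).
apply: decomposesI => [k|x xS|k].
- by apply/subvP=> a; rewrite mL => /memS/andP[].
- have : (0, x) \in carrier (Q F c n) by rewrite mem_carrier_Q xS mem0v.
  rewrite -[X in spanned _ X]/((0 : M, x).2).
  apply: (decomposes_ind decX (P := fun x => spanned Lam x.2)) => [k y yk|y z _ _].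
    by apply: (@spanned_mem _ _ _ _ k); move: yk; rewrite XE mem_pairv => /andP[].
  exact: spannedD.
have [|P PE] := @lfun_of_linear F M M (fun a => (Pi k (0, a)).2).
  move=> a x y; have -> : (0, a *: x + y) = a *: (0, x) + (0, y) :> (M * M)%type.
    by congr (_, _); rewrite /= scaler0 addr0.
  by rewrite linearP.
exists P; split=> [x|l lk x]; rewrite mL PE => xX; first by rewrite Pi1.
by rewrite (Pi0 _ _ lk).
Qed.

(* Schur: the graded [S]-module map [x |-> \underline{x}] is homogeneous. *)
Lemma grading_Q_qgraded : exists (Gam : K -> {vspace M}) (d : K),
  [/\ prod_graded Gam, odd_degree Gam (d *+ 2) & Xi =1 qgraded Gam d].
Proof.
have [Gam [Lam [decG decL XE]]] := grading_Q_even_odd.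
have [_ _ _ mul _] := gradX.
have memG a k : a \in Gam k -> (a, 0) \in Xi k by rewrite XE mem_pairv mem0v andbT.
have memL b k : b \in Lam k -> (0, b) \in Xi k by rewrite XE mem_pairv mem0v.
have GG g k x y : x \in Gam g -> y \in Gam k -> p x y \in Gam (g + k).
  move=> /memG xg /memG yk; have := mul _ _ _ _ xg yk.
  by rewrite XE mem_pairv /= (bilin0l qb) addr0 => /andP[].
have GL g k x y : x \in Gam g -> y \in Lam k -> p x y \in Lam (g + k).
  move=> /memG xg /memL yk; have := mul _ _ _ _ xg yk.
  by rewrite XE mem_pairv /= (bilin0l pb) addr0 => /andP[].
have LL g k x y : x \in Lam g -> y \in Lam k -> q x y \in Gam (g + k).
  move=> /memL xg /memL yk; have := mul _ _ _ _ xg yk.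
  by rewrite XE mem_pairv /= (bilin0l pb) add0r => /andP[].
have gradG : prod_graded Gam by [].
have [sS _ _] := decG; have [sSL _ _] := decL.
have [s [pi [us pi_in pi1 pi0 pi_sum]]] := decomposes_proj decG.
have [t [rho [_ rho_in rho1 rho0 rho_sum]]] := decomposes_proj decL.
have [g0 [x0 [x0g x0_neq0]]] : exists g x, x \in Gam g /\ x != 0.
  apply: contrapT => none.
  have [x [y [xS _ /eqP]]] := @q0prod_neq0 F c n two_neq0 n_ge2 lie_neq0; apply.
  suff -> : x = 0 by rewrite (bilin0l pb).
  move: x xS; apply: (decomposes_ind decG) => [g x xg|x x' _ _ -> ->]; last by rewrite addr0.
  by apply/eqP/negPn/negP=> x0; apply: none; exists g, x.
have [l l_neq0] : exists l, rho l x0 != 0.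
  apply: contrapT => none; move: x0_neq0.
  rewrite (rho_sum x0) ?(subvP (sS g0)) // big1 ?eqxx // => l _.
  by apply/eqP/negPn/negP=> E; apply: none; exists l.
(* The identity of [S], seen as a map from [Gam] to [Lam], has a nonzero homogeneous part [th] of
   degree [d]. It commutes with even products, so it is a scalar. *)
pose d := l - g0.
have [|th thE] := @lfun_of_linear F M M (fun x => \sum_(g <- s) rho (g + d) (pi g x)).
  by move=> a x y; rewrite scaler_sumr -big_split; apply: eq_bigr => g _; rewrite !linearP.
have th_hom g x : x \in Gam g -> th x = rho (g + d) x.
  move=> xg; rewrite thE (sum_proj gradG us pi1 pi0 pi_sum (L := fun g => rho (g + d)) _ xg) //.
  by move=> k; rewrite linear0.
have rho_prod g k z x : z \in Gam g -> x \in S -> rho (g + k) (p z x) = p z (rho k x).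
  move=> zg; move: x; apply: (decomposes_ind decL) => [m x xm|x y _ _ Ex Ey]; last first.
    by rewrite !(bilinDr pb) !linearD /= Ex Ey (bilinDr pb).
  have [mk|mk] := eqVneq m k; first by rewrite -mk !rho1 // GL.
  rewrite (rho0 k m) // (bilin0r pb) (rho0 _ (g + m)) ?GL //.
  by rewrite (inj_eq (addrI g)).
have [|x z xS zS|a Ea] := q0_centroid two_neq0 n_ge2 lie_neq0 (t := th).
- by move=> x _; rewrite thE; apply: rpred_sum => g _; apply: subvP (rho_in _ _).
- move: z zS x xS; apply: (decomposes_ind decG) => [k z zk|z z' _ _ Ez Ez'] x xS; last first.
    by rewrite !(bilinDl pb) linearD /= Ez ?Ez'.
  move: x xS; apply: (decomposes_ind decG) => [g x xg|x y _ _ Ex Ey]; last first.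
    by rewrite !(bilinDr pb) !linearD /= Ex Ey (bilinDr pb).
  rewrite (th_hom _ _ xg) (th_hom _ _ (GG _ _ _ _ zk xg)) -addrA rho_prod //.
  exact: subvP xg.
have a_neq0 : a != 0.
  apply: contraNneq l_neq0 => a0; have := th_hom _ _ x0g.
  by rewrite Ea ?(subvP (sS g0)) // a0 scale0r addrC subrK => <-.
have GLd g x : x \in Gam g -> x \in Lam (g + d).
  move=> xg; rewrite -[x](scalerK a_neq0) memvZ // -Ea ?(subvP (sS g)) //.
  by rewrite (th_hom _ _ xg).
(* Decompose [x] along [Gam]: its part of degree k lies in [Lam (k + d)], so projecting to degree g
   + d leaves only the part of degree g. *)
have LGd g x : x \in Lam (g + d) -> x \in Gam g.
  move=> xg; rewrite -(rho1 _ _ xg); move: x {xg} (subvP (sSL _) _ xg).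
  apply: (decomposes_ind decG) => [k x xk|x y _ _ xg yg]; last by rewrite linearD memvD.
  have [<-|kg] := eqVneq k g; first by rewrite rho1 // GLd.
  by rewrite (rho0 _ (k + d)) ?mem0v ?GLd // (inj_eq (addIr d)).
exists Gam, d; split=> // [g k x y xg yk|k].
  by have := LL _ _ _ _ (GLd _ _ xg) (GLd _ _ yk); rewrite addrACA -mulr2n.
rewrite XE /qgraded; congr (pairv _ _); apply/vspaceP=> x; apply/idP/idP.
  by move=> xk; apply: LGd; rewrite subrK.
by move/GLd; rewrite subrK.
Qed.

End ToEven.
End QueerGradings.

(** * Subspaces of a product *)

Section Pairs.
Variables (F : fieldType) (U V : vectType F).
Implicit Types (X : {vspace U}) (Y : {vspace V}).

Lemma pairv_sub X Y X' Y' : (pairv X Y <= pairv X' Y')%VS = (X <= X')%VS && (Y <= Y')%VS.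
Proof.
apply/subvP/andP => [sub|[/subvP XX /subvP YY] x]; last first.
  by rewrite !mem_pairv => /andP[/XX-> /YY->].
split; apply/subvP=> x xX.
  by have := sub (x, 0); rewrite !mem_pairv /= xX !mem0v !andbT; apply.
by have := sub (0, x); rewrite !mem_pairv /= xX !mem0v /=; apply.
Qed.

Lemma pairv_inj X Y X' Y' : pairv X Y = pairv X' Y' -> X = X' /\ Y = Y'.
Proof.
move=> E; have := pairv_sub X Y X' Y'; have := pairv_sub X' Y' X Y.
rewrite E !subvv => /esym/andP[X1 Y1] /esym/andP[X2 Y2].
by split; apply/eqP; rewrite eqEsubv ?X1 ?Y1 ?X2 ?Y2.
Qed.

Lemma pairv00 : pairv 0 0 = 0%VS :> {vspace (U * V)%type}.
Proof.
by apply/vspaceP=> -[x y]; rewrite mem_pairv !memv0.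
Qed.

Lemma pairv_eq0 X Y : (pairv X Y == 0%VS) = (X == 0%VS) && (Y == 0%VS).
Proof.
rewrite -pairv00; apply/eqP/andP => [/pairv_inj[-> ->]|[/eqP-> /eqP->]] //.
Qed.

End Pairs.

(** * The group G[h^{1/2}] and its universal property *)

Section SqrtExt.
Variables (G : zmodType) (h : G).
Local Notation i := (sqrt_in h).
Local Notation d := (sqrt_elt h).

Lemma sqrt_in_additive : exists f : {additive G -> sqrt_ext h}, f =1 i.
Proof.
apply: additive_of_morph => x y.
rewrite /sqrt_in /quot_pi -raddfB; congr (\pi_(_) _).
Qed.

Lemma sqrt_inD : {morph i : x y / x + y}.
Proof. by have [f fE] := sqrt_in_additive; move=> x y; rewrite -!fE raddfD. Qed.

Lemma sqrt_extP (u : sqrt_ext h) : exists g m, u = i g + d *~ m.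
Proof.
have <- : quot_pi (@sqrt_relator _ h) (repr u) = u by exact: reprK.
case: (repr u) => g m; exists g, m; rewrite /sqrt_in /sqrt_elt /quot_pi -raddfMz -raddfD.
congr (\pi_(_) _); congr (_, _) => /=.
  by rewrite (raddfMz (@fst G int)) mul0rz addr0.
by rewrite (raddfMz (@snd G int)) add0r intz.
Qed.

(** The relator has an even integer coordinate, so the parity of that coordinate is well defined on
    the quotient. *)
Lemma sqrt_in_neq g g' : i g <> i g' + d.
Proof.
rewrite /sqrt_in /sqrt_elt /quot_pi -raddfD => /quot_pi_eq/gen_subgroup1[m /(congr1 snd)].
rewrite (raddfMz (@snd G int)) /= !add0r => E.
suff : odd `|(-1 : int)| = odd `|(2 *~ m : int)| by rewrite -mulrzr abszM oddM.
by rewrite -E.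
Qed.

Lemma sqrt_lift (H : zmodType) (a : {additive G -> H}) (b : H) : b *+ 2 = a h ->
  exists f : {additive sqrt_ext h -> H}, (forall g, f (i g) = a g) /\ f d = b.
Proof.
move=> b2; have [|e eE] := @additive_of_morph (G * int)%type H (fun x => a x.1 + b *~ x.2).
  by move=> x y /=; rewrite raddfB mulrzBr opprD addrACA.
have [r ->|f fE] := @quot_by_lift _ H (@sqrt_relator G h) e.
  by rewrite eE /= raddfN -b2 addNr.
exists f; split=> [g|]; rewrite fE eE /=; first by rewrite mulr0z addr0.
by rewrite raddf0 add0r mulr1z.
Qed.

Lemma sqrt_ext_additive_ext (H : zmodType) (f1 f2 : {additive sqrt_ext h -> H}) :
  (forall g, f1 (i g) = f2 (i g)) -> f1 d = f2 d -> f1 =1 f2.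
Proof.
by move=> E Ed u; have [g [m ->]] := sqrt_extP u; rewrite !raddfD !raddfMz E Ed.
Qed.

End SqrtExt.

(** * The grading [tilde Gam]: fineness and universal group *)

Section Tilde.
Variables (F : fieldType) (c : qcase) (n : nat).
Hypotheses (two_neq0 : 2%:R != 0 :> F) (n_ge2 : (2 <= n)%N).
Hypothesis lie_neq0 : c = Lie -> n.+1%:R != 0 :> F.

Local Notation M := 'M[F]_(qdim c n).
Local Notation S := (q0space F c n).
Local Notation p := (@q0prod F c n).
Local Notation q := (@qodd F c n).
Local Notation A0 := (Q0 F c n).
Local Notation AQ := (Q F c n).

Let pb := q0prod_bilin F c n.
Let qb := qodd_bilin F c n.
Let ax0 := Q0_axioms F c n.
Let axQ := Q_axioms (n := n) lie_neq0.

Section OneGrading.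
Variables (G : zmodType) (Gam : G -> {vspace M}).
Hypothesis gradG : prod_graded Gam.
Let h := distinguished Gam.
Local Notation i := (sqrt_in h).
Local Notation d := (sqrt_elt h).
Let degG : odd_degree Gam h := distinguished_odd_degree two_neq0 n_ge2 lie_neq0 gradG.
Let grad0 : is_grading (A := A0) Gam := (is_grading_Q0 Gam).2 gradG.

Lemma relabel_graded : prod_graded (relabel i Gam).
Proof.
have [e eE] := sqrt_in_additive h; have i_inj := @sqrt_in_inj G h.
apply/is_grading_Q0; apply: (@regrading _ A0 ax0 _ Gam grad0 _ _ (fun s => e (val s))).
- by move=> s s'; rewrite !eE => /i_inj/val_inj.
- exact: (respects_val grad0).
- by move=> s; rewrite eE relabelE.
move=> k k0; have [g E] := relabel_supp k0; move: k0; rewrite -E relabelE // => g0.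
by exists (exist _ g g0); rewrite eE.
Qed.

Lemma relabel_mem k x : x \in relabel i Gam k -> x != 0 -> exists2 g, k = i g & x \in Gam g.
Proof.
move=> xk x0; have k0 : relabel i Gam k != 0%VS by apply/vspace0Pn; exists x.
have [g E] := relabel_supp k0; exists g => //.
by move: xk; rewrite -E relabelE //; apply: sqrt_in_inj.
Qed.

Lemma relabel_odd_degree : odd_degree (relabel i Gam) (d *+ 2).
Proof.
move=> g k x y xg yk.
have [->|x0] := eqVneq x 0; first by rewrite (bilin0l qb) mem0v.
have [->|y0] := eqVneq y 0; first by rewrite (bilin0r qb) mem0v.
have [g' -> xg'] := relabel_mem xg x0; have [k' -> yk'] := relabel_mem yk y0.
rewrite sqrt_eltE -!sqrt_inD relabelE; last exact: sqrt_in_inj.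
exact: degG.
Qed.

Lemma tilde_grading : is_grading (A := AQ) (tilde Gam).
Proof. exact: qgraded_grading relabel_graded relabel_odd_degree. Qed.

(** By [sqrt_in_neq] no label carries both an even and an odd component. *)
Lemma tilde_even g : tilde Gam (i g) = pairv (Gam g) 0.
Proof.
rewrite /tilde relabelE; last exact: sqrt_in_inj.
congr (pairv _ _); apply/eqP/negPn/negP=> u0; have [g' E] := relabel_supp u0.
by apply: (@sqrt_in_neq G h g g'); rewrite E subrK.
Qed.

Lemma tilde_odd g : tilde Gam (i g + d) = pairv 0 (Gam g).
Proof.
rewrite /tilde addrK relabelE; last exact: sqrt_in_inj.
congr (pairv _ _); apply/eqP/negPn/negP=> u0; have [g' E] := relabel_supp u0.
exact: (@sqrt_in_neq G h g' g).
Qed.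

Lemma tilde_supp u : tilde Gam u != 0%VS ->
  exists2 g, Gam g != 0%VS & u = i g \/ u = i g + d.
Proof.
rewrite /tilde pairv_eq0 negb_and => /orP[u0|u0].
  have [g E] := relabel_supp u0; exists g; last by left.
  by move: u0; rewrite -E relabelE //; apply: sqrt_in_inj.
have [g E] := relabel_supp u0; exists g; last by right; rewrite E subrK.
by move: u0; rewrite -E relabelE //; apply: sqrt_in_inj.
Qed.

(** The shift [e] is arbitrary because every component of [tilde Gam] is purely even or purely
    odd. *)
Lemma tilde_refines (K : zmodType) (Del : K -> {vspace M}) (e : K) :
  refines Gam Del -> refines (tilde Gam) (qgraded Del e).
Proof.
move=> ref u /tilde_supp[g /ref[k gk] [->|->]].
  by exists k; rewrite tilde_even pairv_sub gk sub0v.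
by exists (k + e); rewrite tilde_odd pairv_sub addrK gk sub0v.
Qed.

(** A refinement of [tilde Gam] is some [qgraded Del e], and [Del] refines [Gam] because a component
    of [tilde Gam] containing a nonzero even vector is even. *)
Lemma tilde_fine : is_fine (A := A0) Gam -> is_fine (A := AQ) (tilde Gam).
Proof.
move=> fineG; split; first exact: tilde_grading.
move=> [K [Xi [gradX [refX [k [u [Xk0 sub neq]]]]]]].
have [Del [e [gradD _ XE]]] := grading_Q_qgraded two_neq0 n_ge2 lie_neq0 gradX.
have D0 l : Del l != 0%VS -> Xi l != 0%VS.
  by rewrite XE /qgraded pairv_eq0 negb_and => ->.
have refD : refines Del Gam.
  move=> l Dl; have [v Xv] := refX l (D0 l Dl); move: (Xv); rewrite XE.
  have [g _ [->|->]] : exists2 g, Gam g != 0%VS & v = i g \/ v = i g + d.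
    by apply: tilde_supp; apply: contraNneq (D0 l Dl) => v0; rewrite -subv0 -v0.
  - by rewrite tilde_even pairv_sub => /andP[lg _]; exists g.
  - by rewrite tilde_odd pairv_sub subv0 (negbTE Dl).
have eqD := is_fine_refinement fineG ((is_grading_Q0 Del).2 gradD) refD.
have [g _ E] : exists2 g, Gam g != 0%VS & u = i g \/ u = i g + d.
  by apply: tilde_supp; apply: contraNneq Xk0 => u0; rewrite -subv0 -u0.
move: Xk0 sub neq; rewrite XE /qgraded; case: E => ->.
  rewrite tilde_even pairv_sub pairv_eq0 subv0 negb_and => Dk /andP[Dg /eqP Dke].
  by move: Dk; rewrite Dke eqxx orbF => Dk; rewrite (eqD _ _ Dk Dg) eqxx.
rewrite tilde_odd pairv_sub pairv_eq0 subv0 negb_and => Dk /andP[/eqP Dk0 Dg].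
by move: Dk; rewrite Dk0 eqxx /= => Dk; rewrite (eqD _ _ Dk Dg) eqxx.
Qed.

(* Regarding tilde Gam as a grading by its universal group U, its even part is
   a U-grading of the same components as Gam, so that U contains the degree e
   of x |-> \underline{x}, a square root of the image of h. *)
Lemma tilde_has_univ_group : has_univ_group (A := A0) Gam -> has_univ_group (A := AQ) (tilde Gam).
Proof.
move=> univG; have gradT := tilde_grading.
have ev_supp (s : supp Gam) : tilde Gam (i (val s)) != 0%VS.
  by rewrite tilde_even pairv_eq0 negb_and (valP s).
have od_supp (s : supp Gam) : tilde Gam (i (val s) + d) != 0%VS.
  by rewrite tilde_odd pairv_eq0 negb_and (valP s) orbT.
pose ev s : supp (tilde Gam) := exist (fun u => tilde Gam u != 0%VS) _ (ev_supp s).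
pose od s : supp (tilde Gam) := exist (fun u => tilde Gam u != 0%VS) _ (od_supp s).
have [g0 [k0 [x0 [y0 [xg yk qxy]]]]] := qodd_hom_neq0 two_neq0 n_ge2 gradG.
have toS g x : x \in Gam g -> x != 0 -> exists s : supp Gam, val s = g.
  exact: (supp_label (A := A0)).
have x0_neq0 : x0 != 0 by apply: contraNneq qxy => ->; rewrite (bilin0l qb).
have y0_neq0 : y0 != 0 by apply: contraNneq qxy => ->; rewrite (bilin0r qb).
apply: (has_univ_groupI gradT) => [|f fE]; last first.
  have [e eE] := sqrt_in_additive h.
  pose idA : {additive sqrt_ext h -> sqrt_ext h} := idfun.
  have fi : f \o e =1 e.
    by apply: (has_univ_group_ext (A := A0) univG) => s; rewrite /= eE; apply: (fE (ev s)).
  apply: (@sqrt_ext_additive_ext _ _ _ f idA) => [g|]; first by have := fi g; rewrite /= eE.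
  (* [f] fixes [i (val s)] and [i (val s) + d], hence [d]. *)
  have [s _] := toS _ _ xg x0_neq0; have := fE (od s); rewrite /= raddfD.
  by have := fi (val s); rewrite /= eE => -> /addrI.
have [Del [e [gradD degD XE]]] :=
  grading_Q_qgraded two_neq0 n_ge2 lie_neq0 (univ_grading_grading axQ gradT).
have [decD _] := gradD.
have [eta etaE] : exists f : {additive G -> univ_group (A := AQ) (tilde Gam)},
    forall s : supp Gam, f (val s) = univ_class (A := AQ) (ev s).
  apply: (has_univ_group_lift (A := A0) (phi := fun s => univ_class (A := AQ) (ev s)) univG).
  move=> s1 s2 s3 [x [y [x1 y2 xy]]] sub; apply: univ_class_respects => [|u v].
    exists (x, 0), (y, 0); rewrite /= !tilde_even !mem_pairv /= x1 y2 !mem0v; split=> //.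
    by apply: contraNneq xy => /(congr1 fst); rewrite /= (bilin0l qb) addr0 => ->.
  rewrite /= !tilde_even !mem_pairv !memv0 => /andP[u1 /eqP u2] /andP[v1 /eqP v2].
  rewrite /= u2 v2 (bilin0l qb) (bilin0l pb) (bilin0r pb) !addr0 eqxx andbT.
  exact: sub.
have DelE (s : supp Gam) : Del (eta (val s)) = Gam (val s).
  have := univ_gradingE gradT (ev s); rewrite XE /= tilde_even -etaE.
  by move/pairv_inj=> [].
have eta_mem g x : x \in Gam g -> x \in Del (eta g).
  move=> xg'; have [->|x0'] := eqVneq x 0; first by rewrite mem0v.
  by have [s E] := toS _ _ xg' x0'; rewrite -E DelE E.
have etaO (s : supp Gam) : univ_class (A := AQ) (od s) = eta (val s) + e.
  have := univ_gradingE gradT (od s); rewrite XE /= tilde_odd.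
  move/pairv_inj=> [_ E]; have /vspace0Pn[x xs x0'] := valP s.
  apply/eqP; rewrite -subr_eq; apply/eqP.
  by apply: (decomposes_eq_label decD _ _ x0'); rewrite ?E ?DelE.
(* Compare two computations of the degree of the nonzero product [q x0 y0]. *)
have e2 : e *+ 2 = eta h.
  have := degD _ _ _ _ (eta_mem _ _ xg) (eta_mem _ _ yk).
  have := eta_mem _ _ (degG xg yk); rewrite !raddfD => m1 m2.
  by apply: (@addrI _ (eta g0 + eta k0)); apply: (decomposes_eq_label decD m2 m1 qxy).
have [f [fi fd]] := sqrt_lift e2; exists f => s.
have [g g_supp E] := tilde_supp (valP s); pose t : supp Gam := exist _ g g_supp.
case: E => E; rewrite E ?raddfD fi ?fd.
  by rewrite (etaE t); congr univ_class; apply: val_inj.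
by rewrite -(etaO t); congr univ_class; apply: val_inj.
Qed.

End OneGrading.
End Tilde.

(** * Gradings with the same components, and equivalence *)

Section Comparison.
Variables (F : fieldType) (A : superalgebra F).
Hypothesis axA : superalgebra_axioms A.

Lemma component_inj (G : zmodType) (Gam : G -> {vspace ambient A}) g k :
  is_grading Gam -> Gam g != 0%VS -> Gam g = Gam k -> g = k.
Proof.
move=> /is_grading_decomposes decG /vspace0Pn[x xg x0] E.
by apply: (decomposes_eq_label decG xg _ x0); rewrite -E.
Qed.

Section SameComponents.
Variables (G K : zmodType) (Gam : G -> {vspace ambient A}) (Del : K -> {vspace ambient A}).
Hypotheses (gradG : is_grading Gam) (gradD : is_grading Del).
Hypothesis same : same_components Gam Del.

(** The components of [Gam] span and occur among those of [Del]; if [Del k] were not one of them,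
    its projector would kill the whole space. *)
Lemma same_components_sym : same_components Del Gam.
Proof.
move=> k Dk; apply: contrapT => none.
have [decG decD] := (is_grading_decomposes gradG, is_grading_decomposes gradD).
have [s [pi [_ _ pi1 pi0 _]]] := decomposes_proj decD.
have [sD _ _] := decD; have /vspace0Pn[x xk /eqP] := Dk; apply.
rewrite -(pi1 _ _ xk); move: x {xk} (subvP (sD k) _ xk).
apply: (decomposes_ind decG) => [g x xg|x y _ _ Ex Ey]; last by rewrite linearD /= Ex Ey addr0.
have [->|x0] := eqVneq x 0; first by rewrite linear0.
have g0 : Gam g != 0%VS by apply/vspace0Pn; exists x.
have [l E] := same g0; apply: (pi0 _ l); last by rewrite E.
by apply: contra_notN none => /eqP lk; exists g; rewrite -E lk.
Qed.

(** Relators mention labels only through components, so the bijections [a] and [b] of the supports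
    induce mutually inverse homomorphisms. *)
Lemma same_components_univ_group : has_univ_group Gam ->
  exists f : {additive G -> univ_group Del},
    bijective f /\ forall g, univ_grading Del (f g) = Gam g.
Proof.
move=> univG.
have [a aE] : exists a : supp Gam -> supp Del, forall s, Del (val (a s)) = Gam (val s).
  suff /choice[a aE] : forall s : supp Gam, exists t : supp Del, Del (val t) = Gam (val s).
    by exists a.
  move=> s; have [k E] := same (valP s).
  have k0 : Del k != 0%VS by rewrite E (valP s).
  by exists (exist (fun k => Del k != 0%VS) k k0).
have [b bE] : exists b : supp Del -> supp Gam, forall t, Gam (val (b t)) = Del (val t).
  suff /choice[b bE] : forall t : supp Del, exists s : supp Gam, Gam (val s) = Del (val t).
    by exists b.
  move=> t; have [g E] := same_components_sym (valP t).
  have g0 : Gam g != 0%VS by rewrite E (valP t).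
  by exists (exist (fun g => Gam g != 0%VS) g g0).
have ab t : a (b t) = t.
  apply/val_inj/esym; apply: (component_inj gradD (valP t)).
  by rewrite aE bE.
have ba s : b (a s) = s.
  apply/val_inj/esym; apply: (component_inj gradG (valP s)).
  by rewrite bE aE.
have [f fE] : exists f : {additive G -> univ_group Del}, forall s, f (val s) = univ_class (a s).
  apply: (has_univ_group_lift (phi := fun s => univ_class (a s)) univG) => s1 s2 s3 nz sub.
  by apply: univ_class_respects; rewrite !aE.
have [e eE] : exists e : {additive univ_group Del -> G}, forall t, e (univ_class t) = val (b t).
  apply: univ_lift => s1 s2 s3 nz sub.
  by apply: (val_respects gradG); rewrite !bE.
have eK : cancel f e.
  pose idG : {additive G -> G} := idfun.
  by apply: (has_univ_group_ext (f1 := e \o f) (f2 := idG) univG) => s /=; rewrite fE eE ba.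
have fK : cancel e f.
  pose idU : {additive univ_group Del -> univ_group Del} := idfun.
  by apply: (univ_additive_ext (f1 := f \o e) (f2 := idU)) => t /=; rewrite eE fE ab.
exists f; split; first by exists e.
move=> g; have [g0|g0] := eqVneq (Gam g) 0%VS; last first.
  by rewrite -[g]/(val (exist (fun g => Gam g != 0%VS) g g0)) fE univ_gradingE // aE.
apply/eqP; rewrite g0; apply/negPn/negP=> /univ_grading_supp[t E].
have : e (univ_class t) = g by rewrite E eK.
by rewrite eE => tg; have := valP (b t); rewrite /= tg g0 eqxx.
Qed.

End SameComponents.

(** An isomorphism keeps distinct components distinct, so matching components in both directions
    already yields a bijection of supports. *)
Lemma equivalentI (B : superalgebra F) (G H : zmodType) (Gam : G -> {vspace ambient A})
    (Del : H -> {vspace ambient B}) (phi : 'Hom(ambient A, ambient B)) :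
    is_grading Gam -> is_grading Del -> is_isomorphism phi ->
    (forall s : supp Gam, exists t : supp Del, (phi @: Gam (val s))%VS = Del (val t)) ->
    (forall t : supp Del, exists s : supp Gam, (phi @: Gam (val s))%VS = Del (val t)) ->
  equivalent Gam Del.
Proof.
move=> gradG gradD iso /choice[a aE] /choice[b bE].
have decD := is_grading_decomposes gradD.
have [_ ker _ _] := iso.
have inj s s' : (phi @: Gam (val s) = phi @: Gam (val s'))%VS -> s = s' :> supp Gam.
  move=> E; apply/val_inj; have /vspace0Pn[x xs x0] := valP s.
  have := memv_img phi xs; rewrite E => /memv_imgP[y ys Exy].
  have [sG _ _ _ _] := gradG.
  apply: (decomposes_eq_label (is_grading_decomposes gradG) xs _ x0).
  suff -> : x = y by [].
  apply/eqP; rewrite -subr_eq0 -memv0 -ker memv_cap memv_ker linearB /= Exy subrr eqxx /=.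
  by rewrite memvB // (subvP (sG _) _ xs, subvP (sG _) _ ys).
exists phi, a; split=> //; exists b => [s|t].
  by apply: inj; rewrite bE aE.
apply/val_inj/esym; have /vspace0Pn[x xt x0] := valP t.
by apply: (decomposes_eq_label decD xt _ x0); rewrite -aE bE.
Qed.

End Comparison.

(** * Fine gradings of Q and their equivalence *)

Section Main.
Variables (F : closedFieldType) (c : qcase) (n : nat).
Hypotheses (two_neq0 : 2%:R != 0 :> F) (n_ge2 : (2 <= n)%N).
Hypothesis lie_neq0 : c = Lie -> n.+1%:R != 0 :> F.

Local Notation M := 'M[F]_(qdim c n).
Local Notation S := (q0space F c n).
Local Notation p := (@q0prod F c n).
Local Notation q := (@qodd F c n).
Local Notation A0 := (Q0 F c n).
Local Notation AQ := (Q F c n).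

Let pb := q0prod_bilin F c n.
Let qb := qodd_bilin F c n.
Let ax0 := Q0_axioms F c n.
Let axQ := Q_axioms (n := n) lie_neq0.

(** Whenever [Gam] refines [Del], [tilde Gam] refines the fine grading [Xi], so its components are
    components of [Xi]. For an arbitrary refinement this shows that [Del] is fine; for the universal
    grading of [Del] it gives the isomorphism. *)
Lemma fine_grading_Q (K : zmodType) (Xi : K -> {vspace (M * M)%type}) : is_fine (A := AQ) Xi ->
  exists (G : zmodType) (Gam : G -> {vspace M}),
    [/\ is_fine (A := A0) Gam, has_univ_group (A := A0) Gam
      & exists f : {additive sqrt_ext (distinguished Gam) -> univ_group (A := AQ) Xi},
          bijective f /\ forall u, univ_grading (A := AQ) Xi (f u) = tilde Gam u].
Proof.
move=> fineX; have [gradX _] := fineX.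
have [Del [d [gradD degD XE]]] := grading_Q_qgraded two_neq0 n_ge2 lie_neq0 gradX.
have XiE : Xi = qgraded Del d by apply/funext.
have gradD0 := (is_grading_Q0 Del).2 gradD.
have tilde_eq (G : zmodType) (Gam : G -> {vspace M}) : prod_graded Gam -> refines Gam Del ->
    forall u k, tilde Gam u != 0%VS -> (tilde Gam u <= Xi k)%VS -> tilde Gam u = Xi k.
  move=> gradG ref; have gradT := tilde_grading two_neq0 n_ge2 lie_neq0 gradG.
  have refT : refines (tilde Gam) Xi by rewrite XiE; apply: tilde_refines.
  exact: (is_fine_refinement fineX gradT refT).
have fineD : is_fine (A := A0) Del.
  split=> // -[G [Gam [/is_grading_Q0 gradG [ref [g [k [g0 sub neq]]]]]]].
  have := tilde_eq _ _ gradG ref (sqrt_in _ g) k.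
  rewrite tilde_even XiE pairv_eq0 negb_and g0 pairv_sub sub sub0v => /(_ isT isT).
  by move=> /pairv_inj[E _]; rewrite E eqxx in neq.
pose Gam : univ_group (A := A0) Del -> {vspace M} := univ_grading (A := A0) Del.
have gradG0 : is_grading (A := A0) Gam := univ_grading_grading ax0 gradD0.
have gradG := (is_grading_Q0 Gam).1 gradG0.
have sameGD : same_components (A := A0) Gam Del := univ_grading_same gradD0.
have refG : refines Gam Del.
  by move=> g /sameGD[k E]; exists k; rewrite E subvv.
have univG : has_univ_group (A := A0) Gam := univ_grading_has_univ_group ax0 gradD0.
have fineG : is_fine (A := A0) Gam := is_fine_same fineD gradG0 sameGD.
exists (univ_group (A := A0) Del), Gam; split=> //.
have gradT := tilde_grading two_neq0 n_ge2 lie_neq0 gradG.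
have univT := tilde_has_univ_group two_neq0 n_ge2 lie_neq0 gradG univG.
apply: (same_components_univ_group (A := AQ) gradT gradX _ univT) => u Tu.
have [k uk] : exists k, (tilde Gam u <= Xi k)%VS by rewrite XiE; apply: tilde_refines refG u Tu.
by exists k; rewrite (tilde_eq _ _ gradG refG u k Tu uk).
Qed.

Lemma isomorphism_Q0P (phi : 'End(M)) : is_isomorphism (A := A0) (B := A0) phi <->
  [/\ (phi @: S)%VS = S, (lker phi :&: S)%VS = 0%VS
    & forall x y, x \in S -> y \in S -> phi (p x y) = p (phi x) (phi y)].
Proof.
rewrite /is_isomorphism /carrier /= addv0; split=> [[im ker mul _]|[im ker mul]] //.
by split=> // -[] /=; rewrite ?limg0 ?sub0v // im subvv.
Qed.

(* Transporting [q] along an automorphism of the even part gives a natural map. *)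
Lemma automorphism_qodd (phi : 'End(M)) : is_isomorphism (A := A0) (B := A0) phi ->
  exists2 a, a != 0 & forall x y, x \in S -> y \in S -> q (phi x) (phi y) = a *: phi (q x y).
Proof.
move=> /isomorphism_Q0P[im ker mul].
(* [psi] inverts [phi] on [S]. The outer projection is there because a preimage under
   [phi \o projv S] is determined only modulo the kernel of [projv S]. *)
pose psi := (projv S \o (phi \o projv S)^-1)%VF.
have phiS x : x \in S -> phi x \in S by move=> xS; rewrite -im memv_img.
have phi_inj x y : x \in S -> y \in S -> phi x = phi y -> x = y.
  move=> xS yS E; apply/eqP; rewrite -subr_eq0 -memv0 -ker memv_cap memv_ker linearB /= E.
  by rewrite subrr eqxx memvB.
have psiS x : psi x \in S by rewrite comp_lfunE memv_proj.
have phiK x : x \in S -> phi (psi x) = x.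
  move=> xS; rewrite comp_lfunE -[phi _]comp_lfunE limg_lfunVK //.
  by rewrite limg_comp limg_proj im.
have psiK x : x \in S -> psi (phi x) = x.
  by move=> xS; apply: phi_inj; rewrite ?phiK ?phiS.
have pS x y : p x y \in S by apply: q0prod_closed.
have qS x y : q x y \in S by apply: qodd_mem.
have psiM x y : x \in S -> y \in S -> psi (p x y) = p (psi x) (psi y).
  by move=> xS yS; apply: phi_inj; rewrite ?phiK // mul ?phiK.
have [qbil _ qC qD qJ] := qodd_natural lie_neq0.
pose f x y := psi (q (phi x) (phi y)).
have DS a b x : a \in S -> b \in S -> x \in S -> inner_der a b x \in S.
  by move=> *; rewrite /inner_der memvB.
have phiD a b x : a \in S -> b \in S -> x \in S ->
    phi (inner_der a b x) = inner_der (phi a) (phi b) (phi x).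
  by move=> aS bS xS; rewrite /inner_der linearB /= !mul.
have nf : natural_map f.
  split=> [|x y _ _|x y xS yS|a b x y aS bS xS yS|cJ x y z xS yS zS].
  - by split=> a x y z; rewrite /f !linearP /= ?(bilinDl qb) ?(bilinDr qb) ?(bilinZl qb)
      ?(bilinZr qb) linearP.
  - exact: psiS.
  - by rewrite /f qC ?phiS // linearZ.
  - apply: phi_inj; rewrite ?DS ?memvD ?psiS //.
    by rewrite phiD ?psiS // linearD /= /f !phiK // !phiD // qD ?phiS.
  - by rewrite /f mul // qJ ?phiS // linearD /= !psiM ?phiS // psiK ?psiK.
have [a fE] := natural_classification two_neq0 n_ge2 lie_neq0 nf.
exists a => [|x y xS yS]; last by rewrite -[q _ _]phiK // -/(f x y) fE // linearZ.
apply/eqP=> a0.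
have [x [y [z [xS yS _ /eqP]]]] := @qodd_neq0 F c n two_neq0 n_ge2; apply.
have /memv_imgP[x' x'S ->] : x \in (phi @: S)%VS by rewrite im.
have /memv_imgP[y' y'S ->] : y \in (phi @: S)%VS by rewrite im.
by rewrite -[q _ _]phiK // -/(f x' y') fE // a0 scale0r linear0 (bilin0l pb).
Qed.

Lemma mem_even_part (x : M * M) : x \in pairv S 0 -> x = (x.1, 0) /\ x.1 \in S.
Proof. by case: x => a b; rewrite mem_pairv memv0 /= => /andP[aS /eqP->]. Qed.

Lemma mem_odd_part (x : M * M) : x \in pairv 0 S -> x = (0, x.2) /\ x.2 \in S.
Proof. by case: x => a b; rewrite mem_pairv memv0 /= => /andP[/eqP-> bS]. Qed.

Section Equivalence.
Variables (G H : zmodType) (Gam : G -> {vspace M}) (Del : H -> {vspace M}).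
Hypotheses (gradG : prod_graded Gam) (gradD : prod_graded Del).

Let gradG0 := (is_grading_Q0 Gam).2 gradG.
Let gradD0 := (is_grading_Q0 Del).2 gradD.
Let gradTG := tilde_grading two_neq0 n_ge2 lie_neq0 gradG.
Let gradTD := tilde_grading two_neq0 n_ge2 lie_neq0 gradD.

Lemma equivalent_tilde : equivalent (A := A0) (B := A0) Gam Del ->
  equivalent (A := AQ) (B := AQ) (tilde Gam) (tilde Del).
Proof.
move=> [phi [al [iso [be alK beK] phiE]]].
have [a a_neq0 qphi] := automorphism_qodd iso.
have /isomorphism_Q0P[im ker mul] := iso.
(* Scaling the odd part by [r] multiplies odd products by r^2, which cancels the factor [a] from
   [automorphism_qodd]. *)
have [r r2] : exists r : F, r ^+ 2 = a^-1.
  by have [r] := @solve_monicpoly F 2 (fun i => if i == 0%N then a^-1 else 0) isT;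
    rewrite !big_ord_recl big_ord0 /= mul0r !addr0 expr0 mulr1; exists r.
have r_neq0 : r != 0 by rewrite -sqrf_eq0 r2 invr_eq0.
have [|Phi PhiE] := @lfun_of_linear F (M * M)%type (M * M)%type (fun x => (phi x.1, r *: phi x.2)).
  by move=> b x y; congr (_, _); rewrite /= !linearP //= scalerDr !scalerA mulrC.
have Phi_pair (X Y : {vspace M}) : (Phi @: pairv X Y = pairv (phi @: X) (phi @: Y))%VS.
  apply/vspaceP=> x; rewrite mem_pairv; apply/memv_imgP/andP => [[y + ->]|].
    by rewrite mem_pairv PhiE => /andP[y1 y2] /=; rewrite memvZ ?memv_img.
  move=> [/memv_imgP[x1 x1X E1] /memv_imgP[x2 x2Y E2]].
  exists (x1, r^-1 *: x2); first by rewrite mem_pairv /= x1X memvZ.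
  by rewrite PhiE /= linearZ /= scalerA divff // scale1r -E1 -E2; case: (x).
have isoQ : is_isomorphism (A := AQ) (B := AQ) Phi.
  have partE j : (Phi @: part AQ j)%VS = part AQ j.
    by case: j => /=; rewrite Phi_pair limg0 im.
  split=> [|||j].
  - by rewrite /carrier limgD !partE.
  - apply/eqP; rewrite -subv0; apply/subvP=> x.
    rewrite memv_cap memv_ker mem_carrier_Q memv0 PhiE.
    case: x => x y /= /andP[/eqP[x0 /eqP]]; rewrite scaler_eq0 (negbTE r_neq0) /= => y0 /andP[xS yS].
    have zero z : phi z = 0 -> z \in S -> z = 0.
      by move=> z0 zS; apply/eqP; rewrite -memv0 -ker memv_cap memv_ker z0 eqxx.
    by rewrite (zero x) // (zero y) //; apply/eqP.
  - move=> x y; rewrite !mem_carrier_Q => /andP[x1 x2] /andP[y1 y2].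
    rewrite !PhiE /= !linearD /= !mul //; congr (_, _) => /=.
      rewrite (bilinZl qb) (bilinZr qb) qphi // !scalerA -mulrA [r * a]mulrC mulrA.
      by rewrite mulrAC -expr2 r2 mulVf // scale1r.
    by rewrite ?scalerDr (bilinZl pb) (bilinZr pb).
  - by rewrite partE subvv.
apply: (equivalentI gradTG gradTD isoQ) => [u|u].
  have [g g0 E] := tilde_supp (valP u); pose s : supp Gam := exist (fun g => Gam g != 0%VS) g g0.
  have sE : (phi @: Gam g)%VS = Del (val (al s)) := phiE s.
  have ev : tilde Del (sqrt_in _ (val (al s))) != 0%VS.
    by rewrite tilde_even pairv_eq0 (negbTE (valP (al s))).
  have od : tilde Del (sqrt_in _ (val (al s)) + sqrt_elt _) != 0%VS.
    by rewrite tilde_odd pairv_eq0 (negbTE (valP (al s))) andbF.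
  case: E => ->; [exists (exist (fun u => tilde Del u != 0%VS) _ ev) | exists (exist (fun u => tilde Del u != 0%VS) _ od)] => /=.
    by rewrite !tilde_even Phi_pair limg0 sE.
  by rewrite !tilde_odd Phi_pair limg0 sE.
have [g g0 E] := tilde_supp (valP u); pose t : supp Del := exist (fun g => Del g != 0%VS) g g0.
have tE : (phi @: Gam (val (be t)))%VS = Del g by rewrite phiE beK.
have ev : tilde Gam (sqrt_in _ (val (be t))) != 0%VS.
  by rewrite tilde_even pairv_eq0 (negbTE (valP (be t))).
have od : tilde Gam (sqrt_in _ (val (be t)) + sqrt_elt _) != 0%VS.
  by rewrite tilde_odd pairv_eq0 (negbTE (valP (be t))) andbF.
case: E => ->; [exists (exist (fun u => tilde Gam u != 0%VS) _ ev) | exists (exist (fun u => tilde Gam u != 0%VS) _ od)] => /=.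
  by rewrite !tilde_even Phi_pair limg0 tE.
by rewrite !tilde_odd Phi_pair limg0 tE.
Qed.

Lemma tilde_equivalent : equivalent (A := AQ) (B := AQ) (tilde Gam) (tilde Del) ->
  equivalent (A := A0) (B := A0) Gam Del.
Proof.
move=> [Phi [al [[imQ kerQ mulQ partQ] [be alK beK] PhiE]]].
(* [Phi] preserves parity, so the first coordinate carries its whole restriction to the even
   part. *)
have [|phi phiE] := @lfun_of_linear F M M (fun x => (Phi (x, 0)).1).
  move=> a x y; have -> : (a *: x + y, 0) = a *: (x, 0) + (y, 0) :> (M * M)%type.
    by congr (_, _); rewrite /= scaler0 addr0.
  by rewrite linearP.
have PhiEv x : x \in S -> Phi (x, 0) = (phi x, 0) /\ phi x \in S.
  move=> xS; have : Phi (x, 0) \in (Phi @: part AQ false)%VS.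
    by apply: memv_img; rewrite /= mem_pairv /= xS mem0v.
  by move=> /(subvP (partQ false)) /mem_even_part[]; rewrite phiE.
have PhiOd x : x \in S -> (Phi (0, x)).1 = 0.
  move=> xS; have : Phi (0, x) \in (Phi @: part AQ true)%VS.
    by apply: memv_img; rewrite /= mem_pairv /= xS mem0v.
  by move=> /(subvP (partQ true)) /mem_odd_part[-> _].
have iso : is_isomorphism (A := A0) (B := A0) phi.
  apply/isomorphism_Q0P; split.
  - apply/eqP; rewrite eqEsubv; apply/andP; split.
      by apply/subvP=> _ /memv_imgP[x /PhiEv[_ xS] ->].
    apply/subvP=> x xS; have : (x, 0) \in carrier AQ by rewrite mem_carrier_Q /= xS mem0v.
    rewrite -imQ => /memv_imgP[[y z]]; rewrite mem_carrier_Q => /andP[/= yS zS] E.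
    apply/memv_imgP; exists y => //.
    have : (y, z) = (y, 0) + (0, z) by congr (_, _); rewrite /= ?addr0 ?add0r.
    move=> yz; move: E; rewrite yz linearD /= => /(congr1 fst) /= ->.
    by rewrite PhiOd // addr0 (PhiEv y yS).1.
  - apply/eqP; rewrite -subv0; apply/subvP=> x; rewrite memv_cap memv_ker memv0 => /andP[/eqP x0 xS].
    have : (x, 0) \in (lker Phi :&: carrier AQ)%VS.
      by rewrite memv_cap memv_ker (PhiEv x xS).1 x0 eqxx mem_carrier_Q /= xS mem0v.
    by rewrite kerQ memv0 => /eqP[->].
  - move=> x y xS yS; have mem z : z \in S -> (z, 0) \in carrier AQ.
      by move=> zS; rewrite mem_carrier_Q /= zS mem0v.
    have := mulQ _ _ (mem x xS) (mem y yS); rewrite (PhiEv x xS).1 (PhiEv y yS).1 /=.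
    rewrite !(bilin0l qb) !(bilin0l pb) !(bilin0r pb) !addr0.
    by rewrite (PhiEv _ (q0prod_closed x y)).1 => -[].
have Phi_pair (X : {vspace M}) : (X <= S)%VS -> (Phi @: pairv X 0 = pairv (phi @: X) 0)%VS.
  move=> /subvP XS; apply/vspaceP=> x; rewrite mem_pairv memv0; apply/memv_imgP/andP => [[y + ->]|].
    case: y => y1 y2; rewrite mem_pairv memv0 /= => /andP[y1X /eqP->].
    by rewrite (PhiEv y1 (XS _ y1X)).1 /= memv_img.
  case: x => x1 x2 /= [/memv_imgP[y yX ->] /eqP->]; exists (y, 0).
    by rewrite mem_pairv /= yX mem0v.
  by rewrite (PhiEv y (XS _ yX)).1.
have [sG _ _] := gradG.1.
apply: (equivalentI gradG0 gradD0 iso) => [s|t].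
  have ev : tilde Gam (sqrt_in _ (val s)) != 0%VS.
    by rewrite tilde_even pairv_eq0 (negbTE (valP s)).
  have := PhiE (exist (fun u => tilde Gam u != 0%VS) _ ev).
  rewrite /= tilde_even Phi_pair ?sG // => E.
  have [k k0 [Ek|Ek]] := tilde_supp (valP (al (exist (fun u => tilde Gam u != 0%VS) _ ev))).
    exists (exist (fun k => Del k != 0%VS) k k0) => /=.
    by move: E; rewrite Ek tilde_even => /pairv_inj[].
  by move: E; rewrite Ek tilde_odd => /pairv_inj[_ E]; rewrite E eqxx in k0.
have ev : tilde Del (sqrt_in _ (val t)) != 0%VS.
  by rewrite tilde_even pairv_eq0 (negbTE (valP t)).
pose t' : supp (tilde Del) := exist (fun u => tilde Del u != 0%VS) _ ev.
have := PhiE (be t'); rewrite beK /= tilde_even => E.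
have [g g0 [Eg|Eg]] := tilde_supp (valP (be t')).
  exists (exist (fun g => Gam g != 0%VS) g g0) => /=.
  by move: E; rewrite Eg tilde_even Phi_pair ?sG // => /pairv_inj[].
(* An odd component has an odd image, whereas [Del (val t)] contains a nonzero even vector. *)
move: E; rewrite Eg tilde_odd => E; have /vspace0Pn[x xt /eqP] := valP t; case.
have : (x, 0) \in (Phi @: pairv 0 (Gam g))%VS by rewrite E mem_pairv /= xt mem0v.
move=> /memv_imgP[[y z]]; rewrite mem_pairv memv0 /= => /andP[/eqP-> zg] /(congr1 fst) /= ->.
by apply: PhiOd; apply: subvP zg.
Qed.

End Equivalence.
End Main.

Theorem theorem5p7 (F : closedFieldType) (c : qcase) (n : nat)
    (char_neq2 : 2%N \notin [pchar F])
    (n_ge2 : (2 <= n)%N)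
    (char_Lie : c = Lie -> forall p : nat, p \in [pchar F] -> ~~ (p %| n.+1)%N) :
  (forall (G : zmodType) (Gam : G -> {vspace 'M[F]_(qdim c n)}),
     is_fine (A := Q0 F c n) Gam -> has_univ_group (A := Q0 F c n) Gam ->
     is_fine (A := Q F c n) (tilde Gam) /\
     has_univ_group (A := Q F c n) (tilde Gam))
  /\
  (forall (K : zmodType)
          (Xi : K -> {vspace ('M[F]_(qdim c n) * 'M[F]_(qdim c n))%type}),
     is_fine (A := Q F c n) Xi ->
     exists (G : zmodType) (Gam : G -> {vspace 'M[F]_(qdim c n)}),
       [/\ is_fine (A := Q0 F c n) Gam,
           has_univ_group (A := Q0 F c n) Gam
         & exists f : {additive sqrt_ext (distinguished Gam)
                         -> univ_group (A := Q F c n) Xi},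
             bijective f /\
             forall q, univ_grading (A := Q F c n) Xi (f q) = tilde Gam q])
  /\
  (forall (G H : zmodType) (Gam : G -> {vspace 'M[F]_(qdim c n)})
          (Del : H -> {vspace 'M[F]_(qdim c n)}),
     is_fine (A := Q0 F c n) Gam -> has_univ_group (A := Q0 F c n) Gam ->
     is_fine (A := Q0 F c n) Del -> has_univ_group (A := Q0 F c n) Del ->
     (equivalent (A := Q F c n) (B := Q F c n) (tilde Gam) (tilde Del) <->
      equivalent (A := Q0 F c n) (B := Q0 F c n) Gam Del)).
Proof.
have two_neq0 : 2%:R != 0 :> F by move: char_neq2; rewrite inE.
have lie_neq0 : c = Lie -> n.+1%:R != 0 :> F.
  move=> cL; rewrite natf_neq0_pchar; apply/pnatP=> // p _ p_dvd.
  by rewrite inE /=; apply: contraL p_dvd; apply: char_Lie.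
have graded (G : zmodType) (Gam : G -> {vspace 'M[F]_(qdim c n)}) :
    is_fine (A := Q0 F c n) Gam -> prod_graded Gam by move=> [/is_grading_Q0].
split=> [G Gam fineG univG|]; first split.
- exact: (tilde_fine two_neq0 n_ge2 lie_neq0 (graded _ _ fineG) fineG).
- exact: (tilde_has_univ_group two_neq0 n_ge2 lie_neq0 (graded _ _ fineG) univG).
split=> [K Xi|G H Gam Del /graded gradG _ /graded gradD _]; first exact: fine_grading_Q.
split; first exact: tilde_equivalent.
exact: equivalent_tilde.
Qed.
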